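(* Let $(\mathbb{L},\mathbb{R})$ be an accessible algebraic weak factorization system on a locally presentable category $\mathsf{M}$, with underlying weak factorization system $(\mathcal{L},\mathcal{R})$. There exist accessible algebraic weak factorization systems $(\mathbb{L}^\sharp,\mathbb{R}^\sharp)$ and $(\mathbb{L}^\flat,\mathbb{R}^\flat)$ on $\mathsf{M}$ characterised by isomorphisms of double categories $$\mathbb{C}\mathsf{oalg}_{\mathbb{L}^\sharp}\cong\mathbb{C}\mathsf{lov}(\mathcal{L})\qquad\text{and}\qquad \mathbb{A}\mathsf{lg}^{\mathbb{R}^\flat}\cong\mathbb{C}\mathsf{lov}(\mathcal{R})$$ over $\mathbb{S}\mathsf{q}(\mathsf{M})$. Furthermore, $(\mathbb{L}^\sharp,\mathbb{R}^\sharp)$ is left-retract-closed, $(\mathbb{L}^\flat,\mathbb{R}^\flat)$ is right-retract-closed, and both have the same underlying weak factorization system as $(\mathbb{L},\mathbb{R})$.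
   Context: Algebraic weak factorization systems. $\mathsf{M}^{\mathbf 2}$ is the arrow category. A functorial factorization on $\mathsf{M}$ assigns to each $f\colon X\to Y$, functorially in $f\in\mathsf{M}^{\mathbf 2}$, a factorization $X\xrightarrow{Lf}Ef\xrightarrow{Rf}Y$ of $f$; this gives a functor $E\colon\mathsf{M}^{\mathbf 2}\to\mathsf{M}$, endofunctors $L,R$ of $\mathsf{M}^{\mathbf 2}$, and natural transformations $\vec\eta\colon 1\Rightarrow R$, $\vec\epsilon\colon L\Rightarrow 1$ with $\vec\eta_f=(Lf,1)\colon f\to Rf$ and $\vec\epsilon_f=(1,Rf)\colon Lf\to f$. An algebraic weak factorization system $(\mathbb{L},\mathbb{R})$ on $\mathsf{M}$ is a comonad $\mathbb{L}=(L,\vec\epsilon,\vec\delta)$ and a monad $\mathbb{R}=(R,\vec\eta,\vec\mu)$ on $\mathsf{M}^{\mathbf 2}$ with $L,R,\vec\epsilon,\vec\eta$ arising from a functorial factorization in this way, such that, writing $\vec\delta_f=(1,\delta_f)\colon Lf\to LLf$ with $\delta_f\colon Ef\to ELf$ and $\vec\mu_f=(\mu_f,1)\colon RRf\to Rf$ with $\mu_f\colon ERf\to Ef$, the maps $(\delta_f,\mu_f)\colon LRf\to RLf$ constitute a distributive law of the comonad $\mathbb{L}$ over the monad $\mathbb{R}$. It is accessible if $\mathsf{M}$ is locally presentable and $E$ is an accessible functor. Cloven maps and the underlying weak factorization system. A cloven $\mathcal{L}$-map $(f,s)\colon A\to B$ is a map $f\colon A\to B$ with a map $s\colon B\to Ef$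 such that $sf=Lf$ and $Rf\cdot s=1_B$; a morphism $(f,s)\to(g,t)$ is a commutative square $(h,k)\colon f\to g$ with $E(h,k)\cdot s=t\cdot k$. Dually a cloven $\mathcal{R}$-map $(g,p)\colon C\to D$ is a map $g\colon C\to D$ with a map $p\colon Eg\to C$ such that $p\cdot Lg=1_C$ and $g\cdot p=Rg$; a morphism $(g,p)\to(g',p')$ is a commutative square $(h,k)\colon g\to g'$ with $h\cdot p=p'\cdot E(h,k)$. The underlying weak factorization system $(\mathcal{L},\mathcal{R})$ of $(\mathbb{L},\mathbb{R})$ has as $\mathcal{L}$ (resp. $\mathcal{R}$) the class of maps admitting a cloven $\mathcal{L}$-map (resp. cloven $\mathcal{R}$-map) structure. Double categories. A double category is an internal category in $\mathsf{CAT}$. $\mathbb{S}\mathsf{q}(\mathsf{M})$ has the objects of $\mathsf{M}$, both horizontal and vertical arrows the arrows of $\mathsf{M}$, and squares the commutative squares. $\mathbb{C}\mathsf{lov}(\mathcal{L})\to\mathbb{S}\mathsf{q}(\mathsf{M})$ is the double category over $\mathbb{S}\mathsf{q}(\mathsf{M})$ with objects and horizontal arrows those of $\mathsf{M}$, vertical arrows the cloven $\mathcal{L}$-maps, and squares the morphisms of cloven $\mathcal{L}$-maps; the vertical composite of $(f,s)\colon A\to B$ and $(g,t)\colon B\to C$ is $(gf,\ \mu_{gf}\cdot E(w,1_C)\cdot t)$ with $w=\mu_{gf}\cdot E(L(gf),g)\cdot s\colon B\to E(gf)$, and the vertical identity at $A$ is $(1_A,L1_A)$. $\mathbb{C}\mathsf{lov}(\mathcal{R})\to\mathbb{S}\mathsf{q}(\mathsf{M})$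 is the double category over $\mathbb{S}\mathsf{q}(\mathsf{M})$ with objects and horizontal arrows those of $\mathsf{M}$, vertical arrows the cloven $\mathcal{R}$-maps, and squares their morphisms; the vertical composite of $(f,p)\colon A\to B$ and $(g,q)\colon B\to C$ is $(gf,\ p\cdot E(1_A,v)\cdot\delta_{gf})$ with $v=q\cdot E(f,R(gf))\cdot\delta_{gf}\colon E(gf)\to B$, and the vertical identity at $A$ is $(1_A,R1_A)$. (Equivalently, identifying a cloven $\mathcal{L}$-map $(f,s)$ with the natural choice of fillers $p\cdot E(h,k)\cdot s$ for squares $(h,k)\colon f\to g$ into $\mathbb{R}$-algebras $(g,p)$, composition is given by lifting first against $f$ and then against $g$; dually for cloven $\mathcal{R}$-maps.) For any algebraic weak factorization system $(\mathbb{L},\mathbb{R})$ on $\mathsf{M}$, $\mathbb{C}\mathsf{oalg}_{\mathbb{L}}$ is the double category over $\mathbb{S}\mathsf{q}(\mathsf{M})$ whose objects and horizontal arrows are those of $\mathsf{M}$, whose vertical arrows are the coalgebras for the comonad $\mathbb{L}$ (that is, those cloven $\mathcal{L}$-maps $(f,s)$, for the functorial factorization of $(\mathbb{L},\mathbb{R})$, with $\delta_f\cdot s=E(1,s)\cdot s$), whose squares are the coalgebra maps, in which the vertical composite of $(f,s)\colon A\to B$ and $(g,t)\colon B\to C$ is $(gf,\ \mu_{gf}\cdot E(w,1_C)\cdot t)$ with $w=\mu_{gf}\cdot E(L(gf),g)\cdot s\colon B\to E(gf)$, and in which the vertical identity at $A$ is $(1_A,L1_A)$; $\mathbb{A}\mathsf{lg}^{\mathbb{R}}$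 is likewise the double category over $\mathbb{S}\mathsf{q}(\mathsf{M})$ of algebras for the monad $\mathbb{R}$ (those cloven $\mathcal{R}$-maps $(g,p)$ with $p\cdot\mu_g=p\cdot E(p,1)$), in which the vertical composite of $(f,p)\colon A\to B$ and $(g,q)\colon B\to C$ is $(gf,\ p\cdot E(1_A,v)\cdot\delta_{gf})$ with $v=q\cdot E(f,R(gf))\cdot\delta_{gf}\colon E(gf)\to B$, and the vertical identity at $A$ is $(1_A,R1_A)$. Retract-closure. $(\mathbb{L},\mathbb{R})$ is left-retract-closed if the class of maps of $\mathsf{M}$ admitting an $\mathbb{L}$-coalgebra structure is closed under retracts (in $\mathsf{M}^{\mathbf 2}$), and right-retract-closed if the class of maps admitting an $\mathbb{R}$-algebra structure is closed under retracts. *)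

(* Defs.v *)
From Stdlib Require Import ProofIrrelevance FunctionalExtensionality.
From Corelib Require Import ssreflect.

Set Implicit Arguments.
Unset Strict Implicit.
Unset Printing Implicit Defensive.

(** Small sets are the types in [Set]; classes are the types in [Type].
    Categories are locally small.  Proof irrelevance is used so that morphisms in arrow categories
    and squares in double categories are determined by their components. *)

Record Category := {
  ob :> Type;
  hom : ob -> ob -> Set;
  idm : forall A, hom A A;
  comp : forall A B C, hom B C -> hom A B -> hom A C;
  comp_assoc : forall A B C D (h : hom C D) (g : hom B C) (f : hom A B),
    comp h (comp g f) = comp (comp h g) f;
  comp_idl : forall A B (f : hom A B), comp (idm B) f = f;
  comp_idr : forall A B (f : hom A B), comp f (idm A) = f }.

Arguments hom {c} A B.
Arguments idm {c} A.
Arguments comp {c A B C} g f.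
Notation "g ∘ f" := (comp g f) (at level 40, left associativity).

Record Functor (C D : Category) := {
  fob :> C -> D;
  fmap : forall A B, hom A B -> hom (fob A) (fob B);
  fmap_id : forall A, fmap (idm A) = idm (fob A);
  fmap_comp : forall A B X (g : hom B X) (f : hom A B),
    fmap (g ∘ f) = fmap g ∘ fmap f }.

Arguments fmap {C D} F {A B} f : rename.

Definition id_functor (C : Category) : Functor C C :=
  {| fob := fun A => A; fmap := fun A B f => f;
     fmap_id := fun A => eq_refl; fmap_comp := fun A B X g f => eq_refl |}.

Definition comp_functor (B C D : Category) (G : Functor C D) (F : Functor B C) :
  Functor B D.
Proof.
refine {| fob := fun A => G (F A); fmap := fun X Y f => fmap G (fmap F f) |}.
- by move=> A; rewrite !fmap_id.
- by move=> X Y Z g f; rewrite !fmap_comp.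
Defined.

Record NatTrans (C D : Category) (F G : Functor C D) := {
  component :> forall A, hom (F A) (G A);
  naturality : forall A B (f : hom A B),
    component B ∘ fmap F f = fmap G f ∘ component A }.

Definition invertible (C : Category) (A B : C) (f : hom A B) : Prop :=
  exists g : hom B A, g ∘ f = idm A /\ f ∘ g = idm B.

Definition isomorphic (C : Category) (A B : C) : Prop :=
  exists f : hom A B, invertible f.

Definition SET : Category :=
  {| ob := Set; hom := fun A B => A -> B;
     idm := fun A x => x; comp := fun A B C g f x => g (f x);
     comp_assoc := fun A B C D h g f => eq_refl;
     comp_idl := fun A B f => eq_refl;
     comp_idr := fun A B f => eq_refl |}.

Definition hom_functor (C : Category) (X : C) : Functor C SET.
Proof.
refine (@Build_Functor C SET (fun A => hom X A) (fun A B f g => f ∘ g) _ _).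
- by move=> A; apply: functional_extensionality => g /=; rewrite comp_idl.
- by move=> A B Y g f; apply: functional_extensionality => x /=;
    rewrite comp_assoc.
Defined.

Record Cocone (J C : Category) (D : Functor J C) := {
  apex : C;
  leg : forall j, hom (D j) apex;
  leg_nat : forall i j (u : hom i j), leg j ∘ fmap D u = leg i }.

Definition is_colimit (J C : Category) (D : Functor J C) (c : Cocone D) : Prop :=
  forall d : Cocone D,
    exists! m : hom (apex c) (apex d), forall j, m ∘ leg c j = leg d j.

Definition map_cocone (J C C' : Category) (F : Functor C C') (D : Functor J C)
  (c : Cocone D) : Cocone (comp_functor F D).
Proof.
refine {| apex := F (apex c) : C';
          leg := fun j => fmap F (leg c j) : hom (comp_functor F D j) _ |}.
by move=> i j u /=; rewrite -fmap_comp leg_nat.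
Defined.

Definition small (J : Category) : Prop :=
  exists (S : Set) (e : S -> J) (e' : J -> S),
    (forall s, e' (e s) = s) /\ (forall j, e (e' j) = j).

Definition cocomplete (C : Category) : Prop :=
  forall (J : Category) (D : Functor J C), small J ->
    exists c : Cocone D, is_colimit c.

Definition card_le (A B : Type) : Prop :=
  exists f : A -> B, forall x y, f x = f y -> x = y.

Definition card_lt (A B : Type) : Prop := card_le A B /\ ~ card_le B A.

(** A cardinal is represented by a set of that cardinality. *)
Definition regular_cardinal (K : Set) : Prop :=
  card_le nat K /\
  forall (I : Set) (F : I -> Set),
    card_lt I K -> (forall i, card_lt (F i) K) -> card_lt {i : I & F i} K.

Definition arrows (C : Category) : Type := {A : C & {B : C & hom A B}}.

Definition filtered (K : Set) (J : Category) : Prop :=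
  forall (I : Category) (D : Functor I J), card_lt (arrows I) K ->
    inhabited (Cocone D).

Definition preserves_filtered_colimits (K : Set) (C C' : Category)
  (F : Functor C C') : Prop :=
  forall (J : Category) (D : Functor J C) (c : Cocone D),
    small J -> filtered K J -> is_colimit c -> is_colimit (map_cocone F c).

Definition presentable (K : Set) (C : Category) (X : C) : Prop :=
  preserves_filtered_colimits K (hom_functor X).

Definition locally_presentable (C : Category) : Prop :=
  cocomplete C /\
  exists K : Set, regular_cardinal K /\
  exists (I : Set) (G : I -> C),
    (forall i, presentable K (G i)) /\
    forall X : C,
      exists (J : Category) (D : Functor J C) (c : Cocone D),
        small J /\ filtered K J /\
        (forall j, exists i, isomorphic (D j) (G i)) /\
        is_colimit c /\ apex c = X.

(** Only meant for functors between locally presentable categories, where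
    preserving K-filtered colimits for some regular K suffices. *)
Definition accessible_functor (C C' : Category) (F : Functor C C') : Prop :=
  exists K : Set, regular_cardinal K /\ preserves_filtered_colimits K F.

Set Primitive Projections.

Record arrow (M : Category) := mkArrow {
  adom : M; acod : M; amap : hom adom acod }.

Record square (M : Category) (f g : arrow M) := mkSquare {
  sdom : hom (adom f) (adom g);
  scod : hom (acod f) (acod g);
  scomm : scod ∘ amap f = amap g ∘ sdom }.

Unset Primitive Projections.

Arguments mkArrow {M adom acod} amap.
Arguments mkSquare {M f g} sdom scod scomm.

Lemma square_ext (M : Category) (f g : arrow M) (x y : square f g) :
  sdom x = sdom y -> scod x = scod y -> x = y.
Proof.
case: x => h k c; case: y => h' k' c' /= eh ek.
by subst h' k'; rewrite (proof_irrelevance _ c c').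
Qed.

Definition id_square (M : Category) (f : arrow M) : square f f.
Proof. by exists (idm _) (idm _); rewrite comp_idl comp_idr. Defined.

Definition comp_square (M : Category) (f g h : arrow M)
  (y : square g h) (x : square f g) : square f h.
Proof.
exists (sdom y ∘ sdom x) (scod y ∘ scod x).
by rewrite -comp_assoc scomm comp_assoc scomm comp_assoc.
Defined.

Definition Arrow (M : Category) : Category.
Proof.
refine {| ob := arrow M; hom := @square M;
          idm := @id_square M; comp := @comp_square M |}.
- by move=> *; apply: square_ext; apply: comp_assoc.
- by move=> *; apply: square_ext; apply: comp_idl.
- by move=> *; apply: square_ext; apply: comp_idr.
Defined.

Definition is_retract (C : Category) (A B : C) : Prop :=
  exists (i : hom A B) (r : hom B A), r ∘ i = idm A.

Definition is_comonad (C : Category) (L : Functor C C)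
  (eps : NatTrans L (id_functor C)) (del : NatTrans L (comp_functor L L)) :
  Prop :=
  (forall A, (eps (L A) : hom (L (L A)) (L A)) ∘ del A = idm (L A)) /\
  (forall A, fmap L (eps A) ∘ del A = idm (L A)) /\
  (forall A, (del (L A) : hom (L (L A)) (L (L (L A)))) ∘ del A
             = fmap L (del A) ∘ del A).

Definition is_monad (C : Category) (R : Functor C C)
  (eta : NatTrans (id_functor C) R) (mu : NatTrans (comp_functor R R) R) :
  Prop :=
  (forall A, mu A ∘ (eta (R A) : hom (R A) (R (R A))) = idm (R A)) /\
  (forall A, mu A ∘ fmap R (eta A) = idm (R A)) /\
  (forall A, mu A ∘ (mu (R A) : hom (R (R (R A))) (R (R A)))
             = mu A ∘ fmap R (mu A)).

Definition is_distributive_law (C : Category) (L R : Functor C C)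
  (eps : NatTrans L (id_functor C)) (del : NatTrans L (comp_functor L L))
  (eta : NatTrans (id_functor C) R) (mu : NatTrans (comp_functor R R) R)
  (lam : NatTrans (comp_functor L R) (comp_functor R L)) : Prop :=
  (forall A, fmap R (eps A) ∘ (lam A : hom (L (R A)) (R (L A)))
             = eps (R A)) /\
  (forall A, (lam A : hom (L (R A)) (R (L A))) ∘ fmap L (eta A)
             = eta (L A)) /\
  (forall A, fmap R (del A) ∘ (lam A : hom (L (R A)) (R (L A)))
             = (lam (L A) : hom (L (R (L A))) (R (L (L A))))
               ∘ fmap L (lam A) ∘ del (R A)) /\
  (forall A, (lam A : hom (L (R A)) (R (L A))) ∘ fmap L (mu A)
             = mu (L A) ∘ fmap R (lam A)
               ∘ (lam (R A) : hom (L (R (R A))) (R (L (R A))))).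

Record FunctorialFactorization (M : Category) := {
  ffE :> Functor (Arrow M) M;
  ffL : forall f : arrow M, hom (adom f) (ffE f);
  ffR : forall f : arrow M, hom (ffE f) (acod f);
  ff_fact : forall f : arrow M, ffR f ∘ ffL f = amap f;
  ffL_nat : forall (f g : arrow M) (x : square f g),
    fmap ffE x ∘ ffL f = ffL g ∘ sdom x;
  ffR_nat : forall (f g : arrow M) (x : square f g),
    scod x ∘ ffR f = ffR g ∘ fmap ffE x }.

Arguments ffL {M} F f : rename.
Arguments ffR {M} F f : rename.

Section FactorizationFunctors.

Variables (M : Category) (F : FunctorialFactorization M).

Definition Lfunctor : Functor (Arrow M) (Arrow M).
Proof.
refine (@Build_Functor (Arrow M) (Arrow M) (fun f => mkArrow (ffL F f))
  (fun f g x => @mkSquare M (mkArrow (ffL F f)) (mkArrow (ffL F g))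
                  (sdom x) (fmap F x) (ffL_nat F x)) _ _).
- by move=> f; apply: square_ext => //=; rewrite fmap_id.
- by move=> f g h y x; apply: square_ext => //=; rewrite fmap_comp.
Defined.

Definition Rfunctor : Functor (Arrow M) (Arrow M).
Proof.
refine (@Build_Functor (Arrow M) (Arrow M) (fun f => mkArrow (ffR F f))
  (fun f g x => @mkSquare M (mkArrow (ffR F f)) (mkArrow (ffR F g))
                  (fmap F x) (scod x) (ffR_nat F x)) _ _).
- by move=> f; apply: square_ext => //=; rewrite fmap_id.
- by move=> f g h y x; apply: square_ext => //=; rewrite fmap_comp.
Defined.

Lemma Rpoint_comm (f : arrow M) : idm (acod f) ∘ amap f = ffR F f ∘ ffL F f.
Proof. by rewrite comp_idl ff_fact. Qed.

Definition Rpoint : NatTrans (id_functor (Arrow M)) Rfunctor.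
Proof.
refine (@Build_NatTrans _ _ (id_functor (Arrow M)) Rfunctor
  (fun f : arrow M => @mkSquare M f (mkArrow (ffR F f)) (ffL F f)
                        (idm (acod f)) (Rpoint_comm f)) _).
move=> f g x; apply: square_ext => /=; first by rewrite ffL_nat.
by rewrite comp_idl comp_idr.
Defined.

Lemma Lcopoint_comm (f : arrow M) : ffR F f ∘ ffL F f = amap f ∘ idm (adom f).
Proof. by rewrite comp_idr ff_fact. Qed.

Definition Lcopoint : NatTrans Lfunctor (id_functor (Arrow M)).
Proof.
refine (@Build_NatTrans _ _ Lfunctor (id_functor (Arrow M))
  (fun f : arrow M => @mkSquare M (mkArrow (ffL F f)) f (idm (adom f))
                        (ffR F f) (Lcopoint_comm f)) _).
move=> f g x; apply: square_ext => /=; last by rewrite ffR_nat.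
by rewrite comp_idl comp_idr.
Defined.

End FactorizationFunctors.

(** The counit and unit laws force the components of [awfs_comult] and
    [awfs_mult] to be of the form [(1, delta f)] and [(mu f, 1)]; see
    [comult_dom] and [mult_cod]. *)
Record AWFS (M : Category) := {
  awfs_ff :> FunctorialFactorization M;
  awfs_comult : NatTrans (Lfunctor awfs_ff)
                  (comp_functor (Lfunctor awfs_ff) (Lfunctor awfs_ff));
  awfs_mult : NatTrans (comp_functor (Rfunctor awfs_ff) (Rfunctor awfs_ff))
                (Rfunctor awfs_ff);
  awfs_comonad : is_comonad (Lcopoint awfs_ff) awfs_comult;
  awfs_monad : is_monad (Rpoint awfs_ff) awfs_mult;
  awfs_distr :
    exists lam : NatTrans (comp_functor (Lfunctor awfs_ff) (Rfunctor awfs_ff))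
                   (comp_functor (Rfunctor awfs_ff) (Lfunctor awfs_ff)),
      (forall f : arrow M,
        sdom (lam f) = scod (awfs_comult f) /\
        scod (lam f) = sdom (awfs_mult f)) /\
      is_distributive_law (Lcopoint awfs_ff) awfs_comult
        (Rpoint awfs_ff) awfs_mult lam }.

Definition accessible_awfs (M : Category) (W : AWFS M) : Prop :=
  locally_presentable M /\ accessible_functor (ffE W).

Definition delta (M : Category) (W : AWFS M) (f : arrow M) :
  hom (W f) (W (mkArrow (ffL W f))) := scod (awfs_comult W f).

Definition mu (M : Category) (W : AWFS M) (f : arrow M) :
  hom (W (mkArrow (ffR W f))) (W f) := sdom (awfs_mult W f).

Definition Emap (M : Category) (F : FunctorialFactorization M) (f g : arrow M)
  (h : hom (adom f) (adom g)) (k : hom (acod f) (acod g))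
  (c : k ∘ amap f = amap g ∘ h) : hom (F f) (F g) :=
  fmap F (mkSquare h k c : @hom (Arrow M) f g).

Arguments Emap {M} F {f g} h k c.

Section FactorizationLemmas.

Variables (M : Category) (F : FunctorialFactorization M).

Lemma paste_comm (f g x : arrow M)
  (h : hom (adom f) (adom g)) (k : hom (acod f) (acod g))
  (h' : hom (adom g) (adom x)) (k' : hom (acod g) (acod x)) :
  k ∘ amap f = amap g ∘ h -> k' ∘ amap g = amap x ∘ h' ->
  (k' ∘ k) ∘ amap f = amap x ∘ (h' ∘ h).
Proof. by move=> c c'; rewrite -comp_assoc c comp_assoc c' comp_assoc. Qed.

Lemma Emap_comp (f g x : arrow M)
  (h : hom (adom f) (adom g)) (k : hom (acod f) (acod g)) c
  (h' : hom (adom g) (adom x)) (k' : hom (acod g) (acod x)) c' :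
  Emap F h' k' c' ∘ Emap F h k c = Emap F (h' ∘ h) (k' ∘ k) (paste_comm c c').
Proof.
rewrite /Emap -fmap_comp; congr fmap.
exact: square_ext.
Qed.

Lemma Emap_eq (f g : arrow M) (h h' : hom (adom f) (adom g))
  (k k' : hom (acod f) (acod g)) c c' :
  h = h' -> k = k' -> Emap F h k c = Emap F h' k' c'.
Proof. by move=> eh ek; subst h' k'; rewrite (proof_irrelevance _ c c'). Qed.

Lemma Emap_id (f : arrow M) c : Emap F (idm (adom f)) (idm (acod f)) c = idm (F f).
Proof. by rewrite -fmap_id /Emap; congr fmap; apply: square_ext. Qed.

Lemma Emap_L (A B A' B' : M) (f : hom A B) (g : hom A' B') (h : hom A A')
  (k : hom B B') c :
  Emap F (f := mkArrow f) (g := mkArrow g) h k c ∘ ffL F (mkArrow f)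
  = ffL F (mkArrow g) ∘ h.
Proof. by rewrite /Emap ffL_nat. Qed.

Lemma Emap_R (A B A' B' : M) (f : hom A B) (g : hom A' B') (h : hom A A')
  (k : hom B B') c :
  ffR F (mkArrow g) ∘ Emap F (f := mkArrow f) (g := mkArrow g) h k c
  = k ∘ ffR F (mkArrow f).
Proof. by rewrite /Emap -ffR_nat. Qed.

End FactorizationLemmas.

Section AWFSLemmas.

Variables (M : Category) (W : AWFS M).

Notation Larr f := (mkArrow (ffL W f)).
Notation Rarr f := (mkArrow (ffR W f)).

Lemma comult_dom (f : arrow M) : sdom (awfs_comult W f) = idm (adom f).
Proof.
have /(f_equal (@sdom _ _ _)) /= := proj1 (awfs_comonad W) f.
by rewrite comp_idl.
Qed.

Lemma mult_cod (f : arrow M) : scod (awfs_mult W f) = idm (acod f).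
Proof.
have /(f_equal (@scod _ _ _)) /= := proj1 (awfs_monad W) f.
by rewrite comp_idr.
Qed.

Lemma delta_L (f : arrow M) : delta W f ∘ ffL W f = ffL W (Larr f).
Proof. by rewrite /delta (scomm (awfs_comult W f)) comult_dom comp_idr. Qed.

Lemma delta_R (f : arrow M) : ffR W (Larr f) ∘ delta W f = idm (W f).
Proof. exact: (f_equal (@scod _ _ _) (proj1 (awfs_comonad W) f)). Qed.

Lemma mu_R (f : arrow M) : ffR W f ∘ mu W f = ffR W (Rarr f).
Proof.
rewrite /mu; have := scomm (awfs_mult W f) => /= <-.
by rewrite mult_cod comp_idl.
Qed.

Lemma mu_L (f : arrow M) : mu W f ∘ ffL W (Rarr f) = idm (W f).
Proof. exact: (f_equal (@sdom _ _ _) (proj1 (awfs_monad W) f)). Qed.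

Lemma delta_E (f : arrow M)
  (c : ffR W f ∘ ffL W f = amap f ∘ idm (adom f)) :
  Emap W (f := Larr f) (idm (adom f)) (ffR W f) c ∘ delta W f = idm (W f).
Proof.
apply: eq_trans (f_equal (@scod _ _ _) (proj1 (proj2 (awfs_comonad W)) f)) => /=.
by rewrite /Emap /delta; congr (fmap _ _ ∘ _); apply: square_ext.
Qed.

Lemma mu_E (f : arrow M)
  (c : idm (acod f) ∘ amap f = ffR W f ∘ ffL W f) :
  mu W f ∘ Emap W (g := Rarr f) (ffL W f) (idm (acod f)) c = idm (W f).
Proof.
apply: eq_trans (f_equal (@sdom _ _ _) (proj1 (proj2 (awfs_monad W)) f)) => /=.
by rewrite /Emap /mu; congr (_ ∘ fmap _ _); apply: square_ext.
Qed.

Lemma delta_coassoc (f : arrow M)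
  (c : delta W f ∘ ffL W f = ffL W (Larr f) ∘ idm (adom f)) :
  delta W (Larr f) ∘ delta W f
  = Emap W (f := Larr f) (g := Larr (Larr f)) (idm (adom f)) (delta W f) c
    ∘ delta W f.
Proof.
apply: (eq_trans (f_equal (@scod _ _ _) (proj2 (proj2 (awfs_comonad W)) f))) => /=.
rewrite /Emap /delta; congr (fmap _ _ ∘ _); apply: square_ext => //=.
exact: comult_dom.
Qed.

Lemma mu_assoc (f : arrow M)
  (c : idm (acod f) ∘ ffR W (Rarr f) = ffR W f ∘ mu W f) :
  mu W f ∘ mu W (Rarr f)
  = mu W f
    ∘ Emap W (f := Rarr (Rarr f)) (g := Rarr f) (mu W f) (idm (acod f)) c.
Proof.
apply: (eq_trans (f_equal (@sdom _ _ _) (proj2 (proj2 (awfs_monad W)) f))) => /=.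
rewrite /Emap /mu; congr (_ ∘ fmap _ _); apply: square_ext => //=.
exact: mult_cod.
Qed.

Lemma delta_nat (f g : arrow M) (h : hom (adom f) (adom g))
  (k : hom (acod f) (acod g)) c
  (c' : Emap W h k c ∘ ffL W f = ffL W g ∘ h) :
  delta W g ∘ Emap W h k c
  = Emap W (f := Larr f) (g := Larr g) h (Emap W h k c) c' ∘ delta W f.
Proof.
have := f_equal (@scod _ _ _)
          (naturality (awfs_comult W) (mkSquare h k c : @hom (Arrow M) f g)).
rewrite /= -[scod (awfs_comult W g)]/(delta W g) -/(Emap W h k c) => ->.
by rewrite /Emap /delta; congr (fmap _ _ ∘ _); apply: square_ext.
Qed.

Lemma mu_nat (f g : arrow M) (h : hom (adom f) (adom g))
  (k : hom (acod f) (acod g)) c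
  (c' : k ∘ ffR W f = ffR W g ∘ Emap W h k c) :
  Emap W h k c ∘ mu W f
  = mu W g ∘ Emap W (f := Rarr f) (g := Rarr g) (Emap W h k c) k c'.
Proof.
have := f_equal (@sdom _ _ _)
          (naturality (awfs_mult W) (mkSquare h k c : @hom (Arrow M) f g)).
rewrite /= -[sdom (awfs_mult W f)]/(mu W f) -/(Emap W h k c) => <-.
by rewrite /Emap /mu; congr (_ ∘ fmap _ _); apply: square_ext.
Qed.

Lemma delta_mu (f : arrow M) c :
  delta W f ∘ mu W f
  = mu W (Larr f)
    ∘ Emap W (f := Larr (Rarr f)) (g := Rarr (Larr f)) (delta W f) (mu W f) c
    ∘ delta W (Rarr f).
Proof.
case: (awfs_distr W) => lam [comps [_ [_ [/(_ f) e _]]]].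
have {e} /= := f_equal (@scod _ _ _) e.
rewrite (proj2 (comps f)) => ->.
rewrite (proj2 (comps (Larr f))) /Emap /delta /mu.
congr (_ ∘ fmap _ _ ∘ _); apply: square_ext; by case: (comps f).
Qed.

End AWFSLemmas.

Section ClovenMaps.

Variables (M : Category) (F : FunctorialFactorization M).

Record ClovenL (A B : M) := {
  clL_map :> hom A B;
  clL_str : hom B (F (mkArrow clL_map));
  clL_dom : clL_str ∘ clL_map = ffL F (mkArrow clL_map);
  clL_cod : ffR F (mkArrow clL_map) ∘ clL_str = idm B }.

Definition clL_square (A B A' B' : M) (u : ClovenL A B) (u' : ClovenL A' B')
  (h : hom A A') (k : hom B B') : Prop :=
  exists c : k ∘ u = u' ∘ h,
    Emap F (f := mkArrow u) (g := mkArrow u') h k c ∘ clL_str u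
    = clL_str u' ∘ k.

Record ClovenR (C D : M) := {
  clR_map :> hom C D;
  clR_str : hom (F (mkArrow clR_map)) C;
  clR_dom : clR_str ∘ ffL F (mkArrow clR_map) = idm C;
  clR_cod : clR_map ∘ clR_str = ffR F (mkArrow clR_map) }.

Definition clR_square (C D C' D' : M) (a : ClovenR C D) (a' : ClovenR C' D')
  (h : hom C C') (k : hom D D') : Prop :=
  exists c : k ∘ a = a' ∘ h,
    h ∘ clR_str a
    = clR_str a' ∘ Emap F (f := mkArrow a) (g := mkArrow a') h k c.

(** Writing [E(h,k)] for [Emap], this is [p ∘ E(h,k) ∘ s], a filler of the
    square [(h,k)] from the cloven L-map [(u,s)] to the cloven R-map [(a,p)]. *)
Definition filler (A B C D : M) (u : ClovenL A B) (a : ClovenR C D)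
  (h : hom A C) (k : hom B D) (c : k ∘ u = a ∘ h) : hom B C :=
  clR_str a ∘ Emap F (f := mkArrow u) (g := mkArrow a) h k c ∘ clL_str u.

Arguments filler {A B C D} u a h k c.

Lemma filler_eq (A B C D : M) (u : ClovenL A B) (a : ClovenR C D)
  (h h' : hom A C) (k k' : hom B D) c c' :
  h = h' -> k = k' -> filler u a h k c = filler u a h' k' c'.
Proof. by move=> eh ek; subst h' k'; rewrite (proof_irrelevance _ c c'). Qed.

Lemma filler_up (A B C D : M) (u : ClovenL A B) (a : ClovenR C D)
  (h : hom A C) (k : hom B D) c : filler u a h k c ∘ u = h.
Proof.
rewrite /filler -comp_assoc clL_dom -comp_assoc.
rewrite Emap_L comp_assoc clR_dom.
exact: comp_idl.
Qed.

Lemma filler_down (A B C D : M) (u : ClovenL A B) (a : ClovenR C D)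
  (h : hom A C) (k : hom B D) c : a ∘ filler u a h k c = k.
Proof.
rewrite /filler !comp_assoc clR_cod.
rewrite Emap_R -comp_assoc clL_cod.
exact: comp_idr.
Qed.

Lemma filler_pre (A B A' B' C D : M) (u : ClovenL A B) (u' : ClovenL A' B')
  (a : ClovenR C D) (h0 : hom A A') (k0 : hom B B') (h : hom A' C)
  (k : hom B' D) c c' :
  clL_square u u' h0 k0 ->
  filler u' a h k c ∘ k0 = filler u a (h ∘ h0) (k ∘ k0) c'.
Proof.
case=> c0 e; rewrite /filler -comp_assoc -e.
rewrite -!comp_assoc; congr (_ ∘ _); rewrite comp_assoc Emap_comp.
by congr (_ ∘ _); apply: Emap_eq.
Qed.

Lemma filler_post (A B C D C' D' : M) (u : ClovenL A B)
  (a : ClovenR C D) (a' : ClovenR C' D') (h : hom A C) (k : hom B D)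
  (h0 : hom C C') (k0 : hom D D') c c' :
  clR_square a a' h0 k0 ->
  h0 ∘ filler u a h k c = filler u a' (h0 ∘ h) (k0 ∘ k) c'.
Proof.
case=> c0 e; rewrite /filler !comp_assoc e.
congr (_ ∘ _); rewrite -comp_assoc Emap_comp.
by congr (_ ∘ _); apply: Emap_eq.
Qed.

Lemma clL_square_id (A B : M) (u : ClovenL A B) :
  clL_square u u (idm A) (idm B).
Proof.
have c : idm B ∘ u = u ∘ idm A by rewrite comp_idl comp_idr.
by exists c; rewrite (@Emap_id _ _ (mkArrow u)) comp_idl comp_idr.
Qed.

Lemma clL_square_comp (A B A' B' A'' B'' : M) (u : ClovenL A B)
  (u' : ClovenL A' B') (u'' : ClovenL A'' B'') (h : hom A A') (k : hom B B')
  (h' : hom A' A'') (k' : hom B' B'') :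
  clL_square u' u'' h' k' -> clL_square u u' h k ->
  clL_square u u'' (h' ∘ h) (k' ∘ k).
Proof.
case=> c' e' [c e].
exists (@paste_comm M (mkArrow u) (mkArrow u') (mkArrow u'') h k h' k' c c').
by rewrite -(@Emap_comp M F (mkArrow u) (mkArrow u') (mkArrow u'') h k c h' k' c') -comp_assoc e comp_assoc e' comp_assoc.
Qed.

Lemma clR_square_id (C D : M) (a : ClovenR C D) :
  clR_square a a (idm C) (idm D).
Proof.
have c : idm D ∘ a = a ∘ idm C by rewrite comp_idl comp_idr.
by exists c; rewrite (@Emap_id _ _ (mkArrow a)) comp_idl comp_idr.
Qed.

Lemma clR_square_comp (A B A' B' A'' B'' : M) (u : ClovenR A B)
  (u' : ClovenR A' B') (u'' : ClovenR A'' B'') (h : hom A A') (k : hom B B')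
  (h' : hom A' A'') (k' : hom B' B'') :
  clR_square u' u'' h' k' -> clR_square u u' h k ->
  clR_square u u'' (h' ∘ h) (k' ∘ k).
Proof.
case=> c' e' [c e].
exists (@paste_comm M (mkArrow u) (mkArrow u') (mkArrow u'') h k h' k' c c').
by rewrite -(@Emap_comp M F (mkArrow u) (mkArrow u') (mkArrow u'') h k c h' k' c') -comp_assoc e comp_assoc e' -comp_assoc.
Qed.

Definition idL (A : M) : ClovenL A A.
Proof.
exists (idm A) (ffL F (mkArrow (idm A))).
- exact: comp_idr.
- exact: (ff_fact F (mkArrow (idm A))).
Defined.

Definition idR (A : M) : ClovenR A A.
Proof.
exists (idm A) (ffR F (mkArrow (idm A))).
- exact: (ff_fact F (mkArrow (idm A))).
- exact: comp_idl.
Defined.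

Lemma clL_square_vid (A A' : M) (h : hom A A') : clL_square (idL A) (idL A') h h.
Proof.
have c : h ∘ idL A = idL A' ∘ h by rewrite /= comp_idl comp_idr.
by exists c; rewrite Emap_L.
Qed.

Lemma clR_square_vid (A A' : M) (h : hom A A') : clR_square (idR A) (idR A') h h.
Proof.
have c : h ∘ idR A = idR A' ∘ h by rewrite /= comp_idl comp_idr.
by exists c; rewrite Emap_R.
Qed.

Lemma filler_idL (A C D : M) (a : ClovenR C D) (h : hom A C) (k : hom A D) c :
  filler (idL A) a h k c = h.
Proof. by rewrite -{2}(filler_up c) /= comp_idr. Qed.

Lemma filler_idR (A B D : M) (u : ClovenL A B) (h : hom A D) (k : hom B D) c :
  filler u (idR D) h k c = k.
Proof. by rewrite -{2}(filler_down c) /= comp_idl. Qed.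

End ClovenMaps.

Arguments filler {M F A B C D} u a h k c.

Section ClovenComposition.

Variables (M : Category) (W : AWFS M).

Notation Larr f := (mkArrow (ffL W f)).
Notation Rarr f := (mkArrow (ffR W f)).

Definition cofreeL (f : arrow M) : ClovenL W (adom f) (W f).
Proof.
exists (ffL W f) (delta W f).
- exact: delta_L.
- exact: delta_R.
Defined.

Definition freeR (f : arrow M) : ClovenR W (W f) (acod f).
Proof.
exists (ffR W f) (mu W f).
- exact: mu_L.
- exact: mu_R.
Defined.

Lemma coalg_comm (A B : M) (u : ClovenL W A B) :
  clL_str u ∘ u = ffL W (mkArrow u) ∘ idm A.
Proof. by rewrite clL_dom comp_idr. Qed.

Definition is_coalgebra (A B : M) (u : ClovenL W A B) : Prop :=
  delta W (mkArrow u) ∘ clL_str u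
  = Emap W (f := mkArrow u) (g := Larr (mkArrow u))
      (idm A) (clL_str u) (coalg_comm u) ∘ clL_str u.

Lemma alg_comm (C D : M) (a : ClovenR W C D) :
  idm D ∘ ffR W (mkArrow a) = a ∘ clR_str a.
Proof. by rewrite clR_cod comp_idl. Qed.

Definition is_algebra (C D : M) (a : ClovenR W C D) : Prop :=
  clR_str a ∘ mu W (mkArrow a)
  = clR_str a ∘ Emap W (f := Rarr (mkArrow a)) (g := mkArrow a)
                  (clR_str a) (idm D) (alg_comm a).

Lemma cofreeL_coalgebra (f : arrow M) : is_coalgebra (cofreeL f).
Proof. exact: delta_coassoc. Qed.

Lemma freeR_algebra (f : arrow M) : is_algebra (freeR f).
Proof. exact: mu_assoc. Qed.

Lemma cofreeL_square (f g : arrow M) (h : hom (adom f) (adom g))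
  (k : hom (acod f) (acod g)) c :
  clL_square (cofreeL f) (cofreeL g) h (Emap W h k c).
Proof.
have c' : Emap W h k c ∘ ffL W f = ffL W g ∘ h by rewrite Emap_L.
by exists c'; rewrite /= (delta_nat (c := c) c').
Qed.

Lemma freeR_square (f g : arrow M) (h : hom (adom f) (adom g))
  (k : hom (acod f) (acod g)) c :
  clR_square (freeR f) (freeR g) (Emap W h k c) k.
Proof.
have c' : k ∘ ffR W f = ffR W g ∘ Emap W h k c by rewrite Emap_R.
by exists c'; rewrite /= (mu_nat (c := c) c').
Qed.

Lemma algebra_extension (f : arrow M) (C D : M) (a : ClovenR W C D)
  (h : hom (adom f) C) (k : hom (acod f) D) (c : k ∘ amap f = a ∘ h) :
  is_algebra a ->
  clR_square (freeR f) a (clR_str a ∘ Emap W (g := mkArrow a) h k c) k.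
Proof.
move=> alg.
have c1 : k ∘ ffR W f = a ∘ (clR_str a ∘ Emap W (g := mkArrow a) h k c).
  by rewrite comp_assoc clR_cod Emap_R.
have c2 : k ∘ ffR W f
          = ffR W (mkArrow a) ∘ Emap W (g := mkArrow a) h k c.
  by rewrite Emap_R.
exists c1 => /=.
rewrite -comp_assoc (mu_nat (f := f) (g := mkArrow a) (c := c) c2) comp_assoc alg -comp_assoc.
by rewrite Emap_comp; congr (_ ∘ _); apply: Emap_eq => //; apply: comp_idl.
Qed.

Lemma coalgebra_extension (g : arrow M) (A B : M) (u : ClovenL W A B)
  (h : hom A (adom g)) (k : hom B (acod g)) (c : k ∘ u = amap g ∘ h) :
  is_coalgebra u ->
  clL_square u (cofreeL g) h (Emap W (f := mkArrow u) h k c ∘ clL_str u).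
Proof.
move=> coalg.
have c1 : Emap W (f := mkArrow u) h k c ∘ clL_str u ∘ u = ffL W g ∘ h.
  by rewrite -comp_assoc clL_dom Emap_L.
have c2 : Emap W (f := mkArrow u) h k c ∘ ffL W (mkArrow u) = ffL W g ∘ h.
  by rewrite Emap_L.
exists c1 => /=.
rewrite comp_assoc (delta_nat (f := mkArrow u) (g := g) (c := c) c2) -comp_assoc coalg comp_assoc.
by rewrite Emap_comp; congr (_ ∘ _); apply: Emap_eq => //; rewrite /= comp_idr.
Qed.

Lemma delta_filler (A B : M) (u : ClovenL W A B) (f : arrow M)
  (h : hom A (W f)) (k : hom B (acod f)) c c' :
  is_coalgebra u ->
  delta W f ∘ filler u (freeR f) h k c
  = filler u (freeR (Larr f)) (delta W f ∘ h) (filler u (freeR f) h k c) c'.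
Proof.
move=> coalg; rewrite {1}/filler !comp_assoc.
have c1 : mu W f ∘ ffL W (Rarr f) = ffR W (Larr f) ∘ delta W f.
  by rewrite mu_L delta_R.
have c2 : Emap W (f := mkArrow u) (g := Rarr f) h k c ∘ ffL W (mkArrow u)
          = ffL W (Rarr f) ∘ h by rewrite Emap_L.
rewrite /= (delta_mu c1) -[_ ∘ delta W (Rarr f) ∘ _]comp_assoc.
rewrite (delta_nat (f := mkArrow u) (g := Rarr f) (c := c) c2).
rewrite -!comp_assoc coalg /filler -!comp_assoc; congr (_ ∘ _).
rewrite !comp_assoc !Emap_comp; congr (_ ∘ _).
by apply: Emap_eq; rewrite /= -?comp_assoc ?comp_idr.
Qed.

Lemma filler_mu (C D : M) (a : ClovenR W C D) (f : arrow M)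
  (h : hom (adom f) C) (k : hom (W f) D) c c' :
  is_algebra a ->
  filler (cofreeL f) a h k c ∘ mu W f
  = filler (cofreeL (Rarr f)) a (filler (cofreeL f) a h k c) (k ∘ mu W f) c'.
Proof.
move=> alg; rewrite {1}/filler -!comp_assoc.
have c1 : mu W f ∘ ffL W (Rarr f) = ffR W (Larr f) ∘ delta W f.
  by rewrite mu_L delta_R.
have c2 : k ∘ ffR W (Larr f)
          = ffR W (mkArrow a) ∘ Emap W (f := Larr f) (g := mkArrow a) h k c.
  by rewrite Emap_R.
rewrite /= (delta_mu c1) !comp_assoc.
rewrite -[clR_str a ∘ _ ∘ mu _ _]comp_assoc.
rewrite (mu_nat (f := Larr f) (g := mkArrow a) (c := c) c2).
rewrite !comp_assoc alg /filler; congr (_ ∘ _).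
rewrite -!comp_assoc !Emap_comp; congr (_ ∘ _).
by apply: Emap_eq; rewrite /= -?comp_assoc ?comp_idl.
Qed.

(** Vertical composition.  Unfolding [filler], the structure of [compL v u] is
    [mu ∘ E(w,1) ∘ t] with [w = mu ∘ E(L(vu),v) ∘ s], and that of [compR b a]
    is [p ∘ E(1,w) ∘ delta] with [w = q ∘ E(a,R(ba)) ∘ delta]. *)

Lemma compL_comm (A B C : M) (v : ClovenL W B C) (u : ClovenL W A B) :
  v ∘ u = ffR W (mkArrow (v ∘ u)) ∘ ffL W (mkArrow (v ∘ u)).
Proof. by rewrite ff_fact. Qed.

Definition compL_aux (A B C : M) (v : ClovenL W B C) (u : ClovenL W A B) :
  hom B (W (mkArrow (v ∘ u))) :=
  filler u (freeR (mkArrow (v ∘ u))) (ffL W (mkArrow (v ∘ u))) v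
    (compL_comm v u).

Lemma compL_aux_comm (A B C : M) (v : ClovenL W B C) (u : ClovenL W A B) :
  idm C ∘ v = freeR (mkArrow (v ∘ u)) ∘ compL_aux v u.
Proof. by rewrite /compL_aux filler_down comp_idl. Qed.

Definition compL (A B C : M) (v : ClovenL W B C) (u : ClovenL W A B) :
  ClovenL W A C.
Proof.
exists (v ∘ u)
  (filler v (freeR (mkArrow (v ∘ u))) (compL_aux v u) (idm C)
     (compL_aux_comm v u)).
- by rewrite comp_assoc filler_up /compL_aux filler_up.
- exact: (filler_down (a := freeR (mkArrow (v ∘ u)))).
Defined.

Lemma compR_comm (A B C : M) (b : ClovenR W B C) (a : ClovenR W A B) :
  ffR W (mkArrow (b ∘ a)) ∘ ffL W (mkArrow (b ∘ a)) = b ∘ a.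
Proof. by rewrite ff_fact. Qed.

Definition compR_aux (A B C : M) (b : ClovenR W B C) (a : ClovenR W A B) :
  hom (W (mkArrow (b ∘ a))) B :=
  filler (cofreeL (mkArrow (b ∘ a))) b a (ffR W (mkArrow (b ∘ a)))
    (compR_comm b a).

Lemma compR_aux_comm (A B C : M) (b : ClovenR W B C) (a : ClovenR W A B) :
  compR_aux b a ∘ cofreeL (mkArrow (b ∘ a)) = a ∘ idm A.
Proof. by rewrite /compR_aux filler_up comp_idr. Qed.

Definition compR (A B C : M) (b : ClovenR W B C) (a : ClovenR W A B) :
  ClovenR W A C.
Proof.
exists (b ∘ a)
  (filler (cofreeL (mkArrow (b ∘ a))) a (idm A) (compR_aux b a)
     (compR_aux_comm b a)).
- exact: (filler_up (u := cofreeL (mkArrow (b ∘ a)))).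
- by rewrite -comp_assoc filler_down /compR_aux filler_down.
Defined.

Lemma filler_compL (A B C X Y : M) (v : ClovenL W B C) (u : ClovenL W A B)
  (a : ClovenR W X Y) (h : hom A X) (k : hom C Y) c c1 c2 :
  is_algebra a ->
  filler (compL v u) a h k c = filler v a (filler u a h (k ∘ v) c1) k c2.
Proof.
move=> alg; rewrite {1}/filler /=.
have sq := algebra_extension (f := mkArrow (v ∘ u)) c alg.
have e : clR_str a ∘ Emap W (f := mkArrow (v ∘ u)) (g := mkArrow a) h k c
           ∘ compL_aux v u = filler u a h (k ∘ v) c1.
  have c3 : k ∘ v ∘ u
     = a ∘ (clR_str a ∘ Emap W (f := mkArrow (v ∘ u)) (g := mkArrow a) h k c
             ∘ ffL W (mkArrow (v ∘ u))).
    rewrite [RHS]comp_assoc [a ∘ (_ ∘ _)]comp_assoc clR_cod Emap_R.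
    by rewrite -!comp_assoc ff_fact.
  rewrite /compL_aux (filler_post _ c3 sq).
  by apply: filler_eq; rewrite // -comp_assoc Emap_L comp_assoc clR_dom comp_idl.
have c4 : k ∘ idm C ∘ v
  = a ∘ (clR_str a ∘ Emap W (f := mkArrow (v ∘ u)) (g := mkArrow a) h k c
           ∘ compL_aux v u) by rewrite e comp_idr.
by rewrite (filler_post _ c4 sq); apply: filler_eq; rewrite ?comp_idr.
Qed.

Lemma filler_compR (A B C X Y : M) (b : ClovenR W B C) (a : ClovenR W A B)
  (u : ClovenL W X Y) (h : hom X A) (k : hom Y C) c c1 c2 :
  is_coalgebra u ->
  filler u (compR b a) h k c = filler u a h (filler u b (a ∘ h) k c1) c2.
Proof.
move=> coalg; rewrite {1}/filler /= -comp_assoc.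
have sq := coalgebra_extension (g := mkArrow (b ∘ a)) c coalg.
set x := Emap W _ _ _ ∘ clL_str u in sq *.
have e : compR_aux b a ∘ x = filler u b (a ∘ h) k c1.
  have e1 : ffR W (mkArrow (b ∘ a)) ∘ x = k.
    by rewrite /x comp_assoc Emap_R -comp_assoc clL_cod comp_idr.
  have c3 : ffR W (mkArrow (b ∘ a)) ∘ x ∘ u = b ∘ (a ∘ h) by rewrite e1.
  by rewrite /compR_aux (filler_pre _ c3 sq); apply: filler_eq.
have c4 : compR_aux b a ∘ x ∘ u = a ∘ (idm A ∘ h) by rewrite e comp_idl.
by rewrite (filler_pre _ c4 sq); apply: filler_eq; rewrite ?comp_idl.
Qed.

Lemma clL_ext (A B : M) (u v : ClovenL W A B) :
  clL_map u = clL_map v ->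
  (forall (X Y : M) (a : ClovenR W X Y) h k c c', is_algebra a ->
    filler u a h k c = filler v a h k c') ->
  u = v.
Proof.
case: u => f s s1 s2; case: v => f' s' s1' s2' /= e; subst f' => H.
have c : idm B ∘ f = ffR W (mkArrow f) ∘ ffL W (mkArrow f).
  by rewrite comp_idl ff_fact.
have e := H _ _ (freeR (mkArrow f)) (ffL W (mkArrow f)) (idm B) c c
            (@freeR_algebra _).
rewrite /filler /= (mu_E (f := mkArrow f) c) !comp_idl in e; subst s'.
by rewrite (proof_irrelevance _ s1 s1') (proof_irrelevance _ s2 s2').
Qed.

Lemma clR_ext (A B : M) (a b : ClovenR W A B) :
  clR_map a = clR_map b ->
  (forall (X Y : M) (u : ClovenL W X Y) h k c c', is_coalgebra u ->
    filler u a h k c = filler u b h k c') ->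
  a = b.
Proof.
case: a => f s s1 s2; case: b => f' s' s1' s2' /= e; subst f' => H.
have c : ffR W (mkArrow f) ∘ ffL W (mkArrow f) = f ∘ idm A.
  by rewrite comp_idr ff_fact.
have e := H _ _ (cofreeL (mkArrow f)) (idm A) (ffR W (mkArrow f)) c c
            (@cofreeL_coalgebra _).
rewrite /filler /= -!comp_assoc (delta_E (f := mkArrow f) c) !comp_idr in e.
subst s'.
by rewrite (proof_irrelevance _ s1 s1') (proof_irrelevance _ s2 s2').
Qed.

Lemma compL_assoc (A B C D : M) (x : ClovenL W C D) (v : ClovenL W B C)
  (u : ClovenL W A B) : compL x (compL v u) = compL (compL x v) u.
Proof.
apply: clL_ext => [|X Y a h k c c' alg]; first exact: comp_assoc.
have ca : k ∘ x ∘ v ∘ u = a ∘ h by move: c; rewrite /= !comp_assoc.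
have ca' : k ∘ x ∘ compL v u = a ∘ h by rewrite -c -comp_assoc.
have cb : k ∘ compL x v ∘ u = a ∘ h by rewrite -c' -comp_assoc.
have d : k ∘ x = a ∘ filler (compL v u) a h (k ∘ x) ca'.
  by rewrite filler_down.
rewrite (filler_compL (v := x) (u := compL v u) _ d alg).
have d1 : k ∘ x ∘ v = a ∘ filler u a h (k ∘ x ∘ v) ca by rewrite filler_down.
have d2 : k ∘ compL x v = a ∘ filler u a h (k ∘ compL x v) cb by rewrite filler_down.
rewrite (filler_compL (v := compL x v) (u := u) (c1 := cb) _ d2 alg).
have d3 : k ∘ x ∘ v = a ∘ filler u a h (k ∘ compL x v) cb
  by rewrite filler_down comp_assoc.
have d4 : k ∘ x = a ∘ filler v a (filler u a h (k ∘ compL x v) cb) (k ∘ x) d3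
  by rewrite filler_down.
rewrite (filler_compL (c1 := d3) d2 d4 alg).
apply: filler_eq => //.
rewrite (filler_compL (c1 := ca) _ d1 alg).
by apply: filler_eq => //; apply: filler_eq; rewrite // comp_assoc.
Qed.

Lemma compL_idl (A B : M) (u : ClovenL W A B) : compL (idL W B) u = u.
Proof.
apply: clL_ext => [|X Y a h k c c' alg]; first exact: comp_idl.
have c1 : k ∘ idL W B ∘ u = a ∘ h by rewrite comp_idr.
have c2 : k ∘ idL W B = a ∘ filler u a h (k ∘ idL W B) c1 by rewrite filler_down.
rewrite (filler_compL _ c2 alg) filler_idL.
by apply: filler_eq; rewrite //= comp_idr.
Qed.

Lemma compL_idr (A B : M) (u : ClovenL W A B) : compL u (idL W A) = u.
Proof.
apply: clL_ext => [|X Y a h k c c' alg]; first exact: comp_idr.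
have c1 : k ∘ u ∘ idL W A = a ∘ h by rewrite comp_idr.
have c2 : k ∘ u = a ∘ filler (idL W A) a h (k ∘ u) c1 by rewrite filler_down.
rewrite (filler_compL _ c2 alg).
by apply: filler_eq; rewrite ?filler_idL.
Qed.

Lemma compR_assoc (A B C D : M) (x : ClovenR W C D) (b : ClovenR W B C)
  (a : ClovenR W A B) : compR x (compR b a) = compR (compR x b) a.
Proof.
apply: clR_ext => [|X Y u h k c c' coalg]; first exact: comp_assoc.
have c1 : k ∘ u = x ∘ (b ∘ a ∘ h) by rewrite c /= !comp_assoc.
have d1 : filler u x (b ∘ a ∘ h) k c1 ∘ u = b ∘ a ∘ h by rewrite filler_up.
rewrite (filler_compR (b := x) (a := compR b a) c d1 coalg).
have c2 : k ∘ u = x ∘ b ∘ (a ∘ h) by rewrite c /= !comp_assoc.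
have d2 : filler u (compR x b) (a ∘ h) k c2 ∘ u = a ∘ h by rewrite filler_up.
rewrite (filler_compR (b := compR x b) (a := a) c' d2 coalg).
have c3 : filler u x (b ∘ a ∘ h) k c1 ∘ u = b ∘ (a ∘ h).
  by rewrite filler_up comp_assoc.
have d3 : filler u b (a ∘ h) (filler u x (b ∘ a ∘ h) k c1) c3 ∘ u = a ∘ h.
  by rewrite filler_up.
rewrite (filler_compR (b := b) (a := a) d1 d3 coalg).
apply: filler_eq => //.
have c4 : k ∘ u = x ∘ (b ∘ (a ∘ h)) by rewrite c /= !comp_assoc.
have d4 : filler u x (b ∘ (a ∘ h)) k c4 ∘ u = b ∘ (a ∘ h) by rewrite filler_up.
rewrite (filler_compR (b := x) (a := b) c2 d4 coalg).
by apply: filler_eq => //; apply: filler_eq; rewrite // comp_assoc.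
Qed.

Lemma compR_idl (A B : M) (a : ClovenR W A B) : compR (idR W B) a = a.
Proof.
apply: clR_ext => [|X Y u h k c c' coalg]; first exact: comp_idl.
have c1 : k ∘ u = idR W B ∘ (a ∘ h) by rewrite /= comp_idl.
have c2 : filler u (idR W B) (a ∘ h) k c1 ∘ u = a ∘ h by rewrite filler_up.
rewrite (filler_compR (b := idR W B) c c2 coalg).
by apply: filler_eq; rewrite ?filler_idR.
Qed.

Lemma compR_idr (A B : M) (a : ClovenR W A B) : compR a (idR W A) = a.
Proof.
apply: clR_ext => [|X Y u h k c c' coalg]; first exact: comp_idr.
have c1 : k ∘ u = a ∘ (idR W A ∘ h) by rewrite /= comp_idl.
have c2 : filler u a (idR W A ∘ h) k c1 ∘ u = idR W A ∘ h by rewrite filler_up.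
rewrite (filler_compR (a := idR W A) c c2 coalg) filler_idR.
by apply: filler_eq; rewrite //= comp_idl.
Qed.

Lemma clL_square_vcomp (A B C A' B' C' : M) (u : ClovenL W A B)
  (v : ClovenL W B C) (u' : ClovenL W A' B') (v' : ClovenL W B' C')
  (h : hom A A') (k : hom B B') (l : hom C C') :
  clL_square v v' k l -> clL_square u u' h k ->
  clL_square (compL v u) (compL v' u') h l.
Proof.
move=> sv su; case: (sv) => cv _; case: (su) => cu _.
have c : l ∘ (v ∘ u) = v' ∘ u' ∘ h.
  by rewrite comp_assoc cv -comp_assoc cu comp_assoc.
exists c => /=.
have sq := @freeR_square (mkArrow (v ∘ u)) (mkArrow (v' ∘ u')) h l c.
set P := Emap _ _ _ _ in sq *; pose R' := freeR (mkArrow (v' ∘ u')).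
have e : P ∘ compL_aux v u = compL_aux v' u' ∘ k.
  have c1 : l ∘ v ∘ u = R' ∘ (P ∘ ffL W (mkArrow (v ∘ u))).
    by rewrite /P /R' Emap_L comp_assoc /= (ff_fact W (mkArrow (v' ∘ u'))) -comp_assoc.
  have c2 : v' ∘ k ∘ u = R' ∘ (ffL W (mkArrow (v' ∘ u')) ∘ h).
    by rewrite /R' comp_assoc /= (ff_fact W (mkArrow (v' ∘ u'))) -!comp_assoc cu.
  rewrite /compL_aux (filler_post _ c1 sq) (filler_pre _ c2 su).
  by apply: filler_eq; rewrite // /P Emap_L.
have c3 : l ∘ idm C ∘ v = R' ∘ (P ∘ compL_aux v u).
  by rewrite e comp_idr cv comp_assoc /R' -compL_aux_comm comp_idl.
have c4 : idm C' ∘ l ∘ v = R' ∘ (compL_aux v' u' ∘ k).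
  by rewrite comp_idl -e -c3 comp_idr.
rewrite (filler_post _ c3 sq) (filler_pre _ c4 sv).
by apply: filler_eq; rewrite ?comp_idl ?comp_idr.
Qed.

Lemma clR_square_vcomp (A B C A' B' C' : M) (a : ClovenR W A B)
  (b : ClovenR W B C) (a' : ClovenR W A' B') (b' : ClovenR W B' C')
  (h : hom A A') (k : hom B B') (l : hom C C') :
  clR_square b b' k l -> clR_square a a' h k ->
  clR_square (compR b a) (compR b' a') h l.
Proof.
move=> sb sa; case: (sb) => cb _; case: (sa) => ca _.
have c : l ∘ (b ∘ a) = b' ∘ a' ∘ h.
  by rewrite comp_assoc cb -comp_assoc ca comp_assoc.
exists c => /=.
have sq := @cofreeL_square (mkArrow (b ∘ a)) (mkArrow (b' ∘ a')) h l c.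
set P := Emap _ _ _ _ in sq *; pose L0 := cofreeL (mkArrow (b ∘ a)).
have e : k ∘ compR_aux b a = compR_aux b' a' ∘ P.
  have c1 : l ∘ ffR W (mkArrow (b ∘ a)) ∘ L0 = b' ∘ (k ∘ a).
    by rewrite /L0 -comp_assoc /= (ff_fact W (mkArrow (b ∘ a))) /= comp_assoc cb -comp_assoc.
  have c2 : ffR W (mkArrow (b' ∘ a')) ∘ P ∘ L0 = b' ∘ (a' ∘ h).
    by rewrite /P Emap_R -ca.
  rewrite /compR_aux (filler_post _ c1 sb) (filler_pre _ c2 sq).
  by apply: filler_eq; rewrite // /P Emap_R.
have c3 : k ∘ compR_aux b a ∘ L0 = a' ∘ (h ∘ idm A).
  by rewrite -comp_assoc /L0 compR_aux_comm !comp_idr.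
have c4 : compR_aux b' a' ∘ P ∘ L0 = a' ∘ (idm A' ∘ h).
  by rewrite -e c3 comp_idr comp_idl.
rewrite (filler_post _ c3 sa) (filler_pre _ c4 sq).
by apply: filler_eq; rewrite ?comp_idl ?comp_idr.
Qed.

Lemma idL_coalgebra (A : M) : is_coalgebra (idL W A).
Proof.
rewrite /is_coalgebra /= (delta_L W (mkArrow (idm A))).
by rewrite (@Emap_L _ W _ _ _ _ (idm A)) comp_idr.
Qed.

Lemma idR_algebra (A : M) : is_algebra (idR W A).
Proof.
rewrite /is_algebra /= (mu_R W (mkArrow (idm A))).
by rewrite (@Emap_R _ W _ _ _ _ _ (idm A)) comp_idl.
Qed.

Lemma compL_coalgebra (A B C : M) (v : ClovenL W B C) (u : ClovenL W A B) :
  is_coalgebra v -> is_coalgebra u -> is_coalgebra (compL v u).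
Proof.
move=> cov cou; rewrite /is_coalgebra /=.
set g := mkArrow (v ∘ u); set s := filler v _ _ _ _.
have sv : s ∘ v = compL_aux v u by exact: filler_up.
have dL : s ∘ v ∘ u = ffL W g by rewrite sv; exact: filler_up.
have c : s ∘ (v ∘ u) = ffL W g ∘ idm A by rewrite comp_assoc dL comp_idr.
have sq := @freeR_square g (Larr g) (idm A) s c.
rewrite (proof_irrelevance _ (coalg_comm (compL v u)) c).
set P := (X in clR_square _ _ X _) in sq.
change (delta W g ∘ s = P ∘ s).
have c1 : compL_aux v u ∘ u = freeR (Larr g) ∘ (delta W g ∘ ffL W g).
  by rewrite comp_assoc /= delta_R comp_idl; exact: filler_up.
have c2 : s ∘ v ∘ u = freeR (Larr g) ∘ (P ∘ ffL W g).
  by rewrite /P Emap_L comp_assoc /= (ff_fact W (Larr g)) comp_idr.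
have e : delta W g ∘ compL_aux v u = P ∘ compL_aux v u.
  rewrite /compL_aux (delta_filler c1) // (filler_post _ c2 sq).
  by apply: filler_eq; rewrite // (delta_L W g) /P Emap_L comp_idr.
have c3 : s ∘ v = freeR (Larr g) ∘ (delta W g ∘ compL_aux v u).
  by rewrite comp_assoc /= delta_R comp_idl.
have c4 : s ∘ idm C ∘ v = freeR (Larr g) ∘ (P ∘ compL_aux v u).
  by rewrite comp_idr c3 e.
rewrite {1}/s (delta_filler c3) // /s (filler_post _ c4 sq).
by apply: filler_eq; rewrite ?comp_idr.
Qed.

Lemma compR_algebra (A B C : M) (b : ClovenR W B C) (a : ClovenR W A B) :
  is_algebra b -> is_algebra a -> is_algebra (compR b a).
Proof.
move=> alb ala; rewrite /is_algebra /=.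
set g := mkArrow (b ∘ a); set p := filler _ a _ _ _.
have ap : a ∘ p = compR_aux b a by exact: filler_down.
have bR : b ∘ (a ∘ p) = ffR W g by rewrite ap; exact: filler_down.
have c : idm C ∘ ffR W g = b ∘ a ∘ p by rewrite -comp_assoc bR comp_idl.
have sq := @cofreeL_square (Rarr g) g p (idm C) c.
rewrite (proof_irrelevance _ (alg_comm (compR b a)) c).
set P := (X in clL_square _ _ _ X) in sq.
change (p ∘ mu W g = p ∘ P).
have c1 : ffR W g ∘ mu W g ∘ cofreeL (Rarr g) = b ∘ compR_aux b a.
  by rewrite -comp_assoc /= mu_L comp_idr -ap.
have c2 : ffR W g ∘ P ∘ cofreeL (Rarr g) = b ∘ (a ∘ p).
  by rewrite /P Emap_R -comp_assoc /= (ff_fact W (Rarr g)) comp_idl.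
have e : compR_aux b a ∘ mu W g = compR_aux b a ∘ P.
  rewrite /compR_aux (filler_mu c1) // (filler_pre _ c2 sq).
  by apply: filler_eq; rewrite // (mu_R W g) /P Emap_R comp_idl.
have c3 : compR_aux b a ∘ mu W g ∘ cofreeL (Rarr g) = a ∘ p.
  by rewrite -comp_assoc /= mu_L comp_idr ap.
have c4 : compR_aux b a ∘ P ∘ cofreeL (Rarr g) = a ∘ (idm A ∘ p).
  by rewrite -e c3 comp_idl.
rewrite {1}/p (filler_mu c3) // /p (filler_pre _ c4 sq).
by apply: filler_eq; rewrite ?comp_idl.
Qed.

Record Coalgebra (A B : M) := {
  coalg_cloven :> ClovenL W A B;
  coalg_law : is_coalgebra coalg_cloven }.

Record Algebra (C D : M) := {
  alg_cloven :> ClovenR W C D;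
  alg_law : is_algebra alg_cloven }.

Lemma coalgebra_ext (A B : M) (u v : Coalgebra A B) :
  coalg_cloven u = coalg_cloven v -> u = v.
Proof.
case: u => u cu; case: v => v cv /= e; subst v.
by rewrite (proof_irrelevance _ cu cv).
Qed.

Lemma algebra_ext (A B : M) (u v : Algebra A B) :
  alg_cloven u = alg_cloven v -> u = v.
Proof.
case: u => u cu; case: v => v cv /= e; subst v.
by rewrite (proof_irrelevance _ cu cv).
Qed.

End ClovenComposition.

(** Equality of squares whose vertical boundaries need only be provably
    equal. *)
Definition eq_over (U V : Type) (S : U -> V -> Type) (u u' : U) (v v' : V)
  (x : S u v) (y : S u' v') : Prop :=
  existT (fun p : U * V => S (fst p) (snd p)) (u, v) x
  = existT (fun p : U * V => S (fst p) (snd p)) (u', v') y.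

(** A category internal to categories, with category of objects [dobj].  The
    objects of its category of arrows are the vertical arrows, indexed by their
    source and target, and the morphisms are the squares [sq u v], whose images
    under the source and target functors are [top] and [bot].  A pair of
    vertically composable squares is a pair [y], [x] with [bot x = top y]. *)
Record DoubleCategory := {
  dobj :> Category;
  ver : dobj -> dobj -> Type;
  sq : forall A B A' B', ver A B -> ver A' B' -> Set;
  top : forall A B A' B' (u : ver A B) (v : ver A' B'), sq u v -> hom A A';
  bot : forall A B A' B' (u : ver A B) (v : ver A' B'), sq u v -> hom B B';
  hid : forall A B (u : ver A B), sq u u;
  hcomp : forall A B A' B' A'' B''
    (u : ver A B) (v : ver A' B') (w : ver A'' B''),
    sq v w -> sq u v -> sq u w;
  hcomp_assoc : forall A B A' B' A'' B'' A3 B3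
    (u : ver A B) (v : ver A' B') (w : ver A'' B'') (t : ver A3 B3)
    (z : sq w t) (y : sq v w) (x : sq u v),
    hcomp z (hcomp y x) = hcomp (hcomp z y) x;
  hcomp_idl : forall A B A' B' (u : ver A B) (v : ver A' B') (x : sq u v),
    hcomp (hid v) x = x;
  hcomp_idr : forall A B A' B' (u : ver A B) (v : ver A' B') (x : sq u v),
    hcomp x (hid u) = x;
  top_id : forall A B (u : ver A B), top (hid u) = idm A;
  bot_id : forall A B (u : ver A B), bot (hid u) = idm B;
  top_comp : forall A B A' B' A'' B''
    (u : ver A B) (v : ver A' B') (w : ver A'' B'') (y : sq v w) (x : sq u v),
    top (hcomp y x) = top y ∘ top x;
  bot_comp : forall A B A' B' A'' B''
    (u : ver A B) (v : ver A' B') (w : ver A'' B'') (y : sq v w) (x : sq u v),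
    bot (hcomp y x) = bot y ∘ bot x;
  vid : forall A, ver A A;
  vid_sq : forall A A' (h : hom A A'), sq (vid A) (vid A');
  top_vid : forall A A' (h : hom A A'), top (vid_sq h) = h;
  bot_vid : forall A A' (h : hom A A'), bot (vid_sq h) = h;
  vid_sq_id : forall A, vid_sq (idm A) = hid (vid A);
  vid_sq_comp : forall A A' A'' (g : hom A' A'') (f : hom A A'),
    vid_sq (g ∘ f) = hcomp (vid_sq g) (vid_sq f);
  vcomp : forall A B C, ver B C -> ver A B -> ver A C;
  vcomp_sq : forall A B C A' B' C'
    (u : ver A B) (v : ver B C) (u' : ver A' B') (v' : ver B' C')
    (y : sq v v') (x : sq u u'),
    bot x = top y -> sq (vcomp v u) (vcomp v' u');
  top_vcomp : forall A B C A' B' C'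
    (u : ver A B) (v : ver B C) (u' : ver A' B') (v' : ver B' C')
    (y : sq v v') (x : sq u u') (e : bot x = top y),
    top (vcomp_sq e) = top x;
  bot_vcomp : forall A B C A' B' C'
    (u : ver A B) (v : ver B C) (u' : ver A' B') (v' : ver B' C')
    (y : sq v v') (x : sq u u') (e : bot x = top y),
    bot (vcomp_sq e) = bot y;
  vcomp_sq_id : forall A B C (u : ver A B) (v : ver B C)
    (e : bot (hid u) = top (hid v)), vcomp_sq e = hid (vcomp v u);
  interchange : forall A B C A' B' C' A'' B'' C''
    (u : ver A B) (v : ver B C) (u' : ver A' B') (v' : ver B' C')
    (u'' : ver A'' B'') (v'' : ver B'' C'')
    (x : sq u u') (y : sq v v') (x' : sq u' u'') (y' : sq v' v'')
    (e : bot x = top y) (e' : bot x' = top y')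
    (e'' : bot (hcomp x' x) = top (hcomp y' y)),
    vcomp_sq e'' = hcomp (vcomp_sq e') (vcomp_sq e);
  vcomp_assoc : forall A B C D (w : ver C D) (v : ver B C) (u : ver A B),
    vcomp w (vcomp v u) = vcomp (vcomp w v) u;
  vcomp_idl : forall A B (u : ver A B), vcomp (vid B) u = u;
  vcomp_idr : forall A B (u : ver A B), vcomp u (vid A) = u;
  vcomp_sq_assoc : forall A B C D A' B' C' D'
    (u : ver A B) (v : ver B C) (w : ver C D)
    (u' : ver A' B') (v' : ver B' C') (w' : ver C' D')
    (x : sq u u') (y : sq v v') (z : sq w w')
    (e1 : bot x = top y) (e2 : bot (vcomp_sq e1) = top z)
    (e3 : bot y = top z) (e4 : bot x = top (vcomp_sq e3)),
    eq_over (vcomp_sq e2) (vcomp_sq e4);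
  vcomp_sq_idl : forall A B A' B' (u : ver A B) (u' : ver A' B') (x : sq u u')
    (e : bot x = top (vid_sq (bot x))), eq_over (vcomp_sq e) x;
  vcomp_sq_idr : forall A B A' B' (u : ver A B) (u' : ver A' B') (x : sq u u')
    (e : bot (vid_sq (top x)) = top x), eq_over (vcomp_sq e) x }.

Arguments ver {D} A B : rename.
Arguments sq {D A B A' B'} u v : rename.
Arguments top {D A B A' B' u v} x : rename.
Arguments bot {D A B A' B' u v} x : rename.
Arguments hid {D A B} u : rename.
Arguments hcomp {D A B A' B' A'' B'' u v w} y x : rename.
Arguments vid {D} A : rename.
Arguments vid_sq {D A A'} h : rename.
Arguments vcomp {D A B C} v u : rename.
Arguments vcomp_sq {D A B C A' B' C' u v u' v'} y x e : rename.

Record DoubleFunctor (D D' : DoubleCategory) := {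
  dfun :> Functor D D';
  dver : forall A B : D, ver A B -> ver (dfun A) (dfun B);
  dsq : forall (A B A' B' : D) (u : ver A B) (v : ver A' B'),
    sq u v -> sq (dver u) (dver v);
  dsq_top : forall (A B A' B' : D) (u : ver A B) (v : ver A' B') (x : sq u v),
    top (dsq x) = fmap dfun (top x);
  dsq_bot : forall (A B A' B' : D) (u : ver A B) (v : ver A' B') (x : sq u v),
    bot (dsq x) = fmap dfun (bot x);
  dsq_id : forall (A B : D) (u : ver A B), dsq (hid u) = hid (dver u);
  dsq_comp : forall (A B A' B' A'' B'' : D)
    (u : ver A B) (v : ver A' B') (w : ver A'' B'') (y : sq v w) (x : sq u v),
    dsq (hcomp y x) = hcomp (dsq y) (dsq x);
  dver_id : forall A : D, dver (vid A) = vid (dfun A);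
  dver_comp : forall (A B C : D) (v : ver B C) (u : ver A B),
    dver (vcomp v u) = vcomp (dver v) (dver u);
  dsq_vid : forall (A A' : D) (h : hom A A'),
    eq_over (dsq (vid_sq h)) (vid_sq (fmap dfun h));
  dsq_vcomp : forall (A B C A' B' C' : D)
    (u : ver A B) (v : ver B C) (u' : ver A' B') (v' : ver B' C')
    (y : sq v v') (x : sq u u') (e : bot x = top y)
    (e' : bot (dsq x) = top (dsq y)),
    eq_over (dsq (vcomp_sq y x e)) (vcomp_sq (dsq y) (dsq x) e') }.

Arguments dver {D D'} F {A B} u : rename.
Arguments dsq {D D'} F {A B A' B' u v} x : rename.

Definition id_double_functor (D : DoubleCategory) : DoubleFunctor D D.
Proof.
refine (@Build_DoubleFunctor D D (id_functor D) (fun A B u => u)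
          (fun A B A' B' u v x => x) _ _ _ _ _ _ _ _) => //=.
by move=> *; rewrite /eq_over; do 2!f_equal; apply: proof_irrelevance.
Defined.

Lemma eq_over_map (U V U' V' : Type) (S : U -> V -> Type)
  (S' : U' -> V' -> Type) (f : U -> U') (g : V -> V')
  (F : forall u v, S u v -> S' (f u) (g v))
  (u u' : U) (v v' : V) (x : S u v) (y : S u' v') :
  eq_over x y -> eq_over (F u v x) (F u' v' y).
Proof.
move=> e.
exact: (f_equal (fun t : {p : U * V & S (fst p) (snd p)} =>
  existT (fun p : U' * V' => S' (fst p) (snd p))
    (f (fst (projT1 t)), g (snd (projT1 t))) (F _ _ (projT2 t))) e).
Qed.

Definition comp_double_functor (D D' D'' : DoubleCategory)
  (G : DoubleFunctor D' D'') (F : DoubleFunctor D D') : DoubleFunctor D D''.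
Proof.
refine (@Build_DoubleFunctor D D'' (comp_functor G F)
          (fun A B u => dver G (dver F u))
          (fun A B A' B' u v x => dsq G (dsq F x)) _ _ _ _ _ _ _ _) => /=.
- by move=> *; rewrite !dsq_top.
- by move=> *; rewrite !dsq_bot.
- by move=> *; rewrite !dsq_id.
- by move=> *; rewrite !dsq_comp.
- by move=> *; rewrite !dver_id.
- by move=> *; rewrite !dver_comp.
- move=> A A' h; apply: eq_trans (dsq_vid G (fmap F h)).
  exact: (eq_over_map (fun u v x => dsq G x) (dsq_vid F h)).
- move=> A B C A' B' C' u v u' v' y x e e'.
  have e1 : bot (dsq F x) = top (dsq F y) by rewrite dsq_bot dsq_top e.
  apply: eq_trans (dsq_vcomp e1 e').
  exact: (eq_over_map (fun u v x => dsq G x) (dsq_vcomp e e1)).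
Defined.

Record DoubleCategoryOver (D : DoubleCategory) := {
  total :> DoubleCategory;
  proj : DoubleFunctor total D }.

Definition double_iso_over (D : DoubleCategory) (X Y : DoubleCategoryOver D) :
  Prop :=
  exists (F : DoubleFunctor X Y) (G : DoubleFunctor Y X),
    comp_double_functor G F = id_double_functor X /\
    comp_double_functor F G = id_double_functor Y /\
    comp_double_functor (proj Y) F = proj X.

(** Double categories with objects and horizontal arrows those of [M], in
    which squares are determined by their horizontal boundary and form a class
    [vs_sq] of commutative squares in [M]. *)
Record VerticalStructure (M : Category) := {
  vs_ver : M -> M -> Type;
  vs_map : forall A B, vs_ver A B -> hom A B;
  vs_sq : forall A B A' B', vs_ver A B -> vs_ver A' B' ->
    hom A A' -> hom B B' -> Prop;
  vs_id : forall A, vs_ver A A;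
  vs_comp : forall A B C, vs_ver B C -> vs_ver A B -> vs_ver A C;
  vs_map_id : forall A, vs_map (vs_id A) = idm A;
  vs_map_comp : forall A B C (v : vs_ver B C) (u : vs_ver A B),
    vs_map (vs_comp v u) = vs_map v ∘ vs_map u;
  vs_sq_comm : forall A B A' B' (u : vs_ver A B) (u' : vs_ver A' B') h k,
    vs_sq u u' h k -> k ∘ vs_map u = vs_map u' ∘ h;
  vs_sq_hid : forall A B (u : vs_ver A B), vs_sq u u (idm A) (idm B);
  vs_sq_hcomp : forall A B A' B' A'' B''
    (u : vs_ver A B) (u' : vs_ver A' B') (u'' : vs_ver A'' B'') h k h' k',
    vs_sq u' u'' h' k' -> vs_sq u u' h k -> vs_sq u u'' (h' ∘ h) (k' ∘ k);
  vs_sq_vid : forall A A' (h : hom A A'), vs_sq (vs_id A) (vs_id A') h h;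
  vs_sq_vcomp : forall A B C A' B' C' (u : vs_ver A B) (v : vs_ver B C)
    (u' : vs_ver A' B') (v' : vs_ver B' C') h k l,
    vs_sq v v' k l -> vs_sq u u' h k ->
    vs_sq (vs_comp v u) (vs_comp v' u') h l;
  vs_assoc : forall A B C D
    (w : vs_ver C D) (v : vs_ver B C) (u : vs_ver A B),
    vs_comp w (vs_comp v u) = vs_comp (vs_comp w v) u;
  vs_idl : forall A B (u : vs_ver A B), vs_comp (vs_id B) u = u;
  vs_idr : forall A B (u : vs_ver A B), vs_comp u (vs_id A) = u }.

Section VerticalStructureDouble.

Variables (M : Category) (V : VerticalStructure M).

Record vs_cell (A B A' B' : M) (u : vs_ver V A B) (v : vs_ver V A' B') := {
  cell_top : hom A A';
  cell_bot : hom B B';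
  cell_sq : vs_sq u v cell_top cell_bot }.

Lemma vs_cell_ext (A B A' B' : M) (u : vs_ver V A B) (v : vs_ver V A' B')
  (x y : vs_cell u v) :
  cell_top x = cell_top y -> cell_bot x = cell_bot y -> x = y.
Proof.
case: x => h k p; case: y => h' k' p' /= eh ek; subst h' k'.
by rewrite (proof_irrelevance _ p p').
Qed.

Lemma vs_cell_eq_over (A B A' B' : M) (u u' : vs_ver V A B)
  (v v' : vs_ver V A' B') (x : vs_cell u v) (y : vs_cell u' v') :
  u = u' -> v = v' -> cell_top x = cell_top y -> cell_bot x = cell_bot y ->
  eq_over x y.
Proof.
move=> eu ev et eb; subst u' v'; rewrite /eq_over; f_equal.
exact: vs_cell_ext.
Qed.

Lemma vs_vcomp_cell (A B C A' B' C' : M) (u : vs_ver V A B) (v : vs_ver V B C)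
  (u' : vs_ver V A' B') (v' : vs_ver V B' C') (y : vs_cell v v')
  (x : vs_cell u u') :
  cell_bot x = cell_top y ->
  vs_sq (vs_comp v u) (vs_comp v' u') (cell_top x) (cell_bot y).
Proof.
move=> e; apply: vs_sq_vcomp (cell_sq y) _.
by rewrite -e; apply: cell_sq.
Qed.

Definition vs_double : DoubleCategory.
Proof.
refine (@Build_DoubleCategory M (vs_ver V) vs_cell cell_top cell_bot
  (fun A B u => Build_vs_cell (vs_sq_hid u))
  (fun A B A' B' A'' B'' u v w y x =>
     Build_vs_cell (vs_sq_hcomp (cell_sq y) (cell_sq x)))
  _ _ _ _ _ _ _
  (vs_id V)
  (fun A A' h => Build_vs_cell (vs_sq_vid V h))
  _ _ _ _
  (@vs_comp M V)
  (fun A B C A' B' C' u v u' v' y x e => Build_vs_cell (vs_vcomp_cell e))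
  _ _ _ _ (@vs_assoc M V) (@vs_idl M V) (@vs_idr M V) _ _ _) => //=.
- by move=> *; apply: vs_cell_ext; apply: comp_assoc.
- by move=> *; apply: vs_cell_ext; apply: comp_idl.
- by move=> *; apply: vs_cell_ext; apply: comp_idr.
- by move=> *; apply: vs_cell_ext.
- by move=> *; apply: vs_cell_ext.
- by move=> *; apply: vs_cell_ext.
- by move=> *; apply: vs_cell_ext.
- by move=> *; apply: vs_cell_eq_over => //; apply: vs_assoc.
- by move=> *; apply: vs_cell_eq_over => //; apply: vs_idl.
- by move=> *; apply: vs_cell_eq_over => //; apply: vs_idr.
Defined.

End VerticalStructureDouble.

Definition Sq_structure (M : Category) : VerticalStructure M.
Proof.
refine (@Build_VerticalStructure M (fun A B => hom A B) (fun A B u => u)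
  (fun A B A' B' u v h k => k ∘ u = v ∘ h) (fun A => idm A)
  (fun A B C v u => v ∘ u) _ _ _ _ _ _ _ _ _ _) => //=.
- by move=> *; rewrite comp_idl comp_idr.
- move=> A B A' B' A'' B'' u u' u'' h k h' k' e' e.
  by rewrite -comp_assoc e comp_assoc e' comp_assoc.
- by move=> *; rewrite comp_idl comp_idr.
- move=> A B C A' B' C' u v u' v' h k l e' e.
  by rewrite comp_assoc e' -comp_assoc e comp_assoc.
- by move=> *; apply: comp_assoc.
- by move=> *; apply: comp_idl.
- by move=> *; apply: comp_idr.
Defined.

Definition Sq (M : Category) : DoubleCategory := vs_double (Sq_structure M).

Definition vs_proj (M : Category) (V : VerticalStructure M) :
  DoubleFunctor (vs_double V) (Sq M).
Proof.
refine (@Build_DoubleFunctor (vs_double V) (Sq M) (id_functor M)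
  (fun A B u => vs_map u)
  (fun A B A' B' u v x =>
     @Build_vs_cell M (Sq_structure M) A B A' B' (vs_map u) (vs_map v)
       (cell_top x) (cell_bot x) (vs_sq_comm (cell_sq x)))
  _ _ _ _ _ _ _ _) => //=.
- by move=> *; apply: vs_cell_ext.
- by move=> *; apply: vs_cell_ext.
- by move=> *; apply: vs_map_id.
- by move=> *; apply: vs_map_comp.
- by move=> *; apply: (@vs_cell_eq_over M (Sq_structure M)) => //; apply: vs_map_id.
- by move=> *; apply: (@vs_cell_eq_over M (Sq_structure M)) => //; apply: vs_map_comp.
Defined.

Definition vs_over (M : Category) (V : VerticalStructure M) :
  DoubleCategoryOver (Sq M) :=
  {| total := vs_double V; proj := vs_proj V |}.

Section AWFSDoubleCategories.

Variables (M : Category) (W : AWFS M).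

Definition ClovL_structure : VerticalStructure M.
Proof.
refine (@Build_VerticalStructure M (ClovenL W) (@clL_map M W) (@clL_square M W)
  (idL W) (@compL M W) _ _ _ _ _ _ _ _ _ _).
- by [].
- by [].
- by move=> A B A' B' u u' h k [].
- exact: clL_square_id.
- exact: clL_square_comp.
- exact: clL_square_vid.
- exact: clL_square_vcomp.
- exact: compL_assoc.
- exact: compL_idl.
- exact: compL_idr.
Defined.

Definition ClovR_structure : VerticalStructure M.
Proof.
refine (@Build_VerticalStructure M (ClovenR W) (@clR_map M W) (@clR_square M W)
  (idR W) (@compR M W) _ _ _ _ _ _ _ _ _ _).
- by [].
- by [].
- by move=> A B A' B' u u' h k [].
- exact: clR_square_id.
- exact: clR_square_comp.
- exact: clR_square_vid.
- exact: clR_square_vcomp.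
- exact: compR_assoc.
- exact: compR_idl.
- exact: compR_idr.
Defined.

Definition Coalg_structure : VerticalStructure M.
Proof.
refine (@Build_VerticalStructure M (Coalgebra W) (fun A B u => clL_map u)
  (fun A B A' B' u v h k => clL_square u v h k)
  (fun A => Build_Coalgebra (idL_coalgebra W A))
  (fun A B C v u =>
     Build_Coalgebra (compL_coalgebra (coalg_law v) (coalg_law u)))
  _ _ _ _ _ _ _ _ _ _).
- by [].
- by [].
- by move=> A B A' B' u u' h k [].
- by move=> *; apply: clL_square_id.
- by move=> A B A' B' A'' B'' u u' u'' h k h' k'; apply: clL_square_comp.
- by move=> *; apply: clL_square_vid.
- by move=> A B C A' B' C' u v u' v' h k l; apply: clL_square_vcomp.
- by move=> *; apply: coalgebra_ext; apply: compL_assoc.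
- by move=> *; apply: coalgebra_ext; apply: compL_idl.
- by move=> *; apply: coalgebra_ext; apply: compL_idr.
Defined.

Definition Alg_structure : VerticalStructure M.
Proof.
refine (@Build_VerticalStructure M (Algebra W) (fun A B u => clR_map u)
  (fun A B A' B' u v h k => clR_square u v h k)
  (fun A => Build_Algebra (idR_algebra W A))
  (fun A B C v u =>
     Build_Algebra (compR_algebra (alg_law v) (alg_law u)))
  _ _ _ _ _ _ _ _ _ _).
- by [].
- by [].
- by move=> A B A' B' u u' h k [].
- by move=> *; apply: clR_square_id.
- by move=> A B A' B' A'' B'' u u' u'' h k h' k'; apply: clR_square_comp.
- by move=> *; apply: clR_square_vid.
- by move=> A B C A' B' C' u v u' v' h k l; apply: clR_square_vcomp.
- by move=> *; apply: algebra_ext; apply: compR_assoc.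
- by move=> *; apply: algebra_ext; apply: compR_idl.
- by move=> *; apply: algebra_ext; apply: compR_idr.
Defined.

Definition ClovL : DoubleCategoryOver (Sq M) := vs_over ClovL_structure.
Definition ClovR : DoubleCategoryOver (Sq M) := vs_over ClovR_structure.
Definition Coalg : DoubleCategoryOver (Sq M) := vs_over Coalg_structure.
Definition Alg : DoubleCategoryOver (Sq M) := vs_over Alg_structure.

Definition left_class (f : arrow M) : Prop :=
  exists u : ClovenL W (adom f) (acod f), clL_map u = amap f.

Definition right_class (f : arrow M) : Prop :=
  exists a : ClovenR W (adom f) (acod f), clR_map a = amap f.

Definition has_coalgebra (f : arrow M) : Prop :=
  exists u : Coalgebra W (adom f) (acod f), clL_map u = amap f.

Definition has_algebra (f : arrow M) : Prop :=
  exists a : Algebra W (adom f) (acod f), clR_map a = amap f.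

Definition left_retract_closed : Prop :=
  forall f g : Arrow M, is_retract f g -> has_coalgebra g -> has_coalgebra f.

Definition right_retract_closed : Prop :=
  forall f g : Arrow M, is_retract f g -> has_algebra g -> has_algebra f.

End AWFSDoubleCategories.

Definition same_underlying_wfs (M : Category) (W W' : AWFS M) : Prop :=
  (forall f : arrow M, left_class W f <-> left_class W' f) /\
  (forall f : arrow M, right_class W f <-> right_class W' f).

(** A morphism of functorial factorizations [phi] underlying both a comonad
    morphism [(1,phi)] and a monad morphism [(phi,1)]. *)
Record AWFSMorphism (M : Category) (W W' : AWFS M) := {
  awm :> NatTrans (ffE W) (ffE W');
  awm_L : forall f : arrow M,
    awm f ∘ ffL W f = ffL W' f ∘ idm (adom f);
  awm_R : forall f : arrow M,
    idm (acod f) ∘ ffR W f = ffR W' f ∘ awm f;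
  awm_delta : forall f : arrow M,
    delta W' f ∘ awm f
    = Emap W' (f := mkArrow (ffL W f)) (g := mkArrow (ffL W' f))
        (idm (adom f)) (awm f) (awm_L f)
      ∘ (awm (mkArrow (ffL W f)) ∘ delta W f);
  awm_mu : forall f : arrow M,
    awm f ∘ mu W f
    = mu W' f
      ∘ (Emap W' (f := mkArrow (ffR W f)) (g := mkArrow (ffR W' f))
           (awm f) (idm (acod f)) (awm_R f)
         ∘ awm (mkArrow (ffR W f))) }.

Definition awfs_isomorphic (M : Category) (W W' : AWFS M) : Prop :=
  exists phi : AWFSMorphism W W', forall f : arrow M, invertible (phi f).

(* Main.v *)
From Stdlib Require Import Classical ClassicalEpsilon ProofIrrelevance
  FunctionalExtensionality PropExtensionality Inverse_Image Eqdep List.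
From Corelib Require Import ssreflect.
Require Import Defs.

(** A cloven left map is a coalgebra for the copointed endofunctor [Lfunctor W]
    of the arrow category: its structure is a section of the counit, subject to
    no coassociativity.  So the comonad of [Wsharp] has to be the one that is
    cofree on this copointed endofunctor, and its coalgebras inherit the vertical
    composition of cloven left maps.  Two facts make this precise.

    First, suppose that a double category over the squares of [M] has cofree
    vertical arrows ([presented]), and that each vertical arrow receives a square
    from the identity on its domain ([connected]).  Then it determines an
    algebraic weak factorization system.
    An arrow [f] is factored through the cofree vertical arrow over it, the
    comultiplication is induced by the universal property, and the
    multiplication by the vertical composite of the cofree arrows on [f] and on
    the right part of [f].  All laws compare two squares into a cofree arrow
    ([presented_laws]).  If vertical arrows are the coalgebras for the
    comonad of cofree ones, then the coalgebras of the system form the given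
    double category ([coalgebras_of_presented]).  Conversely, every algebraic
    weak factorization system is presented by its own coalgebras
    ([coalgebras_presented]), and a presentation is determined by the double
    category ([compare_presented]); this gives uniqueness.

    Second, an accessible copointed endofunctor of a locally presentable
    category has cofree coalgebras, and they depend accessibly on the object
    ([cofree_exists], [cofree_bcontinuous]).  Here a bound [B] on all sizes is
    fixed, and the presentable objects of that size are arranged into a family
    that is closed under colimits of size [B].  Every object is the filtered
    colimit of its generalized elements over this family, so a presheaf that
    turns colimits of size [B] into limits is represented by the colimit of its
    elements ([colimit_of_elements]).  Every generalized element of a coalgebra
    lies in a small coalgebra, obtained as the union of a chain
    ([small_coalgebra_extension]); hence small coalgebras generate, and the
    cofree coalgebra on [X] represents the maps from small coalgebras to [X].

    For [Wflat], cloven right maps are the algebras for the pointed endofunctor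
    [Rfunctor W].  Local presentability is not a self-dual notion, so the free
    algebras need a proof of their own: the terms over a given object bound the
    size of the algebras that it generates, which gives a weakly initial
    set ([generated_subalgebra], [free_exists]).  From there on the argument is
    the one above in the opposite category.

    The counits compare the cofree factorization with that of [W] in both
    directions, whence the same underlying weak factorization system.  The
    retract-closure statements hold because retracts of cloven maps are cloven
    ([left_class_retract], [right_class_retract]). *)

Set Implicit Arguments.
Unset Strict Implicit.
Unset Printing Implicit Defensive.

(** * Choice and cardinals *)

Lemma dchoice (A : Type) (P : A -> Type) (R : forall a, P a -> Prop) :
  (forall a, exists b, R a b) -> exists f : forall a, P a, forall a, R a (f a).
Proof.
move=> H.
exists (fun a => proj1_sig (constructive_indefinite_description _ (H a))).
by move=> a; case: (constructive_indefinite_description _ _).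
Qed.

Definition truth (P : Prop) : bool :=
  match excluded_middle_informative P with left _ => true | right _ => false end.

Lemma truthP (P : Prop) : truth P = true <-> P.
Proof. by rewrite /truth; case: (excluded_middle_informative P). Qed.

Lemma sig_ext (A : Type) (P : A -> Prop) (x y : {a | P a}) :
  proj1_sig x = proj1_sig y -> x = y.
Proof.
case: x => x p; case: y => y q /= e; subst y.
by rewrite (proof_irrelevance _ p q).
Qed.

Lemma card_le_trans (B A C : Type) : card_le A B -> card_le B C -> card_le A C.
Proof.
case=> f hf [g hg]; exists (fun x => g (f x)).
by move=> x y /hg /hf.
Qed.

Lemma card_le_surj (A B : Type) (f : A -> B) :
  (forall b, exists a, f a = b) -> card_le B A.
Proof.
by move=> /dchoice [g hg]; exists g => x y e; rewrite -(hg x) -(hg y) e.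
Qed.

Lemma card_le_rel (A B : Type) (R : A -> B -> Prop) :
  (forall a, exists b, R a b) -> (forall a a' b, R a b -> R a' b -> a = a') ->
  card_le A B.
Proof.
move=> /dchoice [f hf] inj; exists f => x y e.
by apply: inj (hf x) _; rewrite e.
Qed.

Lemma card_le_pair (A A' B B' : Type) :
  card_le A A' -> card_le B B' -> card_le (A * B) (A' * B').
Proof.
case=> f hf [g hg]; exists (fun x => (f (fst x), g (snd x))).
by move=> [x y] [x' y'] [/= /hf -> /hg ->].
Qed.

Lemma card_le_list (A B : Type) : card_le A B -> card_le (list A) (list B).
Proof.
case=> f hf; exists (map f); elim=> [|a l IH] [|b m] //= [/hf -> /IH ->] //.
Qed.

(** Sizes for which finite constructions stay within the bound. *)
Definition roomy (B : Set) : Prop := card_le nat B /\ card_le (list B) B.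

Section Roomy.

Variables (B : Set) (hB : roomy B).

Lemma roomy_pair : card_le (B * B) B.
Proof.
apply: card_le_trans (proj2 hB).
by exists (fun x => fst x :: snd x :: nil) => -[a b] [c d] [/= -> ->].
Qed.

Lemma card_le_prod (V E : Type) : card_le V B -> card_le E B -> card_le (V * E) B.
Proof. by move=> v e; apply: card_le_trans roomy_pair; apply: card_le_pair. Qed.

Lemma roomy_bool : card_le bool B.
Proof.
by apply: card_le_trans (proj1 hB); exists (fun b : bool => if b then 0 else 1) => -[] [].
Qed.

Lemma card_le_option (V : Type) : card_le V B -> card_le (option V) B.
Proof.
move=> hV; apply: card_le_trans (proj2 hB); apply: card_le_trans (card_le_list hV).
exists (fun o => match o with Some v => v :: nil | None => nil end).
by move=> [a|] [b|] //= [->].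
Qed.

End Roomy.

(** Pairing as a constructor gives a set above [X] that absorbs its own finite
    powers without any cardinal arithmetic. *)
Inductive pairing_closure (X : Set) : Set :=
| pc_in (x : X)
| pc_pair (a b : pairing_closure X).

Lemma pairing_closure_roomy (X : Set) : card_le nat X -> roomy (pairing_closure X).
Proof.
move=> [f hf]; split; first by exists (fun n => pc_in (f n)) => x y [/hf].
exists (fix enc l := match l with
                     | nil => pc_in (f 0)
                     | a :: l => pc_pair a (enc l)
                     end).
by elim=> [|a l IH] [|b m] //= [-> /IH ->].
Qed.

Lemma card_le_pairing_closure (X : Set) : card_le X (pairing_closure X).
Proof. by exists (@pc_in X) => x y []. Qed.

(** ** Regular cardinals above a given set *)

Section Successor.

Variable (B : Set).

(** Well-founded trees with branching [B], compared by rank, stand for the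
    ordinals below the successor cardinal of [B]. *)
Inductive ordinal : Set :=
| ozero
| osup (f : B -> ordinal).

Fixpoint ole (t s : ordinal) : Prop :=
  match t with
  | ozero => True
  | osup f => forall b, match s with
                        | ozero => False
                        | osup g => exists b', ole (f b) (g b')
                        end
  end.

Definition olt (t s : ordinal) : Prop :=
  match s with
  | ozero => False
  | osup g => exists b, ole t (g b)
  end.

Lemma ole_total t s : (ole t s \/ olt s t) /\ (olt t s \/ ole s t).
Proof.
suff H : forall s, ole t s \/ olt s t.
  split => //; case: s => [|g]; first by right.
  case: (classic (olt t (osup g))) => n; [by left | right => b].
  case: (H (g b)) => //.
  by move=> l; case: n; exists b.
elim: t {s} => [|f IH] s; first by left.
case: (classic (ole (osup f) s)) => n; first by left.
right; have [b nb] := not_all_ex_not _ _ n.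
have : ole s (f b) \/ olt (f b) s; last by case=> // l; exists b.
case: s {n} nb => [|g] nb; first by left.
left => b'; case: (IH b (g b')) => // l.
by case: nb; exists b'.
Qed.

Lemma ole_trans t s r : ole t s -> ole s r -> ole t r.
Proof.
elim: t s r => // f IH s r ts sr b.
case: s ts sr => [|g] ts sr; first by case: (ts b).
case: (ts b) => b' l; case: r sr => [|h] sr; first by case: (sr b').
by case: (sr b') => b'' l'; exists b''; apply: IH l'.
Qed.

Lemma ole_refl t : ole t t.
Proof. by elim: t => [|f IH] //= b; exists b. Qed.

Lemma olt_ole_trans t s r : olt t s -> ole s r -> olt t r.
Proof.
case: s => //= g [b l] sr; case: r sr => [|h] sr; first by case: (sr b).
by case: (sr b) => b' l'; exists b'; apply: ole_trans l l'.
Qed.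

Lemma ole_olt_trans t s r : ole t s -> olt s r -> olt t r.
Proof. by case: r => //= h l [b l']; exists b; apply: ole_trans l l'. Qed.

Lemma olt_irrefl t : ~ olt t t.
Proof.
elim: t => [|f IH] //= [b l].
by apply: (IH b); apply: (l b).
Qed.

Lemma olt_wf : well_founded olt.
Proof.
suff H t : forall s, ole s t -> Acc olt s by move=> t; apply: (H t); apply: ole_refl.
elim: t => [|f IH] s l; constructor => r rs.
  by have := olt_ole_trans rs l.
by have [b l'] := olt_ole_trans rs l; apply: IH l'.
Qed.

Definition oeq t s := ole t s /\ ole s t.

Definition orep (t : ordinal) : ordinal := epsilon (inhabits ozero) (oeq t).

Lemma orepP t : oeq t (orep t).
Proof. by apply: epsilon_spec; exists t; split; apply: ole_refl. Qed.

Lemma orep_eq t s : oeq t s -> orep t = orep s.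
Proof.
case=> ts st; rewrite /orep; congr epsilon.
apply: functional_extensionality => r; apply: propositional_extensionality.
by split=> -[a b]; split; apply: ole_trans; eassumption.
Qed.

Definition succ_card : Set := {t : ordinal | orep t = t}.

Definition slt (x y : succ_card) := olt (proj1_sig x) (proj1_sig y).

Lemma slt_wf : well_founded slt.
Proof. exact: (wf_inverse_image _ _ _ (@proj1_sig _ _) olt_wf). Qed.

Lemma slt_total x y : slt x y \/ x = y \/ slt y x.
Proof.
case: (proj1 (ole_total (proj1_sig x) (proj1_sig y))) => l; last by right; right.
case: (proj1 (ole_total (proj1_sig y) (proj1_sig x))) => l'; last by left.
by right; left; apply: sig_ext; rewrite -(proj2_sig x) -(proj2_sig y); apply: orep_eq.
Qed.

Fixpoint subtree (t : ordinal) (p : list B) {struct p} : ordinal :=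
  match p, t with
  | b :: p, osup f => subtree (f b) p
  | _, _ => t
  end.

(** The ordinals below the rank of [t] are the ranks of its proper subtrees,
    which are addressed by finite sequences of branches. *)
Lemma olt_subtree t s : olt s t -> exists p, oeq s (subtree t p).
Proof.
elim: t => [|f IH] //= [b l].
case: (proj1 (ole_total (f b) s)) => l'; first by exists (b :: nil).
by have [p e] := IH b l'; exists (b :: p).
Qed.

Lemma succ_segment x : card_le {y | slt y x} (list B).
Proof.
apply: (@card_le_rel {y | slt y x} (list B) (fun y p => oeq (proj1_sig (proj1_sig y))
                                        (subtree (proj1_sig x) p))).
  by move=> [y l]; exact: (olt_subtree l).
move=> y y' p [a b] [a' b']; apply: sig_ext; apply: sig_ext.
rewrite -(proj2_sig (proj1_sig y)) -(proj2_sig (proj1_sig y')).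
by apply: orep_eq; split; apply: ole_trans; eassumption.
Qed.

(** An enumeration by a part of [B] would have a strict upper bound. *)
Lemma succ_not_le : ~ card_le succ_card B.
Proof.
case=> i hi.
have [f hf] : exists f : B -> ordinal, forall b x, i x = b -> f b = proj1_sig x.
  apply: (@dchoice B (fun _ => ordinal)
           (fun b t => forall x, i x = b -> t = proj1_sig x)) => b.
  case: (classic (exists x, i x = b)) => [[x e]|n].
    by exists (proj1_sig x) => y e'; rewrite (hi x y) // e e'.
  by exists ozero => x e; case: n; exists x.
have rr : orep (orep (osup f)) = orep (osup f).
  by rewrite -(orep_eq (orepP (osup f))).
have [a b] := orepP (osup f).
pose x : succ_card := exist _ (orep (osup f)) rr.
apply: (@olt_irrefl (osup f)); apply: ole_olt_trans a _.
by exists (i x); rewrite (hf _ x eq_refl); apply: ole_refl.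
Qed.

(** Exhausting [X] along the well-order: either every ordinal receives a new
    element, or [X] is enumerated by an initial segment. *)
Lemma succ_compare (X : Type) : card_le succ_card X \/ exists x, card_le X {y | slt y x}.
Proof.
case: (classic (inhabited X)) => [ix|nx]; last first.
  right; exists (exist (fun t => orep t = t) (orep ozero) (eq_sym (orep_eq (orepP ozero)))).
  by exists (fun x => False_rect _ (nx (inhabits x))) => x; case: nx.
pose step (x : succ_card) (g : forall y, slt y x -> X) : X :=
  epsilon ix (fun a => forall y l, g y l <> a).
pose h := Fix slt_wf (fun _ => X) step.
have hE x : h x = epsilon ix (fun a => forall y, slt y x -> h y <> a).
  by rewrite /h Fix_eq // => y g g' e; rewrite /step; congr epsilon;
    apply: functional_extensionality => a; apply: propositional_extensionality;
    split=> H z l; have := H z l; rewrite e.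
case: (classic (forall x, exists a, forall y, slt y x -> h y <> a)) => H.
  left; exists h => x y e.
  have new z : forall y, slt y z -> h y <> h z.
    by rewrite (hE z); apply: epsilon_spec (H z).
  by case: (slt_total x y) => [/new|[|/new]] //; rewrite e.
have [x nx] := not_all_ex_not _ _ H.
right; exists x; apply: (@card_le_surj _ _ (fun y => h (proj1_sig y))) => a.
apply: NNPP => n; apply: nx; exists a => y l e; apply: n.
by exists (exist _ y l).
Qed.

Lemma regular_above : roomy B ->
  exists K : Set, regular_cardinal K /\ forall X : Type, card_le X B -> card_lt X K.
Proof.
move=> hB; exists succ_card.
have seg X x : card_le X {y | slt y x} -> card_le X B.
  move=> l; apply: card_le_trans (proj2 hB).
  exact: card_le_trans l (succ_segment x).
have le : card_le B succ_card.
  case: (succ_compare B) => [/succ_not_le //|[x l]].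
  by apply: card_le_trans l _; exists (@proj1_sig _ _) => ? ?; apply: sig_ext.
have up X : card_le X B -> card_lt X succ_card.
  move=> l; split; first exact: card_le_trans le.
  by move=> /(fun l' => card_le_trans l' l) /succ_not_le.
have down X : card_lt X succ_card -> card_le X B.
  by case=> _ n; case: (succ_compare X) => // -[x /seg].
split => //; split; first exact: card_le_trans (proj1 hB) le.
move=> I F /down lI lF; apply: up; apply: card_le_trans (roomy_pair hB).
have /dchoice [f hf] : forall i, exists f : F i -> B, forall x y, f x = f y -> x = y.
  by move=> i; apply: down (lF i).
case: lI => g hg; exists (fun x => (g (projT1 x), f _ (projT2 x))).
move=> [i x] [j y] [/= /hg e]; subst j.
by move=> /hf ->.
Qed.

End Successor.

(** * Colimits of graphs and filtered categories *)

Section Graphs.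

(** A diagram shape is a family of objects with a relation selecting the
    morphisms between them that cocones have to respect.  No composition is
    asked for, so that such shapes are easy to encode and to reindex. *)
Variables (C : Category) (V : Type) (o : V -> C)
  (r : forall v w, hom (o v) (o w) -> Prop).

Definition gcocone (X : C) (l : forall v, hom (o v) X) : Prop :=
  forall v w m, @r v w m -> l w ∘ m = l v.

Definition is_gcolim (X : C) (l : forall v, hom (o v) X) : Prop :=
  gcocone l /\
  forall Y (k : forall v, hom (o v) Y), gcocone k ->
    exists! h : hom X Y, forall v, h ∘ l v = k v.

Definition gedges : Type := {v : V & {w : V & {m : hom (o v) (o w) | @r v w m}}}.

Lemma gcolim_epi X (l : forall v, hom (o v) X) Y (h h' : hom X Y) :
  is_gcolim l -> (forall v, h ∘ l v = h' ∘ l v) -> h = h'.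
Proof.
move=> [cl ul] e.
have [|k [_ u]] := ul Y (fun v => h ∘ l v).
  by move=> v w m /cl <-; rewrite comp_assoc.
by rewrite -(u h) // -(u h') // => v; rewrite e.
Qed.

End Graphs.

Arguments gcocone {C V} o r {X} l.
Arguments is_gcolim {C V} o r {X} l.

Lemma gedges_image (C C' : Category) (V : Type) (o : V -> C) (o' : V -> C')
  (phi : forall v w, hom (o v) (o w) -> hom (o' v) (o' w))
  (r : forall v w, hom (o v) (o w) -> Prop) :
  card_le (gedges (fun v w (m' : hom (o' v) (o' w)) => exists m, r v w m /\ phi v w m = m'))
    (gedges r).
Proof.
apply: (@card_le_surj _ _ (fun e => existT _ (projT1 e) (existT _ (projT1 (projT2 e))
  (exist _ (phi _ _ (proj1_sig (projT2 (projT2 e))))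
    (ex_intro _ _ (conj (proj2_sig (projT2 (projT2 e))) eq_refl)))))).
move=> [v [w [m' [m [rm e]]]]]; subst m'.
by exists (existT _ v (existT _ w (exist _ m rm))).
Qed.

(** The reindexing is assumed to be injective and surjective, instead of coming
    with an inverse, because the objects of the diagram depend on the vertices
    and would have to be transported along the inverse laws. *)
Lemma gcocone_reindex (C : Category) (V V' : Type) (o : V -> C)
  (r : forall v w, hom (o v) (o w) -> Prop) (g : V' -> V) (X : C)
  (l : forall v', hom (o (g v')) X) :
  (forall x y, g x = g y -> x = y) -> (forall v, exists v', g v' = v) ->
  gcocone (fun v' => o (g v')) (fun v w m => r (g v) (g w) m) l ->
  exists k : forall v, hom (o v) X, gcocone o r k /\ forall v', k (g v') = l v'.
Proof.
move=> inj surj cl.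
have [k hk] : exists k : forall v, hom (o v) X,
    forall v v' (e : g v' = v), k v = eq_rect _ (fun v => hom (o v) X) (l v') v e.
  apply: (@dchoice V (fun v => hom (o v) X) (fun v kv => forall v' (e : g v' = v),
    kv = eq_rect _ (fun v => hom (o v) X) (l v') v e)) => v.
  have [v' e] := surj v; subst v; exists (l v') => w e.
  have ew := inj _ _ e; subst w.
  by rewrite (proof_irrelevance _ e eq_refl).
exists k; split=> [v w m|v']; last by rewrite (hk _ v' eq_refl).
have [v' e] := surj v; have [w' e'] := surj w; subst v w => rm.
by rewrite (hk _ v' eq_refl) (hk _ w' eq_refl) /=; apply: cl.
Qed.

Section Paths.

Variables (V E : Set) (s t : E -> V).

Inductive path : V -> V -> Set :=
| pnil v : path v v
| pcons e x (p : path (t e) x) : path (s e) x.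

Fixpoint pcat v w x (p : path v w) : path w x -> path v x :=
  match p with
  | pnil v => fun q => q
  | pcons p => fun q => pcons (pcat p q)
  end.

Definition path_category : Category.
Proof.
refine (@Build_Category V path pnil (fun A B C q p => pcat p q) _ _ _).
- by move=> A B C D h g f; elim: f g => //= e x p IH g; rewrite IH.
- by move=> A B f; elim: f => //= e x p ->.
- by [].
Defined.

Variables (C : Category) (o : V -> C) (m : forall e, hom (o (s e)) (o (t e))).

Fixpoint peval v w (p : path v w) : hom (o v) (o w) :=
  match p with
  | pnil v => idm (o v)
  | @pcons e x p => peval p ∘ m e
  end.

Definition path_functor : Functor path_category C.
Proof.
refine (@Build_Functor path_category C o peval _ _) => //.
move=> A B X g f; elim: f g => [v|e x p IH] g /=; first by rewrite comp_idr.
by rewrite IH comp_assoc.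
Defined.

Fixpoint pedges v w (p : path v w) : list E :=
  match p with
  | pnil _ => nil
  | @pcons e x p => e :: pedges p
  end.

Lemma pedges_inj v w (p : path v w) v' w' (p' : path v' w') :
  v = v' -> pedges p = pedges p' ->
  existT (fun v => {w & path v w}) v (existT _ w p)
  = existT (fun v => {w & path v w}) v' (existT _ w' p').
Proof.
elim: p v' w' p' => [{}v|e x p IH] v' w' [{}v'|e' x' p'] //=; first by move=> ->.
move=> _ [ee]; subst e' => /(IH _ _ _ eq_refl) q.
have {}q := inj_pair2 _ _ _ _ _ q.
exact: (f_equal (fun a : {x & path (t e) x} => existT (fun v => {w & path v w})
         (s e) (existT _ (projT1 a) (pcons (projT2 a)))) q).
Qed.

Lemma card_le_paths : card_le (arrows path_category) (V * list E).
Proof.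
exists (fun a => (projT1 a, pedges (projT2 (projT2 a)))).
by move=> [v [w p]] [v' [w' p']] [/=]; apply: pedges_inj.
Qed.

End Paths.

Lemma gcolim_exists (C : Category) (V : Set) (o : V -> C)
  (r : forall v w, hom (o v) (o w) -> Prop) :
  cocomplete C -> exists X (l : forall v, hom (o v) X), is_gcolim o r l.
Proof.
move=> coc.
pose E : Set := {v : V & {w : V & {m : hom (o v) (o w) | r v w m}}}.
pose m (e : E) : hom (o (projT1 e)) (o (projT1 (projT2 e))) :=
  proj1_sig (projT2 (projT2 e)).
pose D := path_functor (s := fun e : E => projT1 e) m.
have sm : small (path_category (fun e : E => projT1 e) (fun e => projT1 (projT2 e))).
  by exists V, (fun v => v), (fun v => v).
have [c uc] := coc _ D sm.
exists (apex c), (leg c : forall v, hom (o v) (apex c)); split.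
  move=> v w a ra; pose e : E := existT _ v (existT _ w (exist _ a ra)).
  have := @leg_nat _ _ _ c v w (@pcons _ _ (fun e : E => projT1 e) _ e w (pnil _ _ _)).
  by move=> /=; rewrite comp_idl.
move=> Y k ck.
have nat_k i j (u : @hom (path_category (fun e : E => projT1 e) (fun e => projT1 (projT2 e))) i j) :
    k j ∘ fmap D u = k i.
  elim: u => [v|e x p IH] /=; first by rewrite comp_idr.
  by rewrite comp_assoc IH; apply: ck (proj2_sig (projT2 (projT2 e))).
exact: (uc (@Build_Cocone _ _ D Y k nat_k)).
Qed.

(** Only graphs are asked to have cocones, so that composites and identities of
    diagrams need no attention when filteredness is used; free categories on
    graphs relate this to [filtered]. *)
Definition gfiltered (B : Set) (J : Category) : Prop :=
  forall (V : Set) (o : V -> J) (r : forall v w, hom (o v) (o w) -> Prop),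
    card_le V B -> card_le (gedges r) B ->
    exists X (l : forall v, hom (o v) X), gcocone o r l.

Lemma filtered_gfiltered (B K : Set) (J : Category) : roomy B ->
  (forall X : Type, card_le X B -> card_lt X K) -> filtered K J -> gfiltered B J.
Proof.
move=> hB lt fJ V o r lV lE.
pose E : Set := {v : V & {w : V & {m : hom (o v) (o w) | r v w m}}}.
pose m (e : E) : hom (o (projT1 e)) (o (projT1 (projT2 e))) :=
  proj1_sig (projT2 (projT2 e)).
pose D := path_functor (s := fun e : E => projT1 e) m.
have [|c] := fJ _ D.
  apply: lt; apply: card_le_trans (card_le_paths _ _) _.
  apply: (card_le_prod hB) => //.
  by apply: card_le_trans (proj2 hB); apply: card_le_list.
exists (apex c), (leg c : forall v, hom (o v) (apex c)).
move=> v w a ra; pose e : E := existT _ v (existT _ w (exist _ a ra)).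
have := @leg_nat _ _ _ c v w (@pcons _ _ (fun e : E => projT1 e) _ e w (pnil _ _ _)).
by move=> /=; rewrite comp_idl.
Qed.

Lemma gfiltered_filtered (B K : Set) (J : Category) :
  card_le K B -> gfiltered B J -> filtered K J.
Proof.
move=> KB fJ S D [[f hf] _].
pose a (s : S) : arrows S := existT _ s (existT _ s (idm s)).
have ha s s' : f (a s) = f (a s') -> s = s'.
  by move=> /hf e; apply: (f_equal (@projT1 _ _) e).
pose V : Set := {k : K | exists s, f (a s) = k}.
have [g hg] : exists g : V -> S, forall v, f (a (g v)) = proj1_sig v.
  by apply: (@dchoice V (fun _ => S) (fun v s => f (a s) = proj1_sig v)) => -[k []]; eauto.
have inj x y : g x = g y -> x = y.
  by move=> e; apply: sig_ext; rewrite -!hg e.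
have surj s : exists v, g v = s.
  have p : exists s', f (a s') = f (a s) by exists s.
  by exists (exist (fun k => exists s, f (a s) = k) _ p : V); apply: ha; rewrite hg.
pose r (s s' : S) (m : hom (D s) (D s')) := exists u : hom s s', m = fmap D u.
have [||X [l cl]] := fJ V (fun v => D (g v)) (fun v w m => r (g v) (g w) m).
  by apply: card_le_trans KB; exists (fun v => proj1_sig v) => x y; apply: sig_ext.
  apply: card_le_trans KB.
  apply: (@card_le_rel _ _ (fun e k => exists u : hom (g (projT1 e)) (g (projT1 (projT2 e))),
    proj1_sig (projT2 (projT2 e)) = fmap D u /\ f (existT _ _ (existT _ _ u)) = k)).
    by move=> [v [w [m [u e]]]]; exists (f (existT _ _ (existT _ _ u))), u.
  move=> [v [w [m rm]]] [v' [w' [m' rm']]] k [/= u [e <-]] [u' [e' /hf q]].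
  have ev := inj _ _ (f_equal (@projT1 _ _) q); subst v'.
  have {}q := inj_pair2 _ _ _ _ _ q.
  have ew := inj _ _ (f_equal (@projT1 _ _) q); subst w'.
  have {}q := inj_pair2 _ _ _ _ _ q.
  subst u' m m'.
  by rewrite (proof_irrelevance _ rm rm').
have [k [ck _]] := gcocone_reindex (o := fun s => D s) (r := r) inj surj cl.
constructor; refine (@Build_Cocone _ _ D X k _).
by move=> i j u; apply: ck; exists u.
Qed.

Section Filtered.

Variables (B : Set) (hB : roomy B) (J : Category) (fJ : gfiltered B J).

Lemma filtered_family (V : Set) (o : V -> J) : card_le V B ->
  exists X, inhabited (forall v, hom (o v) X).
Proof.
move=> lV; have [||X [l _]] := fJ (o := o) (r := fun _ _ _ => False) => //.
  by exists (fun e => False_rect B (proj2_sig (projT2 (projT2 e)))) => -[? [? []]].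
by exists X.
Qed.

Lemma filtered_bound (i j : J) : exists k (u : hom i k) (v : hom j k), True.
Proof.
have [X [l]] := @filtered_family bool (fun b => if b then i else j) (roomy_bool hB).
by exists X, (l true), (l false).
Qed.

Lemma filtered_coequal (i j : J) (u v : hom i j) : exists k (w : hom j k), w ∘ u = w ∘ v.
Proof.
pose o (b : bool) := if b then j else i.
pose r (b b' : bool) : hom (o b) (o b') -> Prop :=
  match b, b' with
  | false, true => fun m => m = u \/ m = v
  | _, _ => fun _ => False
  end.
have [||X [l cl]] := fJ (o := o) (r := r); first exact: roomy_bool.
  apply: card_le_trans (roomy_bool hB).
  apply: (@card_le_rel (gedges r) bool (fun e b => match e with
    | existT _ false (existT _ true (exist _ m _)) => if b then m = u else m = v
    | _ => False end)).
    by move=> [[] [[] [m []]]] // e; [exists true|exists false].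
  move=> [[] [[] [m []]]] // e [[] [[] [m' []]]] // e' [] *; subst;
    congr existT; congr existT; exact: sig_ext.
exists X, (l true).
exact: eq_trans (cl false true u (or_introl eq_refl))
         (eq_sym (cl false true v (or_intror eq_refl))).
Qed.

Lemma filtered_span (E : Set) (i : J) (k : E -> J) (u : forall e, hom i (k e)) :
  card_le E B ->
  exists X (w : forall e, hom (k e) X) (d : hom i X), forall e, w e ∘ u e = d.
Proof.
move=> lE.
pose o (b : option E) := match b with Some e => k e | None => i end.
pose r (b b' : option E) : hom (o b) (o b') -> Prop :=
  match b, b' with
  | None, Some e => fun m => m = u e
  | _, _ => fun _ => False
  end.
have [||X [l cl]] := fJ (o := o) (r := r); first exact: card_le_option.
  apply: card_le_trans lE.
  apply: (@card_le_rel (gedges r) E (fun e b => match e with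
    | existT _ None (existT _ (Some e) _) => e = b
    | _ => False end)).
    by move=> [[?|] [[e|] [m]]] // _; exists e.
  move=> [[?|] [[e|] [m]]] //= q [[?|] [[e'|] [m']]] // q' b *; subst.
  by congr existT; congr existT; exact: sig_ext.
exists X, (fun e => l (Some e)), (l None) => e.
exact: (cl None (Some e)).
Qed.

End Filtered.

(** * Presentable objects *)

Section Colimits.

Variables (J C : Category) (D : Functor J C).

Lemma colim_epi (c : Cocone D) X (h h' : hom (apex c) X) : is_colimit c ->
  (forall j, h ∘ leg c j = h' ∘ leg c j) -> h = h'.
Proof.
move=> uc e.
have nat i j (u : hom i j) : h ∘ leg c j ∘ fmap D u = h ∘ leg c i.
  by rewrite -comp_assoc leg_nat.
have [k [_ u]] := uc (Build_Cocone nat).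
by rewrite -(u h) // -(u h') // => j /=; rewrite e.
Qed.

Lemma colim_desc (c : Cocone D) X (k : forall j, hom (D j) X) : is_colimit c ->
  (forall i j (u : hom i j), k j ∘ fmap D u = k i) ->
  exists h : hom (apex c) X, forall j, h ∘ leg c j = k j.
Proof. by move=> uc nat; have [h [e _]] := uc (Build_Cocone nat); exists h. Qed.

Lemma colim_intro (c : Cocone D) :
  (forall X (k : forall j, hom (D j) X),
    (forall i j (u : hom i j), k j ∘ fmap D u = k i) ->
    exists h : hom (apex c) X, forall j, h ∘ leg c j = k j) ->
  (forall X (h h' : hom (apex c) X),
    (forall j, h ∘ leg c j = h' ∘ leg c j) -> h = h') ->
  is_colimit c.
Proof.
move=> ex un d; have [h e] := ex _ _ (@leg_nat _ _ _ d).
by exists h; split=> // h' e'; apply: un => j; rewrite e e'.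
Qed.

Lemma colim_along_iso (c d : Cocone D) (i : hom (apex d) (apex c)) :
  is_colimit d -> invertible i -> (forall j, i ∘ leg d j = leg c j) -> is_colimit c.
Proof.
move=> ud [i' [i'i ii']] e; apply: colim_intro => [X k nat|X h h' q].
  have [h eh] := colim_desc ud nat; exists (h ∘ i') => j.
  by rewrite -e -comp_assoc (comp_assoc i') i'i comp_idl.
suff : h ∘ i = h' ∘ i.
  by move=> /(f_equal (fun m => m ∘ i')); rewrite -!comp_assoc ii' !comp_idr.
by apply: (colim_epi ud) => j; rewrite -!comp_assoc e.
Qed.

Lemma colim_iso (c d : Cocone D) : is_colimit c -> is_colimit d ->
  exists i : hom (apex d) (apex c), invertible i /\ forall j, i ∘ leg d j = leg c j.
Proof.
move=> uc ud.
have [i ei] := colim_desc ud (@leg_nat _ _ _ c).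
have [i' ei'] := colim_desc uc (@leg_nat _ _ _ d).
exists i; split => //; exists i'; split.
  by apply: (colim_epi ud) => j; rewrite -comp_assoc ei ei' comp_idl.
by apply: (colim_epi uc) => j; rewrite -comp_assoc ei' ei comp_idl.
Qed.

End Colimits.

Lemma fmap_invertible (C C' : Category) (F : Functor C C') (A B : C) (i : hom A B) :
  invertible i -> invertible (fmap F i).
Proof. by case=> i' [a b]; exists (fmap F i'); rewrite -!fmap_comp a b !fmap_id. Qed.

Lemma preserves_one_colimit (J C C' : Category) (D : Functor J C)
  (F : Functor C C') (d c : Cocone D) :
  is_colimit d -> is_colimit (map_cocone F d) -> is_colimit c ->
  is_colimit (map_cocone F c).
Proof.
move=> ud uFd uc; have [i [inv e]] := colim_iso uc ud.
apply: (@colim_along_iso _ _ _ (map_cocone F c) (map_cocone F d) (fmap F i) uFd) => [|j /=].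
  exact: fmap_invertible.
by rewrite -fmap_comp e.
Qed.

(** Presentability is applied through factorizations of maps and of equations,
    and stated in this form. *)
Definition bpresentable (B : Set) (C : Category) (P : C) : Prop :=
  forall (J : Category) (D : Functor J C) (c : Cocone D),
    small J -> gfiltered B J -> is_colimit c ->
    (forall x : hom P (apex c), exists j (y : hom P (D j)), leg c j ∘ y = x) /\
    (forall j (y y' : hom P (D j)), leg c j ∘ y = leg c j ∘ y' ->
      exists k (u : hom j k), fmap D u ∘ y = fmap D u ∘ y').

Definition bcontinuous (B : Set) (C C' : Category) (F : Functor C C') : Prop :=
  forall (J : Category) (D : Functor J C) (c : Cocone D),
    small J -> gfiltered B J -> is_colimit c -> is_colimit (map_cocone F c).

Definition detects_isos (C : Category) (I : Type) (Q : I -> C) : Prop :=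
  forall (X Y : C) (m : hom X Y),
    (forall i (y : hom (Q i) Y), exists! x, m ∘ x = y) -> invertible m.

(** A set of presentable objects that is closed under small enough colimits
    and generates; the canonical diagram of every object over it is then
    filtered, and has that object as colimit. *)
Record generating_family (B : Set) (C : Category) (I : Set) (Q : I -> C) : Prop := {
  gen_cocomplete : cocomplete C;
  gen_presentable : forall i, bpresentable B (Q i);
  gen_detects : detects_isos Q;
  gen_closed : forall (V : Set) (q : V -> I)
    (r : forall v w, hom (Q (q v)) (Q (q w)) -> Prop),
    card_le V B -> card_le (gedges r) B ->
    exists i (l : forall v, hom (Q (q v)) (Q i)), is_gcolim (fun v => Q (q v)) r l }.

Section Presentable.

Variables (B : Set) (hB : roomy B).

Lemma filtered_square (J : Category) (fJ : gfiltered B J) (i j l : J)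
  (u : hom i l) (w : hom i j) :
  exists X (a : hom l X) (b : hom j X), a ∘ u = b ∘ w.
Proof.
have [k [a [b _]]] := filtered_bound hB fJ l j.
have [X [c e]] := filtered_coequal hB fJ (a ∘ u) (b ∘ w).
by exists X, (c ∘ a), (c ∘ b); rewrite -!comp_assoc.
Qed.

Lemma bpresentable_pair (C : Category) (P : C) : bpresentable B P ->
  forall (J : Category) (D : Functor J C) (c : Cocone D),
    small J -> gfiltered B J -> is_colimit c ->
    forall i j (y : hom P (D i)) (y' : hom P (D j)), leg c i ∘ y = leg c j ∘ y' ->
      exists k (u : hom i k) (v : hom j k), fmap D u ∘ y = fmap D v ∘ y'.
Proof.
move=> pP J D c sJ fJ uc i j y y' e.
have [k [u [v _]]] := filtered_bound hB fJ i j.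
have [|k' [w e']] := proj2 (pP _ _ _ sJ fJ uc) k (fmap D u ∘ y) (fmap D v ∘ y').
  by rewrite !comp_assoc !leg_nat.
by exists k', (w ∘ u), (w ∘ v); rewrite !fmap_comp -!comp_assoc.
Qed.

(** The hom-functor has values in [SET], where a filtered colimit is the set of
    germs; a germ is encoded by its indicator function. *)
Lemma presentable_bpresentable (C : Category) (K : Set) (P : C) :
  card_le K B -> presentable K P -> bpresentable B P.
Proof.
move=> KB pP J D c sJ fJ uc.
have {pP} uc' := pP J D c sJ (gfiltered_filtered KB fJ) uc.
split.
  move=> x.
  pose h (x : hom P (apex c)) := truth (exists j (y : hom P (D j)), leg c j ∘ y = x).
  suff : h = (fun _ => true) by move=> /(f_equal (fun f => f x)) /truthP.
  apply: (colim_epi (X := (bool : SET)) uc') => j.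
  by apply: functional_extensionality => y; apply/truthP; exists j, y.
case: sJ => S [e [e' [_ ee']]].
pose T : Set := {s : S & hom P (D (e s))}.
pose germ i (y : hom P (D i)) (t : T) : bool :=
  truth (exists l (u : hom i l) (v : hom (e (projT1 t)) l),
           fmap D u ∘ y = fmap D v ∘ projT2 t).
have nat i j (w : hom i j) (y : hom P (D i)) : germ j (fmap D w ∘ y) = germ i y.
  apply: functional_extensionality => t; congr truth.
  apply: propositional_extensionality; split=> -[l [u [v q]]].
    by exists l, (u ∘ w), v; rewrite fmap_comp -comp_assoc.
  have [X [a [b ab]]] := filtered_square fJ u w.
  exists X, b, (a ∘ v).
  by rewrite comp_assoc -fmap_comp -ab !fmap_comp -!comp_assoc q.
have [h eh] : exists h : hom P (apex c) -> T -> bool, forall i y, h (leg c i ∘ y) = germ i y.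
  have [|h eh] := @colim_desc J SET _ (map_cocone (hom_functor P) c) (T -> bool) germ uc'.
    by move=> i j u; apply: functional_extensionality => y; apply: nat.
  by exists h => i y; rewrite -eh.
move=> j; rewrite -(ee' j); move: (e' j) => {j} s y y' q.
have : germ (e s) y (existT _ s y') = true.
  by rewrite -eh q eh; apply/truthP; exists (e s), (idm _), (idm _).
move=> /truthP [l [u [v {}q]]].
have [X [w wuv]] := filtered_coequal hB fJ u v.
by exists X, (w ∘ u); rewrite {2}wuv !fmap_comp -!comp_assoc q.
Qed.

(** A map out of the colimit, or an equation between two such maps, amounts to
    at most [B] maps and equations at the vertices and edges, which all live at
    a common stage of a filtered diagram. *)
Lemma bpresentable_gcolim (C : Category) (V : Set) (o : V -> C)
  (r : forall v w, hom (o v) (o w) -> Prop) (X : C) (l : forall v, hom (o v) X) :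
  card_le V B -> card_le (gedges r) B -> (forall v, bpresentable B (o v)) ->
  is_gcolim o r l -> bpresentable B X.
Proof.
move=> lV lE po ul J D c sJ fJ uc.
split=> [x|j y y' e]; last first.
  have /dchoice [z hz] : forall v, exists z : {k & hom j k},
      fmap D (projT2 z) ∘ (y ∘ l v) = fmap D (projT2 z) ∘ (y' ∘ l v).
    move=> v; have [|k [u q]] := proj2 (po v _ _ _ sJ fJ uc) j (y ∘ l v) (y' ∘ l v).
      by rewrite !comp_assoc e.
    by exists (existT _ k u).
  have [k [w [d q]]] := filtered_span hB fJ (fun v => projT2 (z v)) lV.
  exists k, d; apply: (gcolim_epi ul) => v.
  by rewrite -(q v) !fmap_comp -!comp_assoc hz.
have /dchoice [z hz] : forall v, exists z : {j & hom (o v) (D j)},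
    leg c (projT1 z) ∘ projT2 z = x ∘ l v.
  by move=> v; have [j [y e]] := proj1 (po v _ _ _ sJ fJ uc) (x ∘ l v);
     exists (existT _ j y).
have [j [h]] := filtered_family fJ (fun v => projT1 (z v)) lV.
pose y v := fmap D (h v) ∘ projT2 (z v).
have ey v : leg c j ∘ y v = x ∘ l v by rewrite /y comp_assoc leg_nat hz.
move: y ey => y ey.
pose E : Set := {v : V & {w : V & {m : hom (o v) (o w) | r v w m}}}.
have /dchoice [t ht] : forall e : E, exists t : {k & hom j k},
    fmap D (projT2 t) ∘ (y (projT1 (projT2 e)) ∘ proj1_sig (projT2 (projT2 e)))
    = fmap D (projT2 t) ∘ y (projT1 e).
  move=> [v [w [m rm]]] /=.
  have [|k [u q]] := proj2 (po v _ _ _ sJ fJ uc) j (y w ∘ m) (y v).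
    by rewrite comp_assoc !ey -comp_assoc (proj1 ul _ _ _ rm).
  by exists (existT _ k u).
have [k [w [d q]]] := filtered_span hB fJ (fun e => projT2 (t e)) lE.
have [|g [eg _]] := proj2 ul _ (fun v => fmap D d ∘ y v).
  move=> v v' m rm; pose a : E := existT _ v (existT _ v' (exist _ m rm)).
  by have e := ht a; rewrite -(q a) fmap_comp -!comp_assoc; congr (_ ∘ _).
exists k, g; apply: (gcolim_epi ul) => v.
by rewrite -comp_assoc eg comp_assoc leg_nat ey.
Qed.

End Presentable.

(** ** Encoding graphs by sets *)

Section Codes.

Variables (C : Category) (S J : Set) (H : J -> C).

(** Up to isomorphism, the colimits of graphs with at most [S] vertices, taken
    among the [H j], form a set. *)
Record code : Set := {
  code_act : S -> bool;
  code_lab : {s | code_act s = true} -> J;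
  code_rel : forall v w, hom (H (code_lab v)) (H (code_lab w)) -> bool }.

Definition code_ob (c : code) (v : {s | code_act c s = true}) : C := H (code_lab v).

Definition code_graph (c : code) (v w : {s | code_act c s = true})
  (m : hom (code_ob v) (code_ob w)) : Prop := code_rel m = true.

Lemma code_of_graph (V : Set) (q : V -> J)
  (r : forall v w, hom (H (q v)) (H (q w)) -> Prop) : card_le V S ->
  exists c : code, card_le (gedges (@code_graph c)) (gedges r) /\
    forall X (l : forall v, hom (@code_ob c v) X),
      is_gcolim (@code_ob c) (@code_graph c) l ->
      exists k : forall v, hom (H (q v)) X, is_gcolim (fun v => H (q v)) r k.
Proof.
case=> f hf; pose act s := truth (exists v, f v = s).
have [g hg] : exists g : {s | act s = true} -> V, forall s, f (g s) = proj1_sig s.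
  apply: (@dchoice _ (fun _ => V) (fun s v => f v = proj1_sig s)).
  by move=> [s hs]; move/truthP: (hs).
have inj x y : g x = g y -> x = y by move=> e; apply: sig_ext; rewrite -!hg e.
have surj v : exists s, g s = v.
  have a : act (f v) = true by apply/truthP; exists v.
  by exists (exist (fun s => act s = true) _ a); apply: hf; rewrite hg.
exists (@Build_code act (fun s => q (g s)) (fun v w m => truth (r _ _ m))).
have -> : @code_graph (Build_code (fun v w m => truth (r (g v) (g w) m)))
          = fun v w m => r (g v) (g w) m.
  do 3 (apply: functional_extensionality_dep => ?).
  by apply: propositional_extensionality; apply: truthP.
split.
  exists (fun e => existT _ (g (projT1 e)) (existT _ (g (projT1 (projT2 e)))
            (exist _ (proj1_sig (projT2 (projT2 e))) (proj2_sig (projT2 (projT2 e)))))).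
  move=> [v [w [m rm]]] [v' [w' [m' rm']]] /= e.
  have ev := inj _ _ (f_equal (@projT1 _ _) e); subst v'.
  have {}e := inj_pair2 _ _ _ _ _ e.
  have ew := inj _ _ (f_equal (@projT1 _ _) e); subst w'.
  have {}e := inj_pair2 _ _ _ _ _ e.
  by congr existT; congr existT; apply: sig_ext; case: e.
move=> X l [cl ul].
have [k [ck ek]] := gcocone_reindex (o := fun v => H (q v)) (r := r) inj surj cl.
exists k; split=> // Y k' ck'.
have [|h [eh uh]] := ul Y (fun s => k' (g s)).
  by move=> v w m rm; apply: ck'.
exists h; split=> [v|h' eh'].
  by have [s <-] := surj v; rewrite ek eh.
by apply: uh => s; rewrite -ek eh'.
Qed.

Variable coc : cocomplete C.

Lemma code_colimit_exists (c : code) :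
  exists X : C, exists l : forall v, hom (@code_ob c v) X,
    is_gcolim (@code_ob c) (@code_graph c) l.
Proof. exact: gcolim_exists. Qed.

Definition code_colimit (c : code) : C :=
  proj1_sig (constructive_indefinite_description _ (code_colimit_exists c)).

Lemma code_colimitP (c : code) :
  exists l : forall v, hom (@code_ob c v) (code_colimit c),
    is_gcolim (@code_ob c) (@code_graph c) l.
Proof. by rewrite /code_colimit; case: (constructive_indefinite_description _ _). Qed.

End Codes.

(** ** Closing a generator under small colimits *)

Section Closure.

Variables (B : Set) (hB : roomy B) (C : Category) (coc : cocomplete C).
Variables (I : Set) (G : I -> C).
Hypotheses (presG : forall i, bpresentable B (G i)) (detG : detects_isos G).

(** The closure under colimits of size [B] takes transfinitely many steps; they
    are indexed by well-founded trees, so that the objects constructed before a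
    given step are a family defined by structural recursion. *)
Inductive stage : Set :=
| stage0
| stage_sup (f : B -> stage).

Fixpoint stage_objects (t : stage) : {J : Set & J -> C} :=
  match t with
  | stage0 => existT (fun J : Set => J -> C) I G
  | stage_sup f =>
    let H (x : {b : B & projT1 (stage_objects (f b))}) :=
      projT2 (stage_objects (f (projT1 x))) (projT2 x) in
    existT (fun J : Set => J -> C)
      {c : code B H | card_le (gedges (@code_graph _ _ _ _ c)) B}
      (fun c => code_colimit coc (proj1_sig c))
  end.

Definition closure_index : Set := {t : stage & projT1 (stage_objects t)}.

Definition closure_object (i : closure_index) : C :=
  projT2 (stage_objects (projT1 i)) (projT2 i).

Lemma closure_generating : generating_family B closure_object.
Proof.
constructor=> //.
- case=> t; rewrite /closure_object /=; elim: t => [|f IH] i; first exact: presG.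
  case: i => c lE /=; have [l ul] := code_colimitP coc c.
  apply: (bpresentable_gcolim hB _ lE _ ul).
    by exists (fun v => proj1_sig v) => x y; apply: sig_ext.
  by move=> v; apply: IH.
- move=> X Y m bij; apply: detG => i y.
  exact: (bij (existT _ stage0 i) y).
- move=> V q r [f hf] lE.
  have [t ht] : exists t : B -> stage, forall v, exists x : projT1 (stage_objects (t (f v))),
      q v = existT _ (t (f v)) x.
    have [t ht] : exists t : B -> stage, forall b v, f v = b -> t b = projT1 (q v).
      apply: (@dchoice B (fun _ => stage)
                (fun b t => forall v, f v = b -> t = projT1 (q v))) => b.
      case: (classic (exists v, f v = b)) => [[v <-]|n].
        by exists (projT1 (q v)) => w /hf ->.
      by exists stage0 => v e; case: n; exists v.
    exists t => v; have := ht _ v eq_refl; case: (q v) => s x /= ->.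
    by exists x.
  have [x hx] := dchoice ht.
  have {hx} e : q = fun v => existT _ (t (f v)) (x v).
    by apply: functional_extensionality.
  subst q.
  pose H (x : {b : B & projT1 (stage_objects (t b))}) :=
    projT2 (stage_objects (t (projT1 x))) (projT2 x).
  have [c [lc uc]] := @code_of_graph C B _ H V
    (fun v => existT _ (f v) (x v)) r (ex_intro _ f hf).
  have [l ul] := code_colimitP coc c.
  have [k uk] := uc _ _ ul.
  have lc' := card_le_trans lc lE.
  by exists (existT _ (stage_sup t) (exist _ c lc')), k.
Qed.

End Closure.

(** Bijectivity on maps from the generators extends to maps from their colimits,
    that is, from all objects. *)
Lemma presentable_generator (C : Category) (I : Type) (G : I -> C) :
  (forall X : C, exists (J : Category) (D : Functor J C) (c : Cocone D),
    (forall j, exists i, isomorphic (D j) (G i)) /\ is_colimit c /\ apex c = X) ->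
  detects_isos G.
Proof.
move=> gen X Y m bij.
have {}bij Z (y : hom Z Y) : exists! x, m ∘ x = y.
  have [J [D [c [iso [uc e]]]]] := gen Z; subst Z.
  have bijD j (y' : hom (D j) Y) : exists! x, m ∘ x = y'.
    have [i [a [b [ba ab]]]] := iso j.
    have [x [ex ux]] := bij i (y' ∘ b); exists (x ∘ a); split.
      by rewrite comp_assoc ex -comp_assoc ba comp_idr.
    move=> x' ex'; rewrite -[RHS]comp_idr -ba comp_assoc; congr (_ ∘ _).
    by apply: ux; rewrite comp_assoc ex'.
  have /dchoice [k hk] := fun j => bijD j (y ∘ leg c j).
  have [|x ex] := colim_desc (k := k) uc.
    move=> i j u; symmetry; apply: (proj2 (hk i)).
    by rewrite comp_assoc (proj1 (hk j)) -comp_assoc leg_nat.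
  exists x; split=> [|x' ex'].
    by apply: (colim_epi uc) => j; rewrite -comp_assoc ex (proj1 (hk j)).
  apply: (colim_epi uc) => j; rewrite ex; apply: (proj2 (hk j)).
  by rewrite comp_assoc ex'.
have [n [mn _]] := bij Y (idm Y); exists n; split=> //.
have [x [_ ux]] := bij X m.
have <- : x = idm X by apply: ux; rewrite comp_idr.
by symmetry; apply: ux; rewrite comp_assoc mn comp_idl.
Qed.

(** * Arrow categories *)

Section ArrowCategory.

Variable M : Category.

Definition dom_functor : Functor (Arrow M) M.
Proof.
by refine (@Build_Functor (Arrow M) M (fun f => adom f) (fun f g x => sdom x) _ _).
Defined.

Definition cod_functor : Functor (Arrow M) M.
Proof.
by refine (@Build_Functor (Arrow M) M (fun f => acod f) (fun f g x => scod x) _ _).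
Defined.

Lemma pointwise_colimit (J : Category) (D : Functor J (Arrow M)) (c : Cocone D) :
  is_colimit (map_cocone dom_functor c) -> is_colimit (map_cocone cod_functor c) ->
  is_colimit c.
Proof.
move=> u0 u1; apply: colim_intro => [X k nat|X x y e]; last first.
  apply: square_ext.
    by apply: (colim_epi u0) => j; exact: (f_equal (@sdom _ _ _) (e j)).
  by apply: (colim_epi u1) => j; exact: (f_equal (@scod _ _ _) (e j)).
have [|h eh] := @colim_desc J M (comp_functor dom_functor D) (map_cocone dom_functor c)
                  (adom X) (fun j => sdom (k j)) u0.
  by move=> i j u; exact: (f_equal (@sdom _ _ _) (nat i j u)).
have [|h' eh'] := @colim_desc J M (comp_functor cod_functor D) (map_cocone cod_functor c)
                    (acod X) (fun j => scod (k j)) u1.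
  by move=> i j u; exact: (f_equal (@scod _ _ _) (nat i j u)).
have comm : h' ∘ amap (apex c) = amap X ∘ h.
  apply: (colim_epi u0) => j /=; rewrite -!comp_assoc.
  rewrite /= in eh eh'.
  by rewrite -(scomm (leg c j)) eh comp_assoc eh' scomm.
by exists (mkSquare h h' comm) => j; apply: square_ext; [exact: eh|exact: eh'].
Qed.

Hypothesis coc : cocomplete M.

Lemma arrow_colimit (J : Category) (D : Functor J (Arrow M)) : small J ->
  exists c : Cocone D, is_colimit c /\
    is_colimit (map_cocone dom_functor c) /\ is_colimit (map_cocone cod_functor c).
Proof.
move=> sJ.
have [c0 u0] := coc (comp_functor dom_functor D) sJ.
have [c1 u1] := coc (comp_functor cod_functor D) sJ.
have [|a ea] := @colim_desc J M (comp_functor dom_functor D) c0 (apex c1)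
                  (fun j => leg c1 j ∘ amap (D j)) u0.
  move=> i j u /=; rewrite -comp_assoc -(scomm (fmap D u)) comp_assoc.
  by rewrite (leg_nat c1 u).
have comm j : leg c1 j ∘ amap (D j) = a ∘ leg c0 j by rewrite ea.
pose l j : @hom (Arrow M) (D j) (mkArrow a) :=
  @mkSquare M (D j) (mkArrow a) (leg c0 j) (leg c1 j) (comm j).
have nat i j (u : hom i j) : l j ∘ fmap D u = l i.
  by apply: square_ext => /=; [exact: (leg_nat c0 u)|exact: (leg_nat c1 u)].
exists (@Build_Cocone J (Arrow M) D (mkArrow a) l nat).
by split => //; apply: pointwise_colimit.
Qed.

Lemma arrow_cocomplete : cocomplete (Arrow M).
Proof. by move=> J D /(arrow_colimit D) [c [uc _]]; exists c. Qed.

Lemma dom_cocontinuous (J : Category) (D : Functor J (Arrow M)) (c : Cocone D) :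
  small J -> is_colimit c -> is_colimit (map_cocone dom_functor c).
Proof.
move=> /(arrow_colimit D) [d [ud [u0 _]]]; exact: (preserves_one_colimit ud u0).
Qed.

Lemma cod_cocontinuous (J : Category) (D : Functor J (Arrow M)) (c : Cocone D) :
  small J -> is_colimit c -> is_colimit (map_cocone cod_functor c).
Proof.
move=> /(arrow_colimit D) [d [ud [_ u1]]]; exact: (preserves_one_colimit ud u1).
Qed.

Lemma initial_exists : exists Z : M, forall X, exists h : hom Z X, forall h', h' = h.
Proof.
have [Z [l [_ u]]] := @gcolim_exists M False (fun x => False_rect _ x)
  (fun _ _ _ => False) coc.
exists Z => X; have [|h [_ uh]] := u X (fun x => False_rect _ x); first by case.
by exists h => h'; symmetry; apply: uh; case.
Qed.

(** Maps from [0 -> G i] and from the identity of [G i] to an arrow are the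
    maps from [G i] to its codomain and to its domain. *)
Lemma arrow_generator (B I : Set) (G : I -> M) : detects_isos G ->
  (forall i, bpresentable B (G i)) ->
  exists (I' : Set) (G' : I' -> Arrow M),
    detects_isos G' /\ forall i, bpresentable B (G' i).
Proof.
move=> det pres.
have [Z hZ] := initial_exists.
have epiZ X (h h' : hom Z X) : h = h'.
  by have [k uk] := hZ X; rewrite (uk h) (uk h').
have /dchoice [z _] : forall i, exists z : hom Z (G i), True.
  by move=> i; have [h _] := hZ (G i); exists h.
exists (I + I)%type, (fun x => match x with
  | inl i => mkArrow (z i)
  | inr i => mkArrow (idm (G i)) end); split.
  move=> X Y m bij.
  have [n [nm mn]] : invertible (sdom m).
    apply: (det) => i y.
    have c : (amap Y ∘ y) ∘ idm (G i) = amap Y ∘ y by rewrite comp_idr.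
    have [x [ex ux]] := bij (inr i) (@mkSquare M (mkArrow (idm (G i))) Y _ _ c).
    exists (sdom x); split; first exact: (f_equal (@sdom _ _ _) ex).
    move=> x' ex'.
    have c' : (amap X ∘ x') ∘ idm (G i) = amap X ∘ x' by rewrite comp_idr.
    have e := ux (@mkSquare M (mkArrow (idm (G i))) X _ _ c').
    apply: (f_equal (@sdom _ _ _) (e _)); apply: square_ext => //=.
    by rewrite comp_assoc scomm -comp_assoc ex'.
  have [n' [nm' mn']] : invertible (scod m).
    apply: (det) => i y; have [h _] := hZ (adom Y).
    have c : y ∘ z i = amap Y ∘ h by exact: epiZ.
    have [x [ex ux]] := bij (inl i) (@mkSquare M (mkArrow (z i)) Y _ _ c).
    exists (scod x); split; first exact: (f_equal (@scod _ _ _) ex).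
    move=> x' ex'; have [h' _] := hZ (adom X).
    have c' : x' ∘ z i = amap X ∘ h' by exact: epiZ.
    have e := ux (@mkSquare M (mkArrow (z i)) X _ _ c').
    apply: (f_equal (@scod _ _ _) (e _)); apply: square_ext;
      [exact: epiZ|exact: ex'].
  have c : n' ∘ amap Y = amap X ∘ n.
    rewrite -[LHS]comp_idr -mn comp_assoc -(comp_assoc n') -scomm.
    by rewrite (comp_assoc n') nm' comp_idl.
  by exists (mkSquare n n' c); split; apply: square_ext.
move=> [i|i] J D c sJ fJ uc /=.
  have uc1 := cod_cocontinuous sJ uc.
  have [ex eq] := pres i J _ _ sJ fJ uc1; split.
    move=> x; have [j [y e]] := ex (scod x); exists j.
    have [h _] := hZ (adom (D j)).
    have c' : y ∘ z i = amap (D j) ∘ h by exact: epiZ.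
    by exists (@mkSquare M (mkArrow (z i)) (D j) _ _ c'); apply: square_ext;
      [exact: epiZ|].
  move=> j y y' e; have [k [u e']] := eq j (scod y) (scod y') (f_equal (@scod _ _ _) e).
  by exists k, u; apply: square_ext; [exact: epiZ|].
have uc0 := dom_cocontinuous sJ uc.
have [ex eq] := pres i J _ _ sJ fJ uc0.
have idP (f : arrow M) (x : square (mkArrow (idm (G i))) f) : scod x = amap f ∘ sdom x.
  by rewrite -scomm /= comp_idr.
split.
  move=> x; have [j [y e]] := ex (sdom x); exists j.
  have c' : (amap (D j) ∘ y) ∘ idm (G i) = amap (D j) ∘ y by rewrite comp_idr.
  pose s : @hom (Arrow M) (mkArrow (idm (G i))) (D j) :=
    @mkSquare M (mkArrow (idm (G i))) (D j) _ _ c'.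
  exists s; have e' : sdom (leg c j ∘ s) = sdom x by exact: e.
  by apply: square_ext => //; rewrite !idP e'.
move=> j y y' e; have [k [u e']] := eq j (sdom y) (sdom y') (f_equal (@sdom _ _ _) e).
have e'' : sdom (fmap D u ∘ y) = sdom (fmap D u ∘ y') by exact: e'.
by exists k, u; apply: square_ext => //; rewrite !idP e''.
Qed.

Variables (B : Set) (F : FunctorialFactorization M) (cE : bcontinuous B (ffE F)).

(** The composite diagrams agree only up to the proofs of functoriality, hence
    the passage through the elementary form of the universal property. *)
Lemma Lfunctor_bcontinuous : bcontinuous B (Lfunctor F).
Proof.
move=> J D c sJ fJ uc; apply: pointwise_colimit; last first.
  have u := cE sJ fJ uc; apply: colim_intro => [X k nat|X h h' e].
    exact: (@colim_desc _ _ _ (map_cocone F c) X k u nat).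
  exact: (@colim_epi _ _ _ (map_cocone F c) X h h' u e).
have u := dom_cocontinuous sJ uc; apply: colim_intro => [X k nat|X h h' e].
  exact: (@colim_desc _ _ _ (map_cocone dom_functor c) X k u nat).
exact: (@colim_epi _ _ _ (map_cocone dom_functor c) X h h' u e).
Qed.

Lemma Rfunctor_bcontinuous : bcontinuous B (Rfunctor F).
Proof.
move=> J D c sJ fJ uc; apply: pointwise_colimit.
  have u := cE sJ fJ uc; apply: colim_intro => [X k nat|X h h' e].
    exact: (@colim_desc _ _ _ (map_cocone F c) X k u nat).
  exact: (@colim_epi _ _ _ (map_cocone F c) X h h' u e).
have u := cod_cocontinuous sJ uc; apply: colim_intro => [X k nat|X h h' e].
  exact: (@colim_desc _ _ _ (map_cocone cod_functor c) X k u nat).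
exact: (@colim_epi _ _ _ (map_cocone cod_functor c) X h h' u e).
Qed.

End ArrowCategory.

(** * Objects as colimits of their generalized elements *)

Section Elements.

Variables (B : Set) (hB : roomy B) (C : Category) (I : Set) (Q : I -> C).
Hypothesis gQ : generating_family B Q.

Lemma gen_initial : exists i, forall X, exists h : hom (Q i) X, forall h', h = h'.
Proof.
have [||i [l [_ u]]] := gen_closed gQ (V := False) (q := fun x : False => match x with end)
  (r := fun _ _ _ => False).
  by exists (fun x : False => match x with end); case.
  by exists (fun e => False_rect B (projT1 e)) => -[].
exists i => X; have [|h [_ uh]] := u X (fun x : False => match x with end); first by case.
by exists h => h'; apply: uh; case.
Qed.

Lemma gen_coequal i j (u v : hom (Q i) (Q j)) :
  exists k (c : hom (Q j) (Q k)), c ∘ u = c ∘ v /\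
    forall X (w : hom (Q j) X), w ∘ u = w ∘ v -> exists w', w' ∘ c = w.
Proof.
pose q (b : bool) := if b then j else i.
pose r (b b' : bool) : hom (Q (q b)) (Q (q b')) -> Prop :=
  match b, b' with
  | false, true => fun m => m = u \/ m = v
  | _, _ => fun _ => False
  end.
have [||k [l [cl ul]]] := gen_closed gQ (V := bool) (q := q) (r := r).
  exact: roomy_bool.
  apply: card_le_trans (roomy_bool hB).
  apply: (@card_le_rel (gedges r) bool (fun e b => match e with
    | existT _ false (existT _ true (exist _ m _)) => if b then m = u else m = v
    | _ => False end)).
    by move=> [[] [[] [m []]]] // e; [exists true|exists false].
  move=> [[] [[] [m []]]] // e [[] [[] [m' []]]] // e' [] *; subst;
    congr existT; congr existT; exact: sig_ext.
have eu := cl false true u (or_introl eq_refl).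
have ev := cl false true v (or_intror eq_refl).
exists k, (l true); split; first exact: eq_trans eu (eq_sym ev).
move=> X w e.
have [|w' [ew _]] := ul X (fun b => match b return hom (Q (q b)) X with
                                   | true => w | false => w ∘ u end).
  by move=> [] [] m // [] ->.
by exists w'; apply: (ew true).
Qed.

Section Presheaf.

Variables (F : I -> Set) (res : forall i j, hom (Q i) (Q j) -> F j -> F i).
Hypotheses (res_id : forall i x, res (idm (Q i)) x = x)
  (res_comp : forall i j k (g : hom (Q j) (Q k)) (f : hom (Q i) (Q j)) x,
    res (g ∘ f) x = res f (res g x)).

Definition elements : Category.
Proof.
refine (@Build_Category {i : I & F i}
  (fun a b => {u : hom (Q (projT1 a)) (Q (projT1 b)) | res u (projT2 b) = projT2 a})
  (fun a => exist _ (idm _) (res_id _))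
  (fun a b c g f => exist _ (proj1_sig g ∘ proj1_sig f) _) _ _ _).
- by move=> *; apply: sig_ext; apply: comp_assoc.
- by move=> *; apply: sig_ext; apply: comp_idl.
- by move=> *; apply: sig_ext; apply: comp_idr.
Unshelve.
by rewrite res_comp (proj2_sig g) (proj2_sig f).
Defined.

Definition elements_functor : Functor elements C.
Proof.
by refine (@Build_Functor elements C (fun a => Q (projT1 a)) (fun a b u => proj1_sig u) _ _).
Defined.

Lemma elements_small : small elements.
Proof. by exists {i : I & F i}, (fun a => a), (fun a => a). Qed.

Hypothesis amalg : forall (V : Set) (q : V -> I)
  (r : forall v w, hom (Q (q v)) (Q (q w)) -> Prop) (x : forall v, F (q v)),
  card_le V B -> card_le (gedges r) B ->
  (forall v w m, r v w m -> res m (x w) = x v) ->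
  exists i (l : forall v, hom (Q (q v)) (Q i)) (y : F i),
    gcocone (fun v => Q (q v)) r l /\ forall v, res (l v) y = x v.

Lemma elements_filtered : gfiltered B elements.
Proof.
move=> V o r lV lE.
pose r' v w (m : hom (Q (projT1 (o v))) (Q (projT1 (o w)))) :=
  exists m0, @r v w m0 /\ proj1_sig m0 = m.
have [||i [l [y [cl el]]]] :=
    amalg (q := fun v => projT1 (o v)) (r := r') (x := fun v => projT2 (o v)) lV.
- apply: card_le_trans lE.
  exact: (gedges_image (fun v w (m : hom (o v) (o w)) => proj1_sig m) r).
- by move=> v w m [m0 [_ <-]]; exact: (proj2_sig m0).
- exists (existT _ i y : elements), (fun v => exist _ (l v) (el v)).
  by move=> v w m rm; apply: sig_ext; apply: cl; exists m.
Qed.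

(** The category of elements is filtered, so a map from [Q i] into the colimit,
    or an equation between two such maps, is witnessed at one element, and
    restriction along the map brings this element to [F i]. *)
Lemma colimit_of_elements (c : Cocone elements_functor) : is_colimit c ->
  forall i (y : hom (Q i) (apex c)), exists! x : F i, leg c (existT _ i x) = y.
Proof.
move=> uc i y.
have fE := elements_filtered; have sE := elements_small.
have [[j x] [u e]] := proj1 (gen_presentable gQ i sE fE uc) y.
exists (res u x); split.
  have := @leg_nat _ _ _ c (existT _ i (res u x)) (existT _ j x) (exist _ u eq_refl).
  by move=> <-.
suff inj x1 x2 : leg c (existT _ i x1) = leg c (existT _ i x2) -> x1 = x2.
  move=> x' e'; apply: inj; rewrite e' -e.
  have := @leg_nat _ _ _ c (existT _ i (res u x)) (existT _ j x) (exist _ u eq_refl).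
  by move=> <-.
move=> {}e; have := bpresentable_pair hB (gen_presentable gQ i) sE fE uc
  (i := existT _ i x1) (j := existT _ i x2) (y := idm _) (y' := idm _).
move=> [|[k z] [[v ev] [[w ew] /=]]]; first by rewrite !comp_idr.
rewrite !comp_idr => vw.
exact: eq_trans (eq_sym ev) (eq_trans (f_equal (fun t => res t z) vw) ew).
Qed.

End Presheaf.

Section Canonical.

Variable X : C.

Definition canonical_category : Category :=
  @elements (fun i => hom (Q i) X) (fun i j u y => y ∘ u)
    (fun i y => comp_idr y) (fun i j k g f y => comp_assoc y g f).

Definition canonical_diagram : Functor canonical_category C :=
  elements_functor (F := fun i => hom (Q i) X) _ _.

Definition canonical_cocone : Cocone canonical_diagram :=
  @Build_Cocone canonical_category C canonical_diagram X (fun a => projT2 a)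
    (fun a b u => proj2_sig u).

Lemma canonical_small : small canonical_category.
Proof. exact: elements_small. Qed.

Lemma canonical_filtered : gfiltered B canonical_category.
Proof.
apply: elements_filtered => V q r x lV lE cx.
have [i [l ul]] := gen_closed gQ lV lE.
have [y [ey _]] := proj2 ul _ x cx.
by exists i, l, y; split=> //; apply: (proj1 ul).
Qed.

Lemma canonical_colimit : is_colimit canonical_cocone.
Proof.
have [c uc] := gen_cocomplete gQ canonical_diagram canonical_small.
have [m em] := colim_desc uc (@leg_nat _ _ _ canonical_cocone).
apply: (colim_along_iso uc _ em); apply: (gen_detects gQ) => i y.
exists (leg c (existT _ i y : canonical_category)); split.
  exact: (em (existT _ i y : canonical_category)).
move=> x ex; have [|x' [e _]] := colimit_of_elements _ uc x.
  move=> V q r x0 lV lE cx.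
  have [k [l ul]] := gen_closed gQ lV lE.
  have [z [ez _]] := proj2 ul _ x0 cx.
  by exists k, l, z; split=> //; apply: (proj1 ul).
have q : x' = y := eq_trans (eq_sym (em (existT _ i x' : canonical_category)))
  (eq_trans (f_equal (fun t => m ∘ t) e) ex).
by rewrite -e -q.
Qed.

Lemma element_epi Y (h h' : hom X Y) :
  (forall i (x : hom (Q i) X), h ∘ x = h' ∘ x) -> h = h'.
Proof. by move=> e; apply: (colim_epi canonical_colimit) => -[i x]; apply: e. Qed.

Lemma element_desc Y (k : forall i, hom (Q i) X -> hom (Q i) Y) :
  (forall i j (x : hom (Q j) X) (u : hom (Q i) (Q j)), k i (x ∘ u) = k j x ∘ u) ->
  exists h : hom X Y, forall i x, h ∘ x = k i x.
Proof.
move=> nat.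
have [|h eh] := @colim_desc _ _ _ (canonical_cocone) Y
                  (fun a => k (projT1 a) (projT2 a)) canonical_colimit.
  by move=> [i x] [j y] [u /= <-]; rewrite nat.
by exists h => i x; exact: (eh (existT _ i x : canonical_category)).
Qed.

End Canonical.

(** ** Limits *)

Section Limits.

Variables (V : Set) (o : V -> C) (r : forall v w, hom (o v) (o w) -> Prop).

Definition gcone (X : C) (p : forall v, hom X (o v)) : Prop :=
  forall v w m, @r v w m -> m ∘ p v = p w.

Definition is_glim (X : C) (p : forall v, hom X (o v)) : Prop :=
  gcone p /\
  forall Y (k : forall v, hom Y (o v)), gcone k ->
    exists! h : hom Y X, forall v, p v ∘ h = k v.

(** The generalized elements of a limit are the cones. *)
Lemma glim_exists : exists X (p : forall v, hom X (o v)), is_glim p.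
Proof.
pose F i : Set := {p : forall v, hom (Q i) (o v) | gcone p}.
have res0 i j (u : hom (Q i) (Q j)) (p : F j) : gcone (fun v => proj1_sig p v ∘ u).
  by move=> v w m rm; rewrite comp_assoc (proj2_sig p v w m rm).
pose res i j (u : hom (Q i) (Q j)) (p : F j) : F i := exist _ _ (res0 i j u p).
have extF i (p p' : F i) : (forall v, proj1_sig p v = proj1_sig p' v) -> p = p'.
  by move=> e; apply: sig_ext; apply: functional_extensionality_dep.
have res_id i x : res i i (idm (Q i)) x = x by apply: extF => v /=; rewrite comp_idr.
have res_comp i j k (g : hom (Q j) (Q k)) (f : hom (Q i) (Q j)) x :
    res _ _ (g ∘ f) x = res _ _ f (res _ _ g x).
  by apply: extF => v /=; rewrite comp_assoc.
have amalg (W : Set) (q : W -> I) (s : forall v w, hom (Q (q v)) (Q (q w)) -> Prop)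
    (x : forall v, F (q v)) : card_le W B -> card_le (gedges s) B ->
    (forall v w m, s v w m -> res _ _ m (x w) = x v) ->
    exists i (l : forall v, hom (Q (q v)) (Q i)) (y : F i),
      gcocone (fun v => Q (q v)) s l /\ forall v, res _ _ (l v) y = x v.
  move=> lW lE cx; have [i [l ul]] := gen_closed gQ lW lE.
  have /dchoice [y hy] : forall v, exists y : hom (Q i) (o v),
      forall w, y ∘ l w = proj1_sig (x w) v.
    move=> v; have [|y [ey _]] := proj2 ul _ (fun w => proj1_sig (x w) v).
      by move=> w w' m sm; rewrite -(cx _ _ _ sm).
    by exists y.
  have cy : gcone y.
    move=> v w m rm; apply: (gcolim_epi ul) => t.
    by rewrite -comp_assoc !hy (proj2_sig (x t) v w m rm).
  exists i, l, (exist _ y cy); split; first exact: (proj1 ul).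
  by move=> v; apply: extF => t /=; rewrite hy.
have [c uc] := gen_cocomplete gQ (elements_functor res_id res_comp)
                 (elements_small res_id res_comp).
have pts := colimit_of_elements amalg uc.
have /dchoice [p hp] : forall v, exists p : hom (apex c) (o v),
    forall i (x : F i), p ∘ leg c (existT _ i x : elements res_id res_comp) = proj1_sig x v.
  move=> v; have [|p ep] := @colim_desc _ _ _ c (o v) (fun a => proj1_sig (projT2 a) v) uc.
    by move=> [i x] [j y] [u /= <-].
  by exists p => i x; rewrite ep.
exists (apex c), p; split.
  move=> v w m rm; apply: (colim_epi uc) => -[i x].
  by rewrite -comp_assoc !hp (proj2_sig x v w m rm).
move=> Y k ck.
have ck' i (y : hom (Q i) Y) : gcone (fun v => k v ∘ y).
  by move=> v w m rm; rewrite comp_assoc (ck v w m rm).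
have [|h eh] := element_desc (Y := apex c)
    (k := fun i y => leg c (existT _ i (exist _ _ (ck' i y)) : elements res_id res_comp)).
  move=> i j x u; symmetry.
  have e : res _ _ u (exist _ _ (ck' j x)) = exist _ _ (ck' i (x ∘ u)).
    by apply: extF => v /=; rewrite comp_assoc.
  exact: (leg_nat c (exist _ u e : @hom (elements res_id res_comp)
            (existT _ i _) (existT _ j _))).
exists h; split.
  by move=> v; apply: element_epi => i x; rewrite -comp_assoc eh hp.
move=> h' eh'; apply: element_epi => i x; rewrite eh.
have [z [ez _]] := pts i (h' ∘ x); rewrite -ez.
congr (leg c (existT _ i _)); apply: extF => v /=.
by rewrite -hp ez comp_assoc eh'.
Qed.

End Limits.

End Elements.

Arguments is_glim {C V} o r {X} p.
Arguments gcone {C V} o r {X} p.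

(** * Coalgebras for a copointed endofunctor *)

Section Copointed.

Variables (C : Category) (T : Functor C C) (eps : NatTrans T (id_functor C)).

Record copt_coalgebra := {
  cp_ob : C;
  cp_str : hom cp_ob (T cp_ob);
  cp_law : eps cp_ob ∘ cp_str = idm cp_ob }.

Definition copt_hom (X Y : copt_coalgebra) : Set :=
  {h : hom (cp_ob X) (cp_ob Y) | fmap T h ∘ cp_str X = cp_str Y ∘ h}.

Lemma copt_id_law (X : copt_coalgebra) :
  fmap T (idm (cp_ob X)) ∘ cp_str X = cp_str X ∘ idm (cp_ob X).
Proof. by rewrite fmap_id comp_idl comp_idr. Qed.

Lemma copt_comp_law (X Y Z : copt_coalgebra) (g : copt_hom Y Z) (f : copt_hom X Y) :
  fmap T (proj1_sig g ∘ proj1_sig f) ∘ cp_str X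
  = cp_str Z ∘ (proj1_sig g ∘ proj1_sig f).
Proof.
by rewrite fmap_comp -comp_assoc (proj2_sig f) !comp_assoc (proj2_sig g).
Qed.

Definition Copt : Category.
Proof.
refine (@Build_Category copt_coalgebra copt_hom
  (fun X => exist _ (idm (cp_ob X)) (copt_id_law X))
  (fun X Y Z g f => exist _ (proj1_sig g ∘ proj1_sig f) (copt_comp_law g f)) _ _ _).
- by move=> *; apply: sig_ext; apply: comp_assoc.
- by move=> *; apply: sig_ext; apply: comp_idl.
- by move=> *; apply: sig_ext; apply: comp_idr.
Defined.

Definition copt_forget : Functor Copt C.
Proof. by refine (@Build_Functor Copt C cp_ob (fun X Y h => proj1_sig h) _ _). Defined.

Lemma copt_invertible (X Y : Copt) (h : hom X Y) :
  invertible (fmap copt_forget h) -> invertible h.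
Proof.
move=> [n [nh hn]].
have c : fmap T n ∘ cp_str Y = cp_str X ∘ n.
  rewrite -[LHS]comp_idr -hn comp_assoc -(comp_assoc (fmap T n)) -(proj2_sig h).
  rewrite (comp_assoc (fmap T n)) -fmap_comp.
  by move: nh => /= ->; rewrite fmap_id comp_idl.
by exists (exist _ n c); split; apply: sig_ext.
Qed.

Lemma copt_colim_intro (J : Category) (D : Functor J Copt) (c : Cocone D) :
  is_colimit (map_cocone copt_forget c) -> is_colimit c.
Proof.
move=> uc; apply: colim_intro => [X k nat|X h h' e]; last first.
  apply: sig_ext; apply: (colim_epi uc) => j.
  exact: (f_equal (@proj1_sig _ _) (e j)).
have [|h eh] := @colim_desc _ _ _ (map_cocone copt_forget c) (cp_ob X)
                  (fun j => proj1_sig (k j)) uc.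
  by move=> i j u; exact: (f_equal (@proj1_sig _ _) (nat i j u)).
rewrite /= in eh.
have ch : fmap T h ∘ cp_str (apex c) = cp_str X ∘ h.
  apply: (colim_epi uc) => j /=.
  rewrite -!comp_assoc -(proj2_sig (leg c j)) comp_assoc -fmap_comp.
  by rewrite !eh (proj2_sig (k j)).
by exists (exist _ h ch) => j; apply: sig_ext; apply: eh.
Qed.

Hypothesis coc : cocomplete C.

Lemma copt_colimit (J : Category) (D : Functor J Copt) : small J ->
  exists c : Cocone D, is_colimit (map_cocone copt_forget c).
Proof.
move=> sJ; have [c uc] := coc (comp_functor copt_forget D) sJ.
have [|s es] := @colim_desc _ _ _ c (T (apex c))
                  (fun j => fmap T (leg c j) ∘ cp_str (D j)) uc.
  move=> i j u; rewrite -comp_assoc -(proj2_sig (fmap D u)) comp_assoc -fmap_comp.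
  by rewrite (leg_nat c u).
have law : eps (apex c) ∘ s = idm (apex c).
  apply: (colim_epi uc) => j; rewrite -comp_assoc es comp_assoc naturality.
  by rewrite -comp_assoc (cp_law (D j)) comp_idl comp_idr.
pose A := Build_copt_coalgebra law.
pose l j : @hom Copt (D j) A := exist _ (leg c j) (eq_sym (es j)).
have nat i j (u : hom i j) : l j ∘ fmap D u = l i.
  by apply: sig_ext; exact: (leg_nat c u).
by exists (@Build_Cocone J Copt D A l nat).
Qed.

Lemma copt_cocomplete : cocomplete Copt.
Proof.
by move=> J D /(copt_colimit D) [c uc]; exists c; apply: copt_colim_intro.
Qed.

Lemma copt_forget_cocontinuous (J : Category) (D : Functor J Copt) (c : Cocone D) :
  small J -> is_colimit c -> is_colimit (map_cocone copt_forget c).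
Proof.
move=> /(copt_colimit D) [d ud].
by apply: preserves_one_colimit (ud); apply: copt_colim_intro.
Qed.

Variables (B : Set) (hB : roomy B) (I : Set) (Q : I -> C).
Hypotheses (gQ : generating_family B Q) (cT : bcontinuous B T).

(** *** The solution set: small coalgebras approximate every coalgebra *)

Section Approximation.

Variable Y : Copt.

(** A map from a small object to [Y] together with a part of its domain on
    which a coalgebra structure is already prescribed. *)
Record partial := {
  pt_src : I;
  pt_ob : I;
  pt_in : hom (Q pt_src) (Q pt_ob);
  pt_map : hom (Q pt_ob) (cp_ob Y);
  pt_str : hom (Q pt_src) (T (Q pt_ob));
  pt_eq : fmap T pt_map ∘ pt_str = cp_str Y ∘ (pt_map ∘ pt_in);
  pt_counit : eps (Q pt_ob) ∘ pt_str = pt_in }.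

(** A step towards a coalgebra: the structure of [Y], defined on all of [pt_ob p]
    with values at a larger small object over [Y]. *)
Record extension (p : partial) := {
  ex_ob : I;
  ex_in : hom (Q (pt_ob p)) (Q ex_ob);
  ex_map : hom (Q ex_ob) (cp_ob Y);
  ex_str : hom (Q (pt_ob p)) (T (Q ex_ob));
  ex_over : ex_map ∘ ex_in = pt_map p;
  ex_eq : fmap T ex_map ∘ ex_str = cp_str Y ∘ pt_map p;
  ex_coh : ex_str ∘ pt_in p = fmap T ex_in ∘ pt_str p;
  ex_counit : eps (Q ex_ob) ∘ ex_str = ex_in }.

(** [T Y] is the filtered colimit of the values of [T] at the small objects
    over [Y], so that a small object on which the structure of [Y] is defined
    maps into one of these values, and each equation that holds in the colimit
    holds at a later stage. *)
Lemma extension_exists (p : partial) : inhabited (extension p).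
Proof.
have sK := @canonical_small _ _ Q (cp_ob Y).
have fK := canonical_filtered gQ (X := cp_ob Y).
have uK := canonical_colimit hB gQ (X := cp_ob Y).
have uT := cT sK fK uK.
pose K := canonical_category Q (cp_ob Y).
have [[q1 y1] [s1 es1]] :=
  proj1 (gen_presentable gQ (pt_ob p) sK fK uT) (cp_str Y ∘ pt_map p).
rewrite /= in s1 es1.
have [q2 [y2 [p2 [w [ep2 ew]]]]] : exists q2 (y2 : hom (Q q2) (cp_ob Y))
    (p2 : hom (Q (pt_ob p)) (Q q2)) (w : hom (Q q1) (Q q2)),
    y2 ∘ p2 = pt_map p /\ y2 ∘ w = y1.
  have [[q2 y2] [[p2 ep2] [[w ew] _]]] :=
    filtered_bound hB fK (existT _ (pt_ob p) (pt_map p) : K) (existT _ q1 y1).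
  by exists q2, y2, p2, w.
have es2 : fmap T y2 ∘ (fmap T w ∘ s1) = cp_str Y ∘ pt_map p.
  by rewrite comp_assoc -fmap_comp ew.
have [q3 [y3 [u3 [ey3 e3]]]] : exists q3 (y3 : hom (Q q3) (cp_ob Y))
    (u3 : hom (Q q2) (Q q3)), y3 ∘ u3 = y2 /\
    fmap T u3 ∘ (fmap T w ∘ s1 ∘ pt_in p) = fmap T u3 ∘ (fmap T p2 ∘ pt_str p).
  have [|[q3 y3] [[u3 ey3] e3]] := proj2 (gen_presentable gQ (pt_src p) sK fK uT)
    (existT _ q2 y2 : K) (fmap T w ∘ s1 ∘ pt_in p) (fmap T p2 ∘ pt_str p).
    rewrite /= comp_assoc es2 -comp_assoc; symmetry.
    by rewrite comp_assoc -fmap_comp ep2 pt_eq.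
  by exists q3, y3, u3.
have [q4 [y4 [u4 [ey4 e4]]]] : exists q4 (y4 : hom (Q q4) (cp_ob Y))
    (u4 : hom (Q q3) (Q q4)), y4 ∘ u4 = y3 /\
    u4 ∘ (eps (Q q3) ∘ (fmap T u3 ∘ (fmap T w ∘ s1))) = u4 ∘ (u3 ∘ p2).
  have [|[q4 y4] [[u4 ey4] e4]] := proj2 (gen_presentable gQ (pt_ob p) sK fK uK)
    (existT _ q3 y3 : K) (eps (Q q3) ∘ (fmap T u3 ∘ (fmap T w ∘ s1))) (u3 ∘ p2).
    have := naturality eps y3 => /= ny.
    rewrite comp_assoc -ny -comp_assoc (comp_assoc (fmap T y3)) -fmap_comp ey3 es2.
    by rewrite comp_assoc cp_law comp_idl comp_assoc ey3 ep2.
  by exists q4, y4, u4.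
rewrite /= in e4.
have := naturality eps u4 => /= nu.
constructor.
refine (@Build_extension p q4 (u4 ∘ (u3 ∘ p2)) y4
          (fmap T u4 ∘ (fmap T u3 ∘ (fmap T w ∘ s1))) _ _ _ _).
- by rewrite comp_assoc ey4 comp_assoc ey3 ep2.
- by rewrite comp_assoc -fmap_comp ey4 comp_assoc -fmap_comp ey3 es2.
- by rewrite !fmap_comp -!comp_assoc -e3 -!comp_assoc.
- by rewrite comp_assoc nu -comp_assoc.
Qed.

Definition next (p : partial) (x : extension p) : partial :=
  {| pt_in := ex_in x; pt_map := ex_map x; pt_str := ex_str x;
     pt_eq := eq_trans (ex_eq x) (f_equal _ (eq_sym (ex_over x)));
     pt_counit := ex_counit x |}.

(** The structure on the union of the chain of extensions maps each stage to the
    value of [T] at the next one; [T] need not preserve this union. *)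
Lemma small_coalgebra_extension (p : partial) :
  exists i (s : hom (Q i) (T (Q i))) (g : hom (Q (pt_ob p)) (Q i))
    (y : hom (Q i) (cp_ob Y)),
    eps (Q i) ∘ s = idm (Q i) /\ fmap T y ∘ s = cp_str Y ∘ y /\
    y ∘ g = pt_map p /\ s ∘ (g ∘ pt_in p) = fmap T g ∘ pt_str p.
Proof.
have [ext _] : exists ext : forall p, extension p, forall p : partial, True.
  apply: (@dchoice _ _ (fun _ _ => True)) => p'.
  by case: (extension_exists p') => x; exists x.
pose chain := fix chain n := match n with
                             | O => p
                             | S n => next (ext (chain n))
                             end.
pose q n := pt_ob (chain n).
pose link n : hom (Q (q n)) (Q (q (S n))) := ex_in (ext (chain n)).
pose str n : hom (Q (q n)) (T (Q (q (S n)))) := ex_str (ext (chain n)).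
pose map n : hom (Q (q n)) (cp_ob Y) := pt_map (chain n).
have strE n : str (S n) ∘ link n = fmap T (link (S n)) ∘ str n.
  exact: (ex_coh (ext (chain (S n)))).
have str0 : str 0 ∘ pt_in p = fmap T (link 0) ∘ pt_str p by exact: ex_coh.
have mapE n : map (S n) ∘ link n = map n by exact: (ex_over (ext (chain n))).
have mapS n : fmap T (map (S n)) ∘ str n = cp_str Y ∘ map n.
  exact: (ex_eq (ext (chain n))).
have strC n : eps (Q (q (S n))) ∘ str n = link n by exact: (ex_counit (ext (chain n))).
pose r n m u := existT (fun m => hom (Q (q n)) (Q (q m))) m u
                = existT _ (S n) (link n).
have [||i [l [cl ul]]] := gen_closed gQ (V := nat) (q := q) (r := r).
  exact: (proj1 hB).
  apply: card_le_trans (proj1 hB); exists (fun e => projT1 e).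
  move=> [n [m [u ru]]] [n' [m' [u' ru']]] /= en; subst n'.
  have e := eq_trans ru (eq_sym ru').
  have em := f_equal (@projT1 _ _) e; rewrite /= in em; subst m'.
  have eu := inj_pair2 _ _ _ _ _ e; subst u'.
  by rewrite (proof_irrelevance _ ru ru').
have lS n : l (S n) ∘ link n = l n by exact: cl.
have desc X (k : forall n, hom (Q (q n)) X) : (forall n, k (S n) ∘ link n = k n) ->
    exists h : hom (Q i) X, forall n, h ∘ l n = k n.
  move=> ck; have [|h [eh _]] := ul X k; last by exists h.
  move=> n m u e.
  have em := f_equal (@projT1 _ _) e; rewrite /= in em; subst m.
  by have eu := inj_pair2 _ _ _ _ _ e; subst u.
have epi X (h h' : hom (Q i) X) : (forall n, h ∘ l n = h' ∘ l n) -> h = h'.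
  exact: gcolim_epi (conj cl ul).
have [n|s es] := desc _ (fun n => fmap T (l (S n)) ∘ str n).
  by rewrite -comp_assoc strE comp_assoc -fmap_comp lS.
have [|y ey] := desc _ map; first exact: mapE.
exists i, s, (l 0), y; split; [|split; [|split]].
- apply: epi => n; have := naturality eps (l (S n)) => /= nl.
  by rewrite -comp_assoc es comp_assoc nl -comp_assoc strC lS comp_idl.
- by apply: epi => n; rewrite -!comp_assoc es comp_assoc -fmap_comp !ey mapS.
- exact: (ey 0).
- rewrite comp_assoc (es 0) -comp_assoc str0 comp_assoc -fmap_comp.
  by rewrite (lS 0).
Qed.

End Approximation.

(** *** Small coalgebras generate *)

Definition small_coalgebra : Set :=
  {i : I & {s : hom (Q i) (T (Q i)) | eps (Q i) ∘ s = idm (Q i)}}.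

Definition small_copt (a : small_coalgebra) : Copt :=
  Build_copt_coalgebra (proj2_sig (projT2 a)).

(** Extending a partial structure serves twice: for a single element, the
    structure is prescribed on an initial object only; for an identification in
    a small coalgebra, it is prescribed by that coalgebra on the coequalizer. *)
Lemma element_small_coalgebra (Y : Copt) i (x : hom (Q i) (cp_ob Y)) :
  exists (a : small_coalgebra) (y : @hom Copt (small_copt a) Y)
    (g : hom (Q i) (cp_ob (small_copt a))), proj1_sig y ∘ g = x.
Proof.
have [i0 h0] := gen_initial gQ.
have epi0 X (h h' : hom (Q i0) X) : h = h'.
  by have [k uk] := h0 X; rewrite -(uk h) -(uk h').
have [e _] := h0 (Q i); have [t _] := h0 (T (Q i)).
pose p := @Build_partial Y i0 i e x t (epi0 _ _ _) (epi0 _ _ _).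
have [j [s [g [y [es [ey [eg _]]]]]]] := small_coalgebra_extension p.
by exists (existT _ j (exist _ s es)), (exist _ y ey), g.
Qed.

Lemma small_coalgebra_identify (Y : Copt) (a : small_coalgebra)
  (w : @hom Copt (small_copt a) Y) i (u v : hom (Q i) (cp_ob (small_copt a))) :
  proj1_sig w ∘ u = proj1_sig w ∘ v ->
  exists (b : small_coalgebra) (c : @hom Copt (small_copt a) (small_copt b))
    (y : @hom Copt (small_copt b) Y),
    y ∘ c = w /\ proj1_sig c ∘ u = proj1_sig c ∘ v.
Proof.
case: a w u v => j [s es] [w ew] u v /= wuv; have ew' := ew; rewrite /= in ew'.
have es0 := es; rewrite /= in es0.
have [k [c [cuv uc]]] := gen_coequal hB gQ u v.
have [w' ec'] := uc _ w wuv.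
have c1 : fmap T w' ∘ (fmap T c ∘ s) = cp_str Y ∘ (w' ∘ c).
  by rewrite comp_assoc -fmap_comp ec' ew'.
have c2 : eps (Q k) ∘ (fmap T c ∘ s) = c.
  have := naturality eps c => /= nc.
  by rewrite comp_assoc nc -comp_assoc es0 comp_idr.
pose p := @Build_partial Y j k c w' (fmap T c ∘ s) c1 c2.
have [k' [s' [g [y [es' [ey [eg ec]]]]]]] := small_coalgebra_extension p.
rewrite /= in eg ec.
have mor : fmap T (g ∘ c) ∘ s = s' ∘ (g ∘ c) by rewrite fmap_comp -comp_assoc ec.
exists (existT _ k' (exist _ s' es')), (exist _ (g ∘ c) mor), (exist _ y ey); split.
  by apply: sig_ext; rewrite /= comp_assoc eg.
by rewrite /= -!comp_assoc cuv.
Qed.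

(** Two elements of [X] that agree in [Y] lie in a common small coalgebra, and
    are identified in a further one over [Y]; the lift of the latter to [X]
    shows that they are equal. *)
Lemma small_copt_detects : detects_isos small_copt.
Proof.
move=> X Y m bij; apply: copt_invertible; apply: (gen_detects gQ) => i y.
have [a [y' [g eg]]] := element_small_coalgebra (Y := Y) y.
have [x [ex _]] := bij a y'.
exists (proj1_sig x ∘ g); split.
  by rewrite /= comp_assoc -eg -ex.
suff inj u v : proj1_sig m ∘ u = proj1_sig m ∘ v -> u = v :> hom (Q i) (cp_ob X).
  move=> x' ex'; apply: inj; rewrite comp_assoc.
  by move: ex' => /= ->; rewrite -eg -ex.
move=> e.
have [[k z] [[u1 eu] [[v1 ev] _]]] := filtered_bound hB
  (canonical_filtered gQ (X := cp_ob X))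
  (existT _ i u : canonical_category Q (cp_ob X)) (existT _ i v).
rewrite /= in u1 eu v1 ev.
have [b [p [h eh]]] := element_small_coalgebra (Y := X) z.
have [|b' [c [w [ew ec]]]] := @small_coalgebra_identify Y b (m ∘ p) i (h ∘ u1) (h ∘ v1).
  by rewrite /= -!comp_assoc !(comp_assoc _ h) eh eu ev.
have [x'' [ex'' _]] := bij b' w.
have e1 : x'' ∘ c = p.
  have [q [_ uq]] := bij b (m ∘ p).
  by rewrite -(uq p) //; symmetry; apply: uq; rewrite comp_assoc ex''.
have e2 t : proj1_sig p ∘ t = proj1_sig x'' ∘ (proj1_sig c ∘ t).
  by rewrite comp_assoc -[proj1_sig x'' ∘ _]/(proj1_sig (x'' ∘ c)) e1.
by rewrite -eu -ev -eh -!comp_assoc !e2 ec.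
Qed.

Lemma small_copt_presentable (a : small_coalgebra) : bpresentable B (small_copt a).
Proof.
case: a => i [s es] J D c sJ fJ uc.
have uc0 := copt_forget_cocontinuous sJ uc.
have ucT := cT sJ fJ uc0.
have [ex eq] := gen_presentable gQ i sJ fJ uc0.
split=> [[x ex0]|j [y ey] [y' ey'] e].
  have [j [y e]] : exists j (y : hom (Q i) (cp_ob (D j))), proj1_sig (leg c j) ∘ y = x.
    exact: ex.
  have ex1 := ex0; rewrite /= in ex1.
  have [|k [u eu]] := proj2 (gen_presentable gQ i sJ fJ ucT) j (fmap T y ∘ s)
                        (cp_str (D j) ∘ y).
    by rewrite /= !comp_assoc -fmap_comp e ex1 -e comp_assoc (proj2_sig (leg c j)).
  rewrite /= in eu.
  have h : fmap T (proj1_sig (fmap D u) ∘ y) ∘ s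
           = cp_str (D k) ∘ (proj1_sig (fmap D u) ∘ y).
    by rewrite fmap_comp -comp_assoc eu !comp_assoc (proj2_sig (fmap D u)).
  exists k, (exist (fun h => fmap T h ∘ s = cp_str (D k) ∘ h) _ h); apply: sig_ext => /=.
  by rewrite comp_assoc -e -[proj1_sig _ ∘ _]/(proj1_sig (leg c k ∘ fmap D u)) leg_nat.
have [|k [u eu]] := eq j y y'; first exact: (f_equal (@proj1_sig _ _) e).
by exists k, u; apply: sig_ext.
Qed.

(** The second clause concerns cocones of maps that need not respect coalgebra
    structures; the construction of cofree coalgebras relies on it. *)
Lemma small_copt_closed (V : Set) (q : V -> small_coalgebra)
  (r : forall v w, @hom Copt (small_copt (q v)) (small_copt (q w)) -> Prop) :
  card_le V B -> card_le (gedges r) B ->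
  exists a (l : forall v, @hom Copt (small_copt (q v)) (small_copt a)),
    is_gcolim (fun v => small_copt (q v)) r l /\
    forall Y (k : forall v, hom (cp_ob (small_copt (q v))) Y),
      (forall v w m, r v w m -> k w ∘ proj1_sig m = k v) ->
      exists h, forall v, h ∘ proj1_sig (l v) = k v.
Proof.
move=> lV lE.
pose r' v w (m : hom (Q (projT1 (q v))) (Q (projT1 (q w)))) :=
  exists m0, @r v w m0 /\ proj1_sig m0 = m.
have [|i [l ul]] := gen_closed gQ (q := fun v => projT1 (q v)) (r := r') lV.
  apply: card_le_trans lE.
  exact: (gedges_image (o := fun v => small_copt (q v)) (o' := fun v => Q (projT1 (q v)))
           (fun v w m => proj1_sig m) r).
have lnat v w m : r v w m -> l w ∘ proj1_sig m = l v.
  by move=> rm; apply: (proj1 ul); exists m.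
pose str v : hom (Q (projT1 (q v))) (T (Q (projT1 (q v)))) := cp_str (small_copt (q v)).
have [|s [es _]] := proj2 ul _ (fun v => fmap T (l v) ∘ str v).
  move=> v w m [m0 [rm <-]]; rewrite -comp_assoc -(proj2_sig m0).
  by rewrite comp_assoc -fmap_comp lnat.
have law : eps (Q i) ∘ s = idm (Q i).
  apply: (gcolim_epi ul) => v; have := naturality eps (l v) => /= nl.
  rewrite -comp_assoc es comp_assoc nl -comp_assoc.
  by have := cp_law (small_copt (q v)) => /= ->; rewrite comp_idl comp_idr.
pose a : small_coalgebra := existT _ i (exist _ s law).
pose lc v : @hom Copt (small_copt (q v)) (small_copt a) := exist _ (l v) (eq_sym (es v)).
have desc Y (k : forall v, hom (cp_ob (small_copt (q v))) Y) :
    (forall v w m, r v w m -> k w ∘ proj1_sig m = k v) ->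
    exists h, forall v, h ∘ l v = k v.
  move=> ck; have [|h [eh _]] := proj2 ul Y k; last by exists h.
  by move=> v w m [m0 [rm <-]]; apply: ck.
exists a, lc; split=> //; split.
  by move=> v w m rm; apply: sig_ext; apply: lnat.
move=> Y k ck.
have [|h eh] := desc (cp_ob Y) (fun v => proj1_sig (k v)).
  by move=> v w m rm; rewrite -(ck _ _ _ rm).
have ch : fmap T h ∘ s = cp_str Y ∘ h.
  apply: (gcolim_epi ul) => v.
  by rewrite -!comp_assoc es comp_assoc -fmap_comp eh; apply: (proj2_sig (k v)).
exists (exist _ h ch); split=> [v|h' eh']; first by apply: sig_ext; apply: eh.
apply: sig_ext; apply: (gcolim_epi ul) => v /=.
by rewrite eh -(eh' v).
Qed.

Lemma small_copt_generating : generating_family B small_copt.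
Proof.
constructor.
- exact: copt_cocomplete.
- exact: small_copt_presentable.
- exact: small_copt_detects.
- by move=> V q r lV /(small_copt_closed lV) [a [l [ul _]]]; exists a, l.
Qed.

(** *** Cofree coalgebras *)

Definition is_cofree (X : C) (A : Copt) (e : hom (cp_ob A) X) : Prop :=
  forall (Y : Copt) (k : hom (cp_ob Y) X),
    exists! h : @hom Copt Y A, e ∘ proj1_sig h = k.

(** The generalized elements of the cofree coalgebra on [X] are the maps from
    carriers of small coalgebras to [X]. *)
Lemma cofree_exists (X : C) : exists (A : Copt) (e : hom (cp_ob A) X), is_cofree e.
Proof.
pose F a := hom (cp_ob (small_copt a)) X.
pose res a b (u : @hom Copt (small_copt a) (small_copt b)) (y : F b) : F a :=
  y ∘ proj1_sig u.
have res_id a x : res a a (idm (small_copt a)) x = x by exact: comp_idr.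
have res_comp i j k (g : hom (small_copt j) (small_copt k))
    (f : hom (small_copt i) (small_copt j)) x :
    res _ _ (g ∘ f) x = res _ _ f (res _ _ g x) by exact: comp_assoc.
have gS := small_copt_generating.
have amalg (V : Set) (q : V -> small_coalgebra)
    (r : forall v w, hom (small_copt (q v)) (small_copt (q w)) -> Prop)
    (x : forall v, F (q v)) : card_le V B -> card_le (gedges r) B ->
    (forall v w m, r v w m -> res _ _ m (x w) = x v) ->
    exists a (l : forall v, hom (small_copt (q v)) (small_copt a)) (y : F a),
      gcocone (fun v => small_copt (q v)) r l /\ forall v, res _ _ (l v) y = x v.
  move=> lV lE cx; have [a [l [ul desc]]] := small_copt_closed lV lE.
  by have [y ey] := desc _ x cx; exists a, l, y; split=> //; apply: (proj1 ul).
have sE := elements_small res_id res_comp.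
have [c uc] := gen_cocomplete gS (elements_functor res_id res_comp) sE.
have pts := colimit_of_elements hB gS amalg uc.
have uc0 := copt_forget_cocontinuous sE uc.
have [|e he] := @colim_desc _ _ _ (map_cocone copt_forget c) X (fun a => projT2 a) uc0.
  by move=> a b u; exact: (proj2_sig u).
have {}he a (x : F a) :
    e ∘ proj1_sig (leg c (existT _ a x : elements res_id res_comp)) = x.
  exact: (he (existT _ a x)).
exists (apex c), e => Y k.
have uY := canonical_colimit hB gS (X := Y).
have [|h eh] := @colim_desc _ _ _ (canonical_cocone small_copt Y) (apex c)
  (fun a => leg c (existT _ (projT1 a) (k ∘ proj1_sig (projT2 a))
                   : elements res_id res_comp)) uY.
  move=> [a y] [b z] [u /= <-].
  have q : res _ _ u (k ∘ proj1_sig z) = k ∘ (proj1_sig z ∘ proj1_sig u).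
    by rewrite /res comp_assoc.
  exact: (leg_nat c (exist _ u q : @hom (elements res_id res_comp)
            (existT _ a _) (existT _ b _))).
have {}eh a (y : hom (small_copt a) Y) :
    h ∘ y = leg c (existT _ a (k ∘ proj1_sig y) : elements res_id res_comp).
  exact: (eh (existT _ a y : canonical_category small_copt Y)).
exists h; split.
  have uY0 := copt_forget_cocontinuous (canonical_small _ _) uY.
  apply: (colim_epi uY0) => -[a y] /=.
  rewrite -comp_assoc -[proj1_sig h ∘ _]/(proj1_sig (h ∘ (y : hom (small_copt a) Y))).
  by rewrite eh he.
move=> h' eh'; apply: (element_epi hB gS) => a y; rewrite eh.
have [x [ex _]] := pts a (h' ∘ y); rewrite -ex.
congr (leg c (existT _ a _)).
by rewrite -eh' -comp_assoc -[proj1_sig h' ∘ _]/(proj1_sig (h' ∘ y)) -ex he.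
Qed.

(** The right adjoint of [copt_forget] preserves filtered colimits because
    [copt_forget] preserves presentability of the generators. *)
Lemma cofree_bcontinuous (G : Functor C Copt) (e : forall X, hom (cp_ob (G X)) X) :
  (forall X, is_cofree (e X)) ->
  (forall X Y (f : hom X Y), f ∘ e X = e Y ∘ proj1_sig (fmap G f)) ->
  bcontinuous B (comp_functor copt_forget G).
Proof.
move=> cofree nat J D c sJ fJ uc.
have gS := small_copt_generating.
have inj X (Y : Copt) (h h' : hom Y (G X)) :
    e X ∘ proj1_sig h = e X ∘ proj1_sig h' -> h = h'.
  move=> q; have [k [_ uk]] := cofree X Y (e X ∘ proj1_sig h).
  by rewrite -(uk h) // -(uk h').
suff uGc : is_colimit (map_cocone G c).
  have u := copt_forget_cocontinuous sJ uGc.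
  apply: colim_intro => [X k nk|X h h' q].
    exact: (@colim_desc _ _ _ (map_cocone copt_forget (map_cocone G c)) X k u nk).
  exact: (@colim_epi _ _ _ (map_cocone copt_forget (map_cocone G c)) X h h' u q).
have [d ud] := copt_cocomplete (comp_functor G D) sJ.
have [|n en] := @colim_desc _ _ _ d (G (apex c)) (fun j => fmap G (leg c j)) ud.
  exact: (@leg_nat _ _ _ (map_cocone G c)).
apply: (@colim_along_iso _ _ _ (map_cocone G c) d n ud _ en).
apply: (gen_detects gS) => a y.
have lift j (x : hom (cp_ob (small_copt a)) (D j)) :
    exists x' : hom (small_copt a) (G (D j)), e (D j) ∘ proj1_sig x' = x.
  by have [x' [ex' _]] := cofree (D j) _ x; exists x'.
have en' j (z : hom (small_copt a) (G (D j))) : e (apex c) ∘ proj1_sig (n ∘ (leg d j ∘ z))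
    = leg c j ∘ (e (D j) ∘ proj1_sig z).
  by rewrite comp_assoc en comp_assoc nat -comp_assoc.
have pa := small_copt_presentable a.
have pC := gen_presentable gQ (projT1 a).
have [j [x ex]] := proj1 (pC _ _ _ sJ fJ uc) (e (apex c) ∘ proj1_sig y).
have [x' ex'] := lift j x.
exists (leg d j ∘ x'); split; first by apply: inj; rewrite en' ex'.
move=> z ez; have [j' [z' ez']] := proj1 (pa _ _ _ sJ fJ ud) z.
have [|k [u [v q]]] := bpresentable_pair hB pC sJ fJ uc
    (y := x) (y' := e (D j') ∘ proj1_sig z').
  by rewrite ex -en' ez' ez.
rewrite -ez' -(leg_nat d u) -(leg_nat d v) -!comp_assoc; congr (_ ∘ _).
apply: inj => /=; rewrite !comp_assoc -!nat -!comp_assoc.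
by rewrite ex' q.
Qed.

End Copointed.

(** * Algebras for a pointed endofunctor *)

(** The limit of the weakly initial objects and of all morphisms between them
    is initial: every endomorphism that factors through one of them is an
    identity, so that equalizers of maps out of the limit are split. *)
Lemma initial_of_weakly_initial (D : Category)
  (lims : forall (V : Set) (o : V -> D) (r : forall v w, hom (o v) (o w) -> Prop),
    exists X (p : forall v, hom X (o v)), is_glim o r p)
  (W : Set) (w : W -> D) :
  (forall A : D, exists i, inhabited (hom (w i) A)) ->
  exists A0 : D, forall A : D, exists h : hom A0 A, forall h', h = h'.
Proof.
move=> weak.
have [L [p [cp up]]] := lims W w (fun _ _ _ => True).
exists L => A; have [i [h]] := weak A; exists (h ∘ p i) => h'.
move: (h ∘ p i) => f {i h}.
pose o (b : bool) := if b then L else A.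
pose r (b b' : bool) : hom (o b) (o b') -> Prop :=
  match b, b' with
  | true, false => fun m => m = f \/ m = h'
  | _, _ => fun _ => False
  end.
have [E [e [ce _]]] := lims bool o r.
have [i [k]] := weak E.
have split_e : e true ∘ (k ∘ p i) = idm L.
  have [t [_ ut]] := up L p cp.
  have <- : t = idm L by apply: ut => v; rewrite comp_idr.
  by symmetry; apply: ut => v; rewrite !comp_assoc; apply: cp.
rewrite -[f]comp_idr -[h']comp_idr -split_e !comp_assoc; congr (_ ∘ _ ∘ _).
exact: eq_trans (ce true false f (or_introl eq_refl))
  (eq_sym (ce true false h' (or_intror eq_refl))).
Qed.

Section Pointed.

Variables (C : Category) (T : Functor C C) (eta : NatTrans (id_functor C) T).

Record ptd_algebra := {
  al_ob : C;
  al_str : hom (T al_ob) al_ob;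
  al_law : al_str ∘ eta al_ob = idm al_ob }.

Definition ptd_hom (X Y : ptd_algebra) : Set :=
  {h : hom (al_ob X) (al_ob Y) | al_str Y ∘ fmap T h = h ∘ al_str X}.

Lemma ptd_id_law (X : ptd_algebra) :
  al_str X ∘ fmap T (idm (al_ob X)) = idm (al_ob X) ∘ al_str X.
Proof. by rewrite fmap_id comp_idl comp_idr. Qed.

Lemma ptd_comp_law (X Y Z : ptd_algebra) (g : ptd_hom Y Z) (f : ptd_hom X Y) :
  al_str Z ∘ fmap T (proj1_sig g ∘ proj1_sig f)
  = (proj1_sig g ∘ proj1_sig f) ∘ al_str X.
Proof.
by rewrite fmap_comp comp_assoc (proj2_sig g) -!comp_assoc (proj2_sig f).
Qed.

Definition Ptd : Category.
Proof.
refine (@Build_Category ptd_algebra ptd_hom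
  (fun X => exist _ (idm (al_ob X)) (ptd_id_law X))
  (fun X Y Z g f => exist _ (proj1_sig g ∘ proj1_sig f) (ptd_comp_law g f)) _ _ _).
- by move=> *; apply: sig_ext; apply: comp_assoc.
- by move=> *; apply: sig_ext; apply: comp_idl.
- by move=> *; apply: sig_ext; apply: comp_idr.
Defined.

Definition ptd_forget : Functor Ptd C.
Proof. by refine (@Build_Functor Ptd C al_ob (fun X Y h => proj1_sig h) _ _). Defined.

Variables (B : Set) (hB : roomy B) (I : Set) (Q : I -> C).
Hypotheses (gQ : generating_family B Q) (cT : bcontinuous B T).

(** ** The subalgebra generated by a map *)

Section Generated.

Variable X : C.

(** The formal operations that generate elements of an algebra under [X]: the
    action of [T], restriction along maps, and joining a family of elements
    into an element of a colimit. *)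
Inductive gen_op : Set :=
| gen_act i j (z : hom (Q j) (T (Q i)))
| gen_res i j (z : hom (Q j) (Q i))
| gen_join (act : B -> bool) (q : B -> I) j (l : forall b, hom (Q (q b)) (Q j)).

(** The set of formal terms does not depend on the algebra in which they are
    interpreted, and so bounds the size of all generated subalgebras. *)
Inductive gen_term : Set :=
| gen_unit i (z : hom (Q i) X)
| gen_apply (c : gen_op) (args : B -> gen_term).

Section Denotation.

Variables (A : Ptd) (x : hom X (al_ob A)).

Notation el := {i : I & hom (Q i) (al_ob A)}.

Definition mk_el i (y : hom (Q i) (al_ob A)) : el := existT _ i y.

Definition gen_step (c : gen_op) (P : B -> el -> Prop) (e : el) : Prop :=
  match c with
  | @gen_act i j z =>
    exists y : hom (Q i) (al_ob A),
      (forall b, P b (mk_el y)) /\ e = mk_el (al_str A ∘ fmap T y ∘ z)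
  | @gen_res i j z =>
    exists y : hom (Q i) (al_ob A), (forall b, P b (mk_el y)) /\ e = mk_el (y ∘ z)
  | @gen_join act q j l =>
    (forall y y' : hom (Q j) (al_ob A),
      (forall b, act b = true -> y ∘ l b = y' ∘ l b) -> y = y') /\
    exists y : hom (Q j) (al_ob A),
      (forall b, act b = true -> P b (mk_el (y ∘ l b))) /\ e = mk_el y
  end.

Fixpoint denotes (t : gen_term) : el -> Prop :=
  match t with
  | gen_unit z => fun e => e = mk_el (x ∘ z)
  | gen_apply c args => gen_step c (fun b => denotes (args b))
  end.

Lemma mk_el_inj i (y y' : hom (Q i) (al_ob A)) : mk_el y = mk_el y' -> y = y'.
Proof. exact: inj_pair2. Qed.

Lemma denotes_functional t e e' : denotes t e -> denotes t e' -> e = e'.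
Proof.
have [f _] := proj1 hB; pose b0 := f 0.
elim: t e e' => [i z|c args IH] e e' /=; first by move=> -> ->.
case: c => [i j z|i j z|act q j l] /=.
- by move=> [y [hy ->]] [y' [hy' ->]]; rewrite (mk_el_inj (IH b0 _ _ (hy b0) (hy' b0))).
- by move=> [y [hy ->]] [y' [hy' ->]]; rewrite (mk_el_inj (IH b0 _ _ (hy b0) (hy' b0))).
- move=> [epi [y [hy ->]]] [_ [y' [hy' ->]]]; congr mk_el; apply: epi => b ab.
  exact: mk_el_inj (IH b _ _ (hy b ab) (hy' b ab)).
Qed.

Definition generated i (y : hom (Q i) (al_ob A)) : Prop :=
  exists t, denotes t (mk_el y).

Lemma generated_unit i (z : hom (Q i) X) : generated (x ∘ z).
Proof. by exists (gen_unit z). Qed.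

Lemma generated_act i j (y : hom (Q i) (al_ob A)) (z : hom (Q j) (T (Q i))) :
  generated y -> generated (al_str A ∘ fmap T y ∘ z).
Proof. by case=> t ht; exists (gen_apply (gen_act z) (fun _ => t)), y. Qed.

Lemma generated_res i j (y : hom (Q i) (al_ob A)) (z : hom (Q j) (Q i)) :
  generated y -> generated (y ∘ z).
Proof. by case=> t ht; exists (gen_apply (gen_res z) (fun _ => t)), y. Qed.

Lemma generated_join (V : Set) (q : V -> I)
  (r : forall v w, hom (Q (q v)) (Q (q w)) -> Prop) j
  (l : forall v, hom (Q (q v)) (Q j)) (y : hom (Q j) (al_ob A)) :
  card_le V B -> is_gcolim (fun v => Q (q v)) r l ->
  (forall v, generated (y ∘ l v)) -> generated y.
Proof.
move=> [f hf] ul /dchoice [t ht].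
pose act b := truth (exists v, f v = b).
pose src := {k : I & hom (Q k) (Q j)}.
pose lq v : src := existT _ (q v) (l v).
have [s hs] : exists s : B -> src * gen_term, forall b v, f v = b -> s b = (lq v, t v).
  apply: (@dchoice B (fun _ => src * gen_term)%type
            (fun b s => forall v, f v = b -> s = (lq v, t v))) => b.
  case: (classic (exists v, f v = b)) => [[v <-]|n].
    by exists (lq v, t v) => w /hf ->.
  have [i0 h0] := gen_initial gQ; have [z _] := h0 X.
  by exists (existT _ j (idm (Q j)), gen_unit z) => v e; case: n; exists v.
exists (gen_apply (@gen_join act (fun b => projT1 (fst (s b))) j
                     (fun b => projT2 (fst (s b)))) (fun b => snd (s b))) => /=.
split.
  move=> y1 y2 e; apply: (gcolim_epi ul) => v.
  have av : act (f v) = true by apply/truthP; exists v.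
  by have := e _ av; rewrite (hs _ v eq_refl).
exists y; split=> // b /truthP [v ev].
by rewrite (hs _ _ ev); apply: ht.
Qed.

(** The elements of the generated subalgebra are the generated elements; it is
    the colimit of a graph whose vertices are formal terms. *)
Lemma generated_subalgebra :
  exists (c : code gen_term Q) (A' : Ptd) (x' : hom X (al_ob A')) (m : @hom Ptd A' A),
    al_ob A' = code_colimit (gen_cocomplete gQ) c /\ proj1_sig m ∘ x' = x.
Proof.
pose F i : Set := {y : hom (Q i) (al_ob A) | generated y}.
pose res i j (u : hom (Q i) (Q j)) (y : F j) : F i :=
  exist _ _ (generated_res u (proj2_sig y)).
have res_id i y : res i i (idm (Q i)) y = y by apply: sig_ext; apply: comp_idr.
have res_comp i j k (g : hom (Q j) (Q k)) (f : hom (Q i) (Q j)) y :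
    res _ _ (g ∘ f) y = res _ _ f (res _ _ g y) by apply: sig_ext; apply: comp_assoc.
have amalg (V : Set) (q : V -> I) (r : forall v w, hom (Q (q v)) (Q (q w)) -> Prop)
    (y : forall v, F (q v)) : card_le V B -> card_le (gedges r) B ->
    (forall v w m, r v w m -> res _ _ m (y w) = y v) ->
    exists i (l : forall v, hom (Q (q v)) (Q i)) (z : F i),
      gcocone (fun v => Q (q v)) r l /\ forall v, res _ _ (l v) z = y v.
  move=> lV lE cy; have [i [l ul]] := gen_closed gQ lV lE.
  have [|z [ez _]] := proj2 ul _ (fun v => proj1_sig (y v)).
    by move=> v w m rm; rewrite -(cy _ _ _ rm).
  have gz : generated z.
    by apply: (generated_join lV ul) => v; rewrite ez; apply: (proj2_sig (y v)).
  exists i, l, (exist _ z gz); split; first exact: (proj1 ul).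
  by move=> v; apply: sig_ext; apply: ez.
pose K := elements res_id res_comp.
pose D : Functor K C := elements_functor res_id res_comp.
pose r (a b : {i : I & F i}) (m : hom (Q (projT1 a)) (Q (projT1 b))) :=
  exists u : @hom K a b, fmap D u = m.
have lV : card_le {i : I & F i} gen_term.
  apply: (@card_le_rel _ _ (fun e t => denotes t (mk_el (proj1_sig (projT2 e))))).
    by move=> [i [y]].
  move=> [i [y gy]] [i' [y' gy']] t /= d d'.
  have e := denotes_functional d d'.
  have ei := f_equal (@projT1 _ _) e; rewrite /= in ei; subst i'.
  have ey := mk_el_inj e; subst y'.
  by rewrite (proof_irrelevance _ gy gy').
have [c [_ hc]] := code_of_graph (q := fun e : {i : I & F i} => projT1 e) r lV.
have [l0 ul0] := code_colimitP (gen_cocomplete gQ) c.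
have [l ul] := hc _ _ ul0.
have ln (a b : K) (u : hom a b) : l b ∘ fmap D u = l a.
  by apply: (proj1 ul); exists u.
pose cc := @Build_Cocone K C D _ l ln.
have uc : is_colimit cc.
  move=> d; have [|h [eh uh]] := proj2 ul _ (leg d : forall e, hom (Q (projT1 e)) _).
    by move=> a b m [u <-]; exact: (leg_nat d u).
  by exists h; split.
have pts := colimit_of_elements hB gQ amalg uc.
have [|m em] := @colim_desc _ _ _ cc (al_ob A) (fun a => proj1_sig (projT2 a)) uc.
  by move=> a b u; rewrite -(proj2_sig u).
have {}em i (y : F i) : m ∘ leg cc (existT _ i y : K) = proj1_sig y.
  exact: (em (existT _ i y : K)).
have inj i (y y' : hom (Q i) (apex cc)) : m ∘ y = m ∘ y' -> y = y'.
  have [z [<- _]] := pts i y; have [z' [<- _]] := pts i y'.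
  by rewrite !em => e; congr (leg cc (existT _ i _)); apply: sig_ext.
have gen_m i (y : hom (Q i) (apex cc)) : generated (m ∘ y).
  by have [z [<- _]] := pts i y; rewrite em; apply: (proj2_sig z).
have lift Z (f : hom Z (al_ob A)) : (forall i (z : hom (Q i) Z), generated (f ∘ z)) ->
    exists f' : hom Z (apex cc), m ∘ f' = f.
  move=> gf.
  have [|f' ef'] := element_desc hB gQ (Y := apex cc)
    (k := fun i (z : hom (Q i) Z) => leg cc (existT _ i (exist _ _ (gf i z)) : K)).
    move=> i j z u; apply: inj; rewrite em (comp_assoc m) em /=.
    exact: comp_assoc.
  by exists f'; apply: (element_epi hB gQ) => i z; rewrite -comp_assoc ef' em.
have mono Z (f g : hom Z (apex cc)) : m ∘ f = m ∘ g -> f = g.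
  move=> e; apply: (element_epi hB gQ) => i z; apply: inj.
  by rewrite !comp_assoc e.
have [|a ea] := lift _ (al_str A ∘ fmap T m).
  move=> i z.
  have sK := @canonical_small _ _ Q (apex cc).
  have fK := canonical_filtered gQ (X := apex cc).
  have uT := cT sK fK (canonical_colimit hB gQ (X := apex cc)).
  have [[j y] [z' e]] := proj1 (gen_presentable gQ i sK fK uT) z.
  rewrite /= in z' e.
  rewrite -e -comp_assoc (comp_assoc (fmap T m)) -fmap_comp comp_assoc.
  by apply: generated_act.
have [|x' ex'] := lift _ x; first exact: generated_unit.
have law : a ∘ eta (apex cc) = idm (apex cc).
  apply: mono; have := naturality eta m => /= nm.
  by rewrite comp_assoc ea -comp_assoc -nm comp_assoc al_law comp_idl comp_idr.
by exists c, (Build_ptd_algebra law), x', (exist _ m (eq_sym ea)).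
Qed.

End Denotation.

End Generated.

(** ** Free algebras *)

Section Free.

Variable X : C.

Record under := {
  un_alg : Ptd;
  un_map : hom X (al_ob un_alg) }.

Definition under_hom (U V : under) : Set :=
  {h : hom (un_alg U) (un_alg V) | proj1_sig h ∘ un_map U = un_map V}.

Lemma under_id_law (U : under) : proj1_sig (idm (un_alg U)) ∘ un_map U = un_map U.
Proof. exact: comp_idl. Qed.

Lemma under_comp_law (U V W : under) (g : under_hom V W) (f : under_hom U V) :
  proj1_sig (proj1_sig g ∘ proj1_sig f) ∘ un_map U = un_map W.
Proof. by rewrite /= -comp_assoc (proj2_sig f) (proj2_sig g). Qed.

Definition Under : Category.
Proof.
refine (@Build_Category under under_hom
  (fun U => exist _ (idm (un_alg U)) (under_id_law U))
  (fun U V W g f => exist _ (proj1_sig g ∘ proj1_sig f) (under_comp_law g f)) _ _ _).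
- by move=> *; apply: sig_ext; apply: comp_assoc.
- by move=> *; apply: sig_ext; apply: comp_idl.
- by move=> *; apply: sig_ext; apply: comp_idr.
Defined.

(** Limits of pointed algebras are computed in [C]. *)
Lemma under_limits (V : Set) (o : V -> Under)
  (r : forall v w, hom (o v) (o w) -> Prop) :
  exists U (p : forall v, hom U (o v)), is_glim o r p.
Proof.
pose o' v : C := al_ob (un_alg (o v)).
pose r' v w (m' : hom (o' v) (o' w)) :=
  exists m, r v w m /\ proj1_sig (proj1_sig m) = m'.
have [L [p [cp up]]] := glim_exists hB gQ r'.
have cone v w m : r v w m -> proj1_sig (proj1_sig m) ∘ p v = p w.
  by move=> rm; apply: cp; exists m.
have lift Z (k : forall v, hom Z (o' v)) :
    (forall v w m, r v w m -> proj1_sig (proj1_sig m) ∘ k v = k w) ->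
    exists h, (forall v, p v ∘ h = k v) /\
      forall h', (forall v, p v ∘ h' = k v) -> h = h'.
  move=> ck; have [|h [eh uh]] := up Z k; last by exists h.
  by move=> v w m' [m [rm <-]]; apply: ck.
have epi Z (h h' : hom Z L) : (forall v, p v ∘ h = p v ∘ h') -> h = h'.
  move=> e; have [|k [_ uk]] := lift Z (fun v => p v ∘ h).
    by move=> v w m rm; rewrite comp_assoc (cone _ _ _ rm).
  by rewrite -(uk h) // -(uk h').
have [|a [ea _]] := lift _ (fun v => al_str (un_alg (o v)) ∘ fmap T (p v)).
  move=> v w m rm; rewrite -(cone _ _ _ rm) fmap_comp !comp_assoc.
  by rewrite (proj2_sig (proj1_sig m)).
have [|x [ex _]] := lift _ (fun v => un_map (o v)).
  by move=> v w m rm; apply: (proj2_sig m).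
have law : a ∘ eta L = idm L.
  apply: epi => v; have := naturality eta (p v) => /= np.
  by rewrite comp_assoc ea -comp_assoc -np comp_assoc al_law comp_idl comp_idr.
pose U : Under := @Build_under (Build_ptd_algebra law) x.
have pa v : al_str (un_alg (o v)) ∘ fmap T (p v) = p v ∘ a by rewrite ea.
pose q v : hom U (o v) := exist _ (exist _ (p v) (pa v)) (ex v).
exists U, q; split.
  by move=> v w m rm; apply: sig_ext; apply: sig_ext; apply: cone.
move=> Z k ck.
have [|h [eh uh]] := lift _ (fun v => proj1_sig (proj1_sig (k v))).
  by move=> v w m rm; rewrite -(ck _ _ _ rm).
have ha : a ∘ fmap T h = h ∘ al_str (un_alg Z).
  apply: epi => v; rewrite !comp_assoc ea.
  by have := proj2_sig (proj1_sig (k v)); rewrite -eh fmap_comp comp_assoc.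
have hx : h ∘ un_map Z = x.
  by apply: epi => v; rewrite comp_assoc eh ex; apply: (proj2_sig (k v)).
pose h1 : hom (un_alg Z) (un_alg U) := exist _ h ha.
exists (exist _ h1 hx); split.
  by move=> v; apply: sig_ext; apply: sig_ext; apply: eh.
move=> h' eh'; apply: sig_ext; apply: sig_ext; apply: uh => v.
by rewrite -(eh' v).
Qed.

Definition is_free (A : Ptd) (e : hom X (al_ob A)) : Prop :=
  forall (Y : Ptd) (k : hom X (al_ob Y)),
    exists! h : @hom Ptd A Y, proj1_sig h ∘ e = k.

Lemma free_exists : exists (A : Ptd) (e : hom X (al_ob A)), is_free e.
Proof.
pose ob (c : code (gen_term X) Q) := code_colimit (gen_cocomplete gQ) c.
pose W : Set := {c : code (gen_term X) Q &
  ({a : hom (T (ob c)) (ob c) | a ∘ eta (ob c) = idm (ob c)} * hom X (ob c))%type}.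
pose w (i : W) : Under :=
  @Build_under (Build_ptd_algebra (proj2_sig (fst (projT2 i)))) (snd (projT2 i)).
have [|U hU] := initial_of_weakly_initial under_limits (w := w).
  move=> [A x]; have [c [[A' a law] [x' [m [/= e em]]]]] := generated_subalgebra x.
  subst A'; pose i : W := existT _ c (exist _ a law, x').
  by exists i; constructor; exact: (exist _ m em).
exists (un_alg U), (un_map U) => Y k.
have [h uh] := hU (@Build_under Y k).
exists (proj1_sig h); split; first exact: (proj2_sig h).
by move=> h' eh'; rewrite (uh (exist _ h' eh')).
Qed.

End Free.

(** The underlying object of a filtered colimit of free algebras is an algebra,
    with the universal property of the free algebra on the colimit. *)
Lemma free_bcontinuous (G : Functor C Ptd) (e : forall X, hom X (al_ob (G X))) :
  (forall X, is_free (e X)) ->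
  (forall X Y (f : hom X Y), e Y ∘ f = proj1_sig (fmap G f) ∘ e X) ->
  bcontinuous B (comp_functor ptd_forget G).
Proof.
move=> free nat J D c sJ fJ uc.
have inj X (Y : Ptd) (h h' : hom (G X) Y) :
    proj1_sig h ∘ e X = proj1_sig h' ∘ e X -> h = h'.
  move=> q; have [k [_ uk]] := free X Y (proj1_sig h ∘ e X).
  by rewrite -(uk h) // -(uk h').
have [d ud] := gen_cocomplete gQ (comp_functor (comp_functor ptd_forget G) D) sJ.
have uT := cT sJ fJ ud.
have [|a ea] := @colim_desc _ _ _ (map_cocone T d) (apex d)
    (fun j => leg d j ∘ al_str (G (D j))) uT.
  move=> i j u /=; rewrite -comp_assoc (proj2_sig (fmap G (fmap D u))) comp_assoc.
  by rewrite (leg_nat d u).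
rewrite /= in ea.
have law : a ∘ eta (apex d) = idm (apex d).
  apply: (colim_epi ud) => j; have := naturality eta (leg d j) => /= nl.
  by rewrite -comp_assoc nl comp_assoc ea -comp_assoc al_law comp_idl comp_idr.
pose Y : Ptd := Build_ptd_algebra law.
pose lY j : hom (G (D j)) Y := exist _ (leg d j) (ea j).
have [|n en] := @colim_desc _ _ _ d (al_ob (G (apex c)))
    (fun j => proj1_sig (fmap G (leg c j))) ud.
  by move=> i j u; rewrite -(leg_nat c u) fmap_comp.
have hn : al_str (G (apex c)) ∘ fmap T n = n ∘ a.
  apply: (colim_epi uT) => j /=.
  rewrite -!comp_assoc ea -fmap_comp comp_assoc en.
  exact: (proj2_sig (fmap G (leg c j))).
pose nY : hom Y (G (apex c)) := exist _ n hn.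
have [|k ek] := @colim_desc _ _ _ c (apex d) (fun j => leg d j ∘ e (D j)) uc.
  by move=> i j u; rewrite -comp_assoc nat comp_assoc (leg_nat d u).
have [h [eh _]] := free (apex c) Y k.
apply: (@colim_along_iso _ _ _ (map_cocone (comp_functor ptd_forget G) c) d n ud _ en).
exists (proj1_sig h); split.
  apply: (colim_epi ud) => j; rewrite comp_idl -comp_assoc en.
  suff : h ∘ fmap G (leg c j) = lY j by move=> /(f_equal (@proj1_sig _ _)).
  by apply: inj; rewrite /= -comp_assoc -nat comp_assoc eh ek.
suff : nY ∘ h = idm (G (apex c)) by move=> /(f_equal (@proj1_sig _ _)).
apply: inj; rewrite /= -comp_assoc eh comp_idl.
apply: (colim_epi uc) => j.
by rewrite -comp_assoc ek comp_assoc en nat.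
Qed.

End Pointed.

(** * Algebraic weak factorization systems in elementary terms *)

Section Laws.

Variables (M : Category) (F : FunctorialFactorization M).

Notation Larr f := (mkArrow (ffL F f) : ob (Arrow M)).
Notation Rarr f := (mkArrow (ffR F f) : ob (Arrow M)).

Variables (d : forall f : arrow M, hom (F f) (F (Larr f)))
  (m : forall f : arrow M, hom (F (Rarr f)) (F f)).

(** The squares to which [fmap F] is applied are specified by their components,
    so that no commutativity proof occurs in the equations. *)
Record awfs_laws : Prop := {
  law_dL : forall f, d f ∘ ffL F f = ffL F (Larr f);
  law_dR : forall f, ffR F (Larr f) ∘ d f = idm (F f);
  law_dE : forall (f : Arrow M) (x : hom (Larr f) f),
    sdom x = idm _ -> scod x = ffR F f -> fmap F x ∘ d f = idm (F f);
  law_dd : forall (f : Arrow M) (x : hom (Larr f) (Larr (Larr f))),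
    sdom x = idm _ -> scod x = d f -> d (Larr f) ∘ d f = fmap F x ∘ d f;
  law_dnat : forall (f g : Arrow M) (x : hom f g) (y : hom (Larr f) (Larr g)),
    sdom y = sdom x -> scod y = fmap F x -> d g ∘ fmap F x = fmap F y ∘ d f;
  law_mR : forall f, ffR F f ∘ m f = ffR F (Rarr f);
  law_mL : forall f, m f ∘ ffL F (Rarr f) = idm (F f);
  law_mE : forall (f : Arrow M) (x : hom f (Rarr f)),
    sdom x = ffL F f -> scod x = idm _ -> m f ∘ fmap F x = idm (F f);
  law_mm : forall (f : Arrow M) (x : hom (Rarr (Rarr f)) (Rarr f)),
    sdom x = m f -> scod x = idm _ -> m f ∘ m (Rarr f) = m f ∘ fmap F x;
  law_mnat : forall (f g : Arrow M) (x : hom f g) (y : hom (Rarr f) (Rarr g)),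
    sdom y = fmap F x -> scod y = scod x -> fmap F x ∘ m f = m g ∘ fmap F y;
  law_dm : forall (f : Arrow M) (x : hom (Larr (Rarr f)) (Rarr (Larr f))),
    sdom x = d f -> scod x = m f ->
    d f ∘ m f = m (Larr f) ∘ fmap F x ∘ d (Rarr f) }.

Hypothesis laws : awfs_laws.

Lemma make_comult_comm (f : arrow M) :
  d f ∘ ffL F f = ffL F (Larr f) ∘ idm (adom f).
Proof. by rewrite (law_dL laws) comp_idr. Qed.

Definition make_comult :
  NatTrans (Lfunctor F) (comp_functor (Lfunctor F) (Lfunctor F)).
Proof.
refine (@Build_NatTrans _ _ (Lfunctor F) (comp_functor (Lfunctor F) (Lfunctor F))
  (fun f : arrow M => @mkSquare M (Larr f) (Larr (Larr f)) (idm (adom f)) (d f)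
                        (make_comult_comm f)) _).
move=> f g x; apply: square_ext => /=; first by rewrite comp_idl comp_idr.
by rewrite (law_dnat laws (y := fmap (Lfunctor F) x)).
Defined.

Lemma make_mult_comm (f : arrow M) :
  idm (acod f) ∘ ffR F (Rarr f) = ffR F f ∘ m f.
Proof. by rewrite (law_mR laws) comp_idl. Qed.

Definition make_mult :
  NatTrans (comp_functor (Rfunctor F) (Rfunctor F)) (Rfunctor F).
Proof.
refine (@Build_NatTrans _ _ (comp_functor (Rfunctor F) (Rfunctor F)) (Rfunctor F)
  (fun f : arrow M => @mkSquare M (Rarr (Rarr f)) (Rarr f) (m f) (idm (acod f))
                        (make_mult_comm f)) _).
move=> f g x; apply: square_ext => /=; last by rewrite comp_idl comp_idr.
by rewrite (law_mnat laws (y := fmap (Rfunctor F) x)).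
Defined.

Lemma make_comonad : is_comonad (Lcopoint F) make_comult.
Proof.
split; [|split] => f; apply: square_ext => /=; rewrite ?comp_idl //.
- exact: (law_dR laws).
- exact: (law_dE laws).
- by rewrite (law_dd laws (x := make_comult f)).
Qed.

Lemma make_monad : is_monad (Rpoint F) make_mult.
Proof.
split; [|split] => f; apply: square_ext => /=; rewrite ?comp_idl //.
- exact: (law_mL laws).
- exact: (law_mE laws).
- by rewrite (law_mm laws (x := make_mult f)).
Qed.

Lemma make_lam_comm (f : arrow M) :
  m f ∘ ffL F (Rarr f) = ffR F (Larr f) ∘ d f.
Proof. by rewrite (law_mL laws) (law_dR laws). Qed.

Definition make_lam : NatTrans (comp_functor (Lfunctor F) (Rfunctor F))
  (comp_functor (Rfunctor F) (Lfunctor F)).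
Proof.
refine (@Build_NatTrans _ _ (comp_functor (Lfunctor F) (Rfunctor F))
  (comp_functor (Rfunctor F) (Lfunctor F))
  (fun f : arrow M => @mkSquare M (Larr (Rarr f)) (Rarr (Larr f)) (d f) (m f)
                        (make_lam_comm f)) _).
move=> f g x; apply: square_ext => /=.
  by rewrite (law_dnat laws (y := fmap (Lfunctor F) x)).
by rewrite (law_mnat laws (y := fmap (Rfunctor F) x)).
Defined.

Lemma make_distr : is_distributive_law (Lcopoint F) make_comult (Rpoint F)
  make_mult make_lam.
Proof.
split; [|split; [|split]] => f; apply: square_ext => /=; rewrite ?comp_idl ?comp_idr.
- exact: (law_dE laws).
- exact: (law_mR laws).
- exact: (law_dL laws).
- exact: (law_mE laws).
- by rewrite (law_dd laws (x := make_comult f)).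
- exact: (law_dm laws).
- exact: (law_dm laws).
- by rewrite (law_mm laws (x := make_mult f)).
Qed.

Definition make_awfs : AWFS M.
Proof.
refine (@Build_AWFS M F make_comult make_mult make_comonad make_monad _).
by exists make_lam; split => //; apply: make_distr.
Defined.

End Laws.

(** * Vertical structures with cofree arrows *)

Section Presented.

Variables (M : Category) (V : VerticalStructure M).

Lemma vs_sq_eq (A B A' B' : M) (u : vs_ver V A B) (v : vs_ver V A' B') h k h' k' :
  vs_sq u v h k -> h = h' -> k = k' -> vs_sq u v h' k'.
Proof. by move=> s <- <-. Qed.

(** The factorization of [f] through the cofree vertical arrow over [f], with
    [d] and [m] the maps induced by the universal property from the cofree
    arrow on [f] and from the vertical composite of the cofree arrows on [f]
    and on its right part. *)
Record presented (F : FunctorialFactorization M)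
  (d : forall f : arrow M, hom (F f) (F (mkArrow (ffL F f))))
  (m : forall f : arrow M, hom (F (mkArrow (ffR F f))) (F f)) := {
  cofree : forall f : arrow M, vs_ver V (adom f) (F f);
  cofree_map : forall f, vs_map (cofree f) = ffL F f;
  cofree_ext : forall (f : arrow M) A B (u : vs_ver V A B)
    (h : hom A (adom f)) (k : hom B (acod f)), k ∘ vs_map u = amap f ∘ h ->
    exists k', vs_sq u (cofree f) h k' /\ ffR F f ∘ k' = k;
  cofree_uniq : forall (f : arrow M) A B (u : vs_ver V A B)
    (h : hom A (adom f)) k1 k2,
    vs_sq u (cofree f) h k1 -> vs_sq u (cofree f) h k2 ->
    ffR F f ∘ k1 = ffR F f ∘ k2 -> k1 = k2;
  cofree_nat : forall (f g : Arrow M) (x : hom f g),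
    vs_sq (cofree f) (cofree g) (sdom x) (fmap F x);
  cofree_d : forall f : arrow M,
    vs_sq (cofree f) (cofree (mkArrow (ffL F f))) (idm (adom f)) (d f);
  cofree_dR : forall f, ffR F (mkArrow (ffL F f)) ∘ d f = idm (F f);
  cofree_m : forall f : arrow M,
    vs_sq (vs_comp (cofree (mkArrow (ffR F f))) (cofree f)) (cofree f)
      (idm (adom f)) (m f);
  cofree_mR : forall f, ffR F f ∘ m f = ffR F (mkArrow (ffR F f)) }.

(** The universal property of a cofree arrow speaks of squares into it; this
    condition provides the squares that extend a vertical arrow by an identity,
    which lead into vertical composites. *)
Definition connected : Prop :=
  forall A B (u : vs_ver V A B), vs_sq (vs_id V A) u (idm A) (vs_map u).

Section Cofree.

Variables (E : arrow M -> M) (C : forall f : arrow M, vs_ver V (adom f) (E f))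
  (R : forall f : arrow M, hom (E f) (acod f)).
Hypotheses (RC : forall f, R f ∘ vs_map (C f) = amap f)
  (univ : forall (f : arrow M) A B (u : vs_ver V A B)
    (h : hom A (adom f)) (k : hom B (acod f)), k ∘ vs_map u = amap f ∘ h ->
    exists! k', vs_sq u (C f) h k' /\ R f ∘ k' = k).

Lemma univ_uniq (f : arrow M) A B (u : vs_ver V A B) (h : hom A (adom f)) k1 k2 :
  vs_sq u (C f) h k1 -> vs_sq u (C f) h k2 -> R f ∘ k1 = R f ∘ k2 -> k1 = k2.
Proof.
move=> s1 s2 e.
have c : (R f ∘ k1) ∘ vs_map u = amap f ∘ h.
  by rewrite -comp_assoc (vs_sq_comm s1) comp_assoc RC.
have [k [_ uk]] := univ c.
by rewrite -(uk k1) // -(uk k2).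
Qed.

Section Lift.

Variables (f : arrow M) (A B : M) (u : vs_ver V A B) (h : hom A (adom f))
  (k : hom B (acod f)) (c : k ∘ vs_map u = amap f ∘ h).

Definition univ_lift : hom B (E f) :=
  proj1_sig (constructive_indefinite_description _ (univ c)).

Lemma univ_lift_sq : vs_sq u (C f) h univ_lift.
Proof. by rewrite /univ_lift; case: constructive_indefinite_description => k' [[]]. Qed.

Lemma univ_lift_R : R f ∘ univ_lift = k.
Proof. by rewrite /univ_lift; case: constructive_indefinite_description => k' [[]]. Qed.

End Lift.

Lemma cofree_map_comm (f g : Arrow M) (x : hom f g) :
  (scod x ∘ R f) ∘ vs_map (C f) = amap g ∘ sdom x.
Proof. by rewrite -comp_assoc RC scomm. Qed.

Definition cofree_functor : Functor (Arrow M) M.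
Proof.
refine (@Build_Functor (Arrow M) M E (fun f g x => univ_lift (cofree_map_comm x)) _ _).
- move=> f; apply: univ_uniq (univ_lift_sq _) (vs_sq_hid _) _.
  by rewrite univ_lift_R comp_idl comp_idr.
- move=> f g k y x; apply: univ_uniq (univ_lift_sq _) _ _.
    exact: vs_sq_hcomp (univ_lift_sq _) (univ_lift_sq _).
  by rewrite univ_lift_R comp_assoc univ_lift_R -!comp_assoc univ_lift_R.
Defined.

Definition cofree_ff : FunctorialFactorization M.
Proof.
refine (@Build_FunctorialFactorization M cofree_functor (fun f => vs_map (C f)) R RC _ _).
- by move=> f g x; apply: vs_sq_comm (univ_lift_sq _).
- by move=> f g x; rewrite univ_lift_R.
Defined.

Lemma cofree_comult_comm (f : arrow M) :
  idm (E f) ∘ vs_map (C f) = vs_map (C f) ∘ idm (adom f).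
Proof. by rewrite comp_idl comp_idr. Qed.

Definition cofree_comult (f : arrow M) : hom (E f) (E (mkArrow (vs_map (C f)))) :=
  univ_lift (f := mkArrow (vs_map (C f))) (cofree_comult_comm f).

Lemma cofree_mult_comm (f : arrow M) :
  R (mkArrow (R f)) ∘ vs_map (vs_comp (C (mkArrow (R f))) (C f))
  = amap f ∘ idm (adom f).
Proof. by rewrite vs_map_comp comp_assoc RC /= RC comp_idr. Qed.

Definition cofree_mult (f : arrow M) : hom (E (mkArrow (R f))) (E f) :=
  univ_lift (f := f) (cofree_mult_comm f).

Definition cofree_presented :
  presented (F := cofree_ff) cofree_comult cofree_mult.
Proof.
refine (@Build_presented cofree_ff cofree_comult cofree_mult C _ _ _ _ _ _ _ _).
- by [].
- by move=> f A B u h k c; have [k' [hk _]] := univ c; exists k'.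
- exact: univ_uniq.
- by move=> f g x; apply: univ_lift_sq.
- by move=> f; apply: univ_lift_sq.
- by move=> f; apply: univ_lift_R.
- by move=> f; apply: univ_lift_sq.
- by move=> f; apply: univ_lift_R.
Defined.

End Cofree.

Section Presentation.

Variables (F : FunctorialFactorization M)
  (d : forall f : arrow M, hom (F f) (F (mkArrow (ffL F f))))
  (m : forall f : arrow M, hom (F (mkArrow (ffR F f))) (F f)).
Variable p : presented d m.
Hypothesis conn : connected.

Notation Larr f := (mkArrow (ffL F f) : ob (Arrow M)).
Notation Rarr f := (mkArrow (ffR F f) : ob (Arrow M)).
Notation C := (cofree p).

Lemma cofree_R_nat (f g : Arrow M) (x : hom f g) :
  ffR F g ∘ fmap F x = scod x ∘ ffR F f.
Proof. by rewrite -ffR_nat. Qed.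

Lemma cofree_inner (f : arrow M) :
  vs_sq (C f) (vs_comp (C (Rarr f)) (C f)) (idm (adom f)) (ffL F (Rarr f)).
Proof.
rewrite -{1}(vs_idl (C f)); apply: vs_sq_vcomp (vs_sq_hid _).
by rewrite -(cofree_map p (Rarr f)); apply: conn.
Qed.

(** A square into the cofree arrow on [Rarr f] along [ffL F f] extends to one
    into the composite, and by [m] to one into the cofree arrow on [f]. *)
Lemma cofree_outer (f : arrow M) A B (u : vs_ver V A B)
  (h : hom A (adom f)) (k : hom B (F (Rarr f))) :
  vs_sq u (C (Rarr f)) (ffL F f ∘ h) k -> vs_sq u (C f) h (m f ∘ k).
Proof.
move=> s.
apply: vs_sq_eq (vs_sq_hcomp (cofree_m p f) (h := h) (k := k) _) _ _ => //.
  rewrite -(vs_idr u); apply: vs_sq_vcomp s _.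
  rewrite -(cofree_map p f).
  apply: vs_sq_eq (vs_sq_hcomp (conn (C f)) (vs_sq_vid V h)) _ _ => //.
  exact: comp_idl.
exact: comp_idl.
Qed.

(** Both sides of each law underlie squares from one vertical arrow into one
    cofree arrow, and have the same composite with its right part; so they are
    equal by [cofree_uniq].  For the laws of the multiplication, the source is a
    vertical composite, and associativity is that of vertical composition. *)
Lemma presented_laws : awfs_laws d m.
Proof.
constructor.
- move=> f; have := vs_sq_comm (cofree_d p f).
  by rewrite !cofree_map comp_idr.
- exact: (cofree_dR p).
- move=> f x e1 e2.
  apply: (@cofree_uniq F d m p f _ _ (C f) (idm (adom f)) _ _ _ (vs_sq_hid _)).
    apply: vs_sq_eq (vs_sq_hcomp (cofree_nat p x) (cofree_d p f)) _ _ => //.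
    by rewrite e1 comp_idl.
  by rewrite comp_assoc cofree_R_nat e2 -comp_assoc (cofree_dR p).
- move=> f x e1 e2.
  apply: (@cofree_uniq F d m p (Larr (Larr f)) _ _ (C f) (idm _ ∘ idm _)).
  + exact: vs_sq_hcomp (cofree_d p (Larr f)) (cofree_d p f).
  + by apply: vs_sq_eq (vs_sq_hcomp (cofree_nat p x) (cofree_d p f)) _ _; rewrite ?e1.
  + rewrite !comp_assoc (cofree_dR p) cofree_R_nat e2 -comp_assoc (cofree_dR p f).
    by rewrite comp_idl comp_idr.
- move=> f g x y e1 e2.
  apply: (@cofree_uniq F d m p (Larr g) _ _ (C f) (idm _ ∘ sdom x)).
  + exact: vs_sq_hcomp (cofree_d p g) (cofree_nat p x).
  + apply: vs_sq_eq (vs_sq_hcomp (cofree_nat p y) (cofree_d p f)) _ _ => //.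
    by rewrite e1 comp_idl comp_idr.
  + rewrite !comp_assoc (cofree_dR p) cofree_R_nat e2 -comp_assoc (cofree_dR p f).
    by rewrite comp_idl comp_idr.
- exact: (cofree_mR p).
- move=> f; apply: (@cofree_uniq F d m p f _ _ (C f) (idm (adom f)) _ _ _ (vs_sq_hid _)).
    apply: vs_sq_eq (vs_sq_hcomp (cofree_m p f) (cofree_inner f)) _ _ => //.
    exact: comp_idl.
  by rewrite comp_assoc (cofree_mR p) (ff_fact F (Rarr f)) comp_idr.
- move=> f x e1 e2; apply: (@cofree_uniq F d m p f _ _ (C f) (idm (adom f)) _ _ _ (vs_sq_hid _)).
    apply: cofree_outer; apply: vs_sq_eq (cofree_nat p x) _ _ => //.
    by rewrite e1 comp_idr.
  by rewrite comp_assoc (cofree_mR p) cofree_R_nat e2 comp_idl comp_idr.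
- move=> f x e1 e2.
  apply: (@cofree_uniq F d m p f _ _
    (vs_comp (C (Rarr (Rarr f))) (vs_comp (C (Rarr f)) (C f))) (idm _ ∘ idm _)).
  + rewrite vs_assoc; apply: vs_sq_hcomp (cofree_m p f) _.
    exact: vs_sq_vcomp (cofree_m p (Rarr f)) (vs_sq_hid _).
  + apply: vs_sq_hcomp (cofree_m p f) _; apply: vs_sq_vcomp (cofree_m p f).
    by apply: vs_sq_eq (cofree_nat p x) _ _.
  + rewrite !comp_assoc !(cofree_mR p) cofree_R_nat e2.
    by rewrite comp_idl.
- move=> f g x y e1 e2.
  apply: (@cofree_uniq F d m p g _ _ (vs_comp (C (Rarr f)) (C f)) (sdom x ∘ idm _)).
  + exact: vs_sq_hcomp (cofree_nat p x) (cofree_m p f).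
  + rewrite comp_idr -[sdom x]comp_idl.
    apply: vs_sq_hcomp (cofree_m p g) _; apply: vs_sq_vcomp (cofree_nat p x).
    exact: vs_sq_eq (cofree_nat p y) e1 eq_refl.
  + rewrite !comp_assoc (cofree_mR p) !cofree_R_nat e2 -comp_assoc.
    by rewrite (cofree_mR p).
- move=> f x e1 e2.
  apply: (@cofree_uniq F d m p (Larr f) _ _ (vs_comp (C (Rarr f)) (C f)) (idm _ ∘ idm _)).
  + exact: vs_sq_hcomp (cofree_d p f) (cofree_m p f).
  + rewrite -comp_assoc; apply: vs_sq_hcomp (cofree_m p (Larr f)) _.
    apply: vs_sq_vcomp (cofree_d p f).
    apply: vs_sq_eq (vs_sq_hcomp (cofree_nat p x) (cofree_d p (Rarr f))) _ _ => //.
    by rewrite e1 comp_idr.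
  + rewrite !comp_assoc (cofree_dR p) (cofree_mR p) cofree_R_nat e2 -comp_assoc.
    by rewrite (cofree_dR p (Rarr f)) comp_idl comp_idr.
Qed.

End Presentation.

End Presented.

Arguments Emap {M} F {f g} h k c.

(** ** Isomorphisms of vertical structures *)

Record vs_iso (M : Category) (V V' : VerticalStructure M) := {
  vi_fun :> forall A B, vs_ver V A B -> vs_ver V' A B;
  vi_inv : forall A B, vs_ver V' A B -> vs_ver V A B;
  vi_funK : forall A B (u : vs_ver V A B), vi_inv (vi_fun u) = u;
  vi_invK : forall A B (u : vs_ver V' A B), vi_fun (vi_inv u) = u;
  vi_map : forall A B (u : vs_ver V A B), vs_map (vi_fun u) = vs_map u;
  vi_sq : forall A B A' B' (u : vs_ver V A B) (v : vs_ver V A' B') h k,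
    vs_sq u v h k <-> vs_sq (vi_fun u) (vi_fun v) h k;
  vi_id : forall A, vi_fun (vs_id V A) = vs_id V' A;
  vi_comp : forall A B C (v : vs_ver V B C) (u : vs_ver V A B),
    vi_fun (vs_comp v u) = vs_comp (vi_fun v) (vi_fun u) }.

Arguments vi_inv {M V V'} v [A B] u : rename.

Section VsIso.

Variable M : Category.

Definition vs_iso_sym (V V' : VerticalStructure M) (i : vs_iso V V') : vs_iso V' V.
Proof.
refine (@Build_vs_iso M V' V (vi_inv i) i (vi_invK i) (vi_funK i) _ _ _ _).
- by move=> A B u; rewrite -{2}(vi_invK i u) vi_map.
- by move=> A B A' B' u v h k; rewrite (vi_sq i) !vi_invK.
- by move=> A; rewrite -(vi_id i) vi_funK.
- by move=> A B C v u; rewrite -{1}(vi_invK i v) -{1}(vi_invK i u) -vi_comp vi_funK.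
Defined.

Definition vs_iso_trans (V V' V'' : VerticalStructure M) (i : vs_iso V V')
  (j : vs_iso V' V'') : vs_iso V V''.
Proof.
refine (@Build_vs_iso M V V'' (fun A B u => j A B (i A B u))
          (fun A B u => vi_inv i (vi_inv j u)) _ _ _ _ _ _).
- by move=> A B u; rewrite !vi_funK.
- by move=> A B u; rewrite !vi_invK.
- by move=> A B u; rewrite !vi_map.
- by move=> A B A' B' u v h k; rewrite (vi_sq i) (vi_sq j).
- by move=> A; rewrite !vi_id.
- by move=> A B C v u; rewrite !vi_comp.
Defined.

Lemma vs_iso_intro (V V' : VerticalStructure M)
  (phi : forall A B, vs_ver V A B -> vs_ver V' A B) :
  (forall A B (u v : vs_ver V A B), phi A B u = phi A B v -> u = v) ->
  (forall A B (u : vs_ver V' A B), exists v, phi A B v = u) ->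
  (forall A B (u : vs_ver V A B), vs_map (phi A B u) = vs_map u) ->
  (forall A B A' B' (u : vs_ver V A B) (v : vs_ver V A' B') h k,
    vs_sq u v h k <-> vs_sq (phi A B u) (phi A' B' v) h k) ->
  (forall A, phi A A (vs_id V A) = vs_id V' A) ->
  (forall A B C (v : vs_ver V B C) (u : vs_ver V A B),
    phi A C (vs_comp v u) = vs_comp (phi B C v) (phi A B u)) ->
  inhabited (vs_iso V V').
Proof.
move=> inj surj h1 h2 h3 h4.
have [g hg] : exists g : forall x : {A : M & {B : M & vs_ver V' A B}},
    vs_ver V (projT1 x) (projT1 (projT2 x)),
    forall x, phi _ _ (g x) = projT2 (projT2 x).
  apply: (@dchoice {A : M & {B : M & vs_ver V' A B}}
    (fun x => vs_ver V (projT1 x) (projT1 (projT2 x)))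
    (fun x v => phi _ _ v = projT2 (projT2 x))).
  by move=> [A [B u]]; apply: surj.
constructor.
refine (@Build_vs_iso M V V' phi (fun A B u => g (existT _ A (existT _ B u))) _ _ h1 h2 h3 h4).
  by move=> A B u; apply: inj; apply: (hg (existT _ A (existT _ B (phi A B u)))).
by move=> A B u; apply: (hg (existT _ A (existT _ B u))).
Qed.

End VsIso.

(** ** Coalgebras of the presented system *)

Lemma clL_eq (M : Category) (F : FunctorialFactorization M) (A B : M)
  (u v : ClovenL F A B) :
  clL_map u = clL_map v -> clL_square u v (idm A) (idm B) -> u = v.
Proof.
case: u => f s s1 s2; case: v => f' s' s1' s2' /= e; subst f' => -[c /= e].
rewrite (@Emap_id _ _ (mkArrow f)) comp_idl comp_idr in e; subst s'.
by rewrite (proof_irrelevance _ s1 s1') (proof_irrelevance _ s2 s2').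
Qed.

Section Comonadic.

Variables (M : Category) (V : VerticalStructure M) (F : FunctorialFactorization M)
  (d : forall f : arrow M, hom (F f) (F (mkArrow (ffL F f))))
  (m : forall f : arrow M, hom (F (mkArrow (ffR F f))) (F f)).
Variable p : presented V d m.
Hypothesis conn : connected V.

Notation Larr f := (mkArrow (ffL F f) : ob (Arrow M)).
Notation Rarr f := (mkArrow (ffR F f) : ob (Arrow M)).
Notation C := (cofree p).

(** Vertical arrows are the coalgebras for the comonad of cofree arrows; [t]
    below is the coalgebra structure that corresponds to [u]. *)
Record comonadic : Prop := {
  cm_create : forall (A B : M) (f : hom A B) (t : hom B (F (mkArrow f))),
    t ∘ f = ffL F (mkArrow f) -> ffR F (mkArrow f) ∘ t = idm B ->
    (forall x : @hom (Arrow M) (mkArrow f) (Larr (mkArrow f)),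
      sdom x = idm A -> scod x = t -> d (mkArrow f) ∘ t = fmap F x ∘ t) ->
    exists u : vs_ver V A B, vs_map u = f /\ vs_sq u (C (mkArrow f)) (idm A) t;
  cm_amnestic : forall A B (u v : vs_ver V A B),
    vs_map u = vs_map v -> vs_sq u v (idm A) (idm B) -> u = v;
  cm_full : forall A B A' B' (u : vs_ver V A B) (v : vs_ver V A' B')
    (t : hom B (F (mkArrow (vs_map u)))) (t' : hom B' (F (mkArrow (vs_map v))))
    (x : @hom (Arrow M) (mkArrow (vs_map u)) (mkArrow (vs_map v))),
    vs_sq u (C (mkArrow (vs_map u))) (idm A) t ->
    ffR F (mkArrow (vs_map u)) ∘ t = idm B ->
    vs_sq v (C (mkArrow (vs_map v))) (idm A') t' ->
    ffR F (mkArrow (vs_map v)) ∘ t' = idm B' ->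
    fmap F x ∘ t = t' ∘ scod x -> vs_sq u v (sdom x) (scod x) }.

Hypothesis cm : comonadic.

Let W : AWFS M := make_awfs (presented_laws p conn).

Section Structure.

Variables (A B : M) (u : vs_ver V A B).

Notation f := (mkArrow (vs_map u) : ob (Arrow M)).

Lemma structure_comm : idm B ∘ vs_map u = vs_map u ∘ idm A.
Proof. by rewrite comp_idl comp_idr. Qed.

Definition vstr : hom B (F f) :=
  proj1_sig (constructive_indefinite_description _
    (cofree_ext p (f := f) structure_comm)).

Lemma vstr_sq : vs_sq u (C f) (idm A) vstr.
Proof. by rewrite /vstr; case: constructive_indefinite_description => k' []. Qed.

Lemma vstr_R : ffR F f ∘ vstr = idm B.
Proof. by rewrite /vstr; case: constructive_indefinite_description => k' []. Qed.

Lemma vstr_L : vstr ∘ vs_map u = ffL F f.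
Proof. by rewrite (vs_sq_comm vstr_sq) cofree_map comp_idr. Qed.

Lemma vstr_unique (g : arrow M) (x : @hom (Arrow M) f g) (t : hom B (F g)) :
  vs_sq u (C g) (sdom x) t -> ffR F g ∘ t = scod x -> fmap F x ∘ vstr = t.
Proof.
move=> s e; apply: (@cofree_uniq _ _ _ _ _ p g _ _ u (sdom x)) => //.
  apply: vs_sq_eq (vs_sq_hcomp (cofree_nat p x) vstr_sq) _ _ => //.
  exact: comp_idr.
by rewrite comp_assoc cofree_R_nat -comp_assoc vstr_R comp_idr e.
Qed.

Lemma vstr_square (g : arrow M) (x : @hom (Arrow M) f g) :
  vs_sq u (C g) (sdom x) (fmap F x ∘ vstr).
Proof.
apply: vs_sq_eq (vs_sq_hcomp (cofree_nat p x) vstr_sq) _ _ => //.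
exact: comp_idr.
Qed.

Definition to_cloven : ClovenL W A B :=
  @Build_ClovenL M W A B (vs_map u) vstr vstr_L vstr_R.

Lemma to_cloven_coalgebra : is_coalgebra to_cloven.
Proof.
rewrite /is_coalgebra; symmetry; apply: vstr_unique => /=.
  apply: vs_sq_eq (vs_sq_hcomp (cofree_d p f) vstr_sq) _ _ => //.
  exact: comp_idl.
by rewrite comp_assoc (cofree_dR p f) comp_idl.
Qed.

Definition to_coalgebra : Coalgebra W A B := Build_Coalgebra to_cloven_coalgebra.

End Structure.

Lemma to_coalgebra_eq (A B : M) (u : vs_ver V A B) (c : Coalgebra W A B) :
  vs_map u = clL_map c ->
  vs_sq u (C (mkArrow (clL_map c))) (idm A) (clL_str c) -> to_coalgebra u = c.
Proof.
move=> e s; apply: coalgebra_ext; apply: clL_eq => //.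
have x : idm B ∘ vs_map u = clL_map c ∘ idm A by rewrite comp_idl comp_idr.
exists x => /=; rewrite comp_idr.
apply: (@vstr_unique A B u (mkArrow (clL_map c))) => //.
exact: (clL_cod c).
Qed.

Lemma to_coalgebra_square (A B A' B' : M) (u : vs_ver V A B) (v : vs_ver V A' B') h k :
  vs_sq u v h k <-> clL_square (to_coalgebra u) (to_coalgebra v) h k.
Proof.
split=> [s|[c e]].
  exists (vs_sq_comm s); apply: vstr_unique => /=.
    apply: vs_sq_eq (vs_sq_hcomp (vstr_sq v) s) _ _ => //.
    exact: comp_idl.
  by rewrite comp_assoc vstr_R comp_idl.
exact: (cm_full cm (vstr_sq u) (vstr_R u) (vstr_sq v) (vstr_R v) e).
Qed.

(** The coalgebra structure of [u] is the square from [u] to the cofree arrow on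
    its underlying map.  The composite of coalgebras is defined by two fillers
    through the multiplication, and [cofree_m] recognizes these as squares out
    of the vertical composite. *)
Theorem coalgebras_of_presented : inhabited (vs_iso (Coalg_structure W) V).
Proof.
suff [i] : inhabited (vs_iso V (Coalg_structure W)) by constructor; apply: vs_iso_sym.
apply: (@vs_iso_intro M V (Coalg_structure W) to_coalgebra).
- move=> A B u v e; apply: (cm_amnestic cm).
    exact: (f_equal (fun c : Coalgebra W A B => clL_map c) e).
  by rewrite to_coalgebra_square e; apply: clL_square_id.
- move=> A B c.
  have [|u [e s]] := cm_create cm (clL_dom c) (clL_cod c).
    move=> x e1 e2; rewrite (coalg_law c).
    by congr (fmap _ _ ∘ _); apply: square_ext.
  by exists u; apply: to_coalgebra_eq.
- by [].
- exact: to_coalgebra_square.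
- move=> A; apply: to_coalgebra_eq; first exact: vs_map_id.
  have := conn (C (mkArrow (idm A))); rewrite cofree_map => s.
  exact: s.
- move=> X Y Z v u; apply: to_coalgebra_eq; first exact: vs_map_comp.
  rewrite /= /filler /=.
  set g := mkArrow (vs_map v ∘ vs_map u).
  set w := compL_aux _ _.
  have sw : vs_sq u (C g) (idm X) w.
    rewrite /w /compL_aux /filler -comp_assoc.
    apply: (@cofree_outer M V F d m p conn g _ _ u (idm X)).
    rewrite comp_idr.
    exact: (@vstr_square _ _ u (Rarr g) (@mkSquare M (mkArrow (vs_map u)) (Rarr g)
      _ _ (compL_comm (to_cloven v) (to_cloven u)))).
  rewrite -comp_assoc.
  have sv := @vstr_square _ _ v (Rarr g) (@mkSquare M (mkArrow (vs_map v)) (Rarr g)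
    _ _ (compL_aux_comm (to_cloven v) (to_cloven u))).
  apply: vs_sq_eq (vs_sq_hcomp (cofree_m p g) (vs_sq_vcomp sv sw)) _ _ => //.
  exact: comp_idl.
Qed.

End Comonadic.

(** ** Comparison of presentations *)

Section Comparison.

Variables (M : Category).

Section Morphism.

Variables (F F' : FunctorialFactorization M)
  (d : forall f : arrow M, hom (F f) (F (mkArrow (ffL F f))))
  (m : forall f : arrow M, hom (F (mkArrow (ffR F f))) (F f))
  (d' : forall f : arrow M, hom (F' f) (F' (mkArrow (ffL F' f))))
  (m' : forall f : arrow M, hom (F' (mkArrow (ffR F' f))) (F' f)).

Record awfs_map (t : forall f : arrow M, hom (F f) (F' f)) : Prop := {
  am_nat : forall (f g : Arrow M) (x : hom f g), t g ∘ fmap F x = fmap F' x ∘ t f;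
  am_L : forall f, t f ∘ ffL F f = ffL F' f;
  am_R : forall f, ffR F' f ∘ t f = ffR F f;
  am_d : forall (f : arrow M)
    (x : @hom (Arrow M) (mkArrow (ffL F f)) (mkArrow (ffL F' f))),
    sdom x = idm _ -> scod x = t f ->
    d' f ∘ t f = fmap F' x ∘ (t (mkArrow (ffL F f)) ∘ d f);
  am_m : forall (f : arrow M)
    (x : @hom (Arrow M) (mkArrow (ffR F f)) (mkArrow (ffR F' f))),
    sdom x = t f -> scod x = idm _ ->
    t f ∘ m f = m' f ∘ (fmap F' x ∘ t (mkArrow (ffR F f))) }.

End Morphism.

Section Map.

Variables (V V' : VerticalStructure M) (i : vs_iso V V').
Variables (F F' : FunctorialFactorization M)
  (d : forall f : arrow M, hom (F f) (F (mkArrow (ffL F f))))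
  (m : forall f : arrow M, hom (F (mkArrow (ffR F f))) (F f))
  (d' : forall f : arrow M, hom (F' f) (F' (mkArrow (ffL F' f))))
  (m' : forall f : arrow M, hom (F' (mkArrow (ffR F' f))) (F' f))
  (p : presented V d m) (p' : presented V' d' m').

Notation C f := (i _ _ (cofree p f)).
Notation C' f := (cofree p' f).

Lemma compare_cofree : exists t : forall f : arrow M, hom (F f) (F' f),
  forall f, vs_sq (C f) (C' f) (idm (adom f)) (t f) /\ ffR F' f ∘ t f = ffR F f.
Proof.
apply: (@dchoice (arrow M) (fun f => hom (F f) (F' f))
  (fun f t => vs_sq (C f) (C' f) (idm (adom f)) t /\ ffR F' f ∘ t = ffR F f)) => f.
apply: (cofree_ext p' (f := f)).
by rewrite vi_map cofree_map ff_fact comp_idr.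
Qed.

Variable t : forall f : arrow M, hom (F f) (F' f).
Hypothesis (ts : forall f, vs_sq (C f) (C' f) (idm (adom f)) (t f))
  (tR : forall f, ffR F' f ∘ t f = ffR F f).

Lemma compare_map : awfs_map d m d' m' t.
Proof.
have isq A B A' B' (u : vs_ver V A B) (v : vs_ver V A' B') h k :
  vs_sq u v h k -> vs_sq (i _ _ u) (i _ _ v) h k by move=> /(vi_sq i).
constructor=> //.
- move=> f g x.
  apply: (@cofree_uniq _ _ _ _ _ p' g _ _ (C f) (sdom x)).
  + apply: vs_sq_eq (vs_sq_hcomp (ts g) (isq _ _ _ _ _ _ _ _ (cofree_nat p x))) _ _ => //.
    exact: comp_idl.
  + apply: vs_sq_eq (vs_sq_hcomp (cofree_nat p' x) (ts f)) _ _ => //.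
    exact: comp_idr.
  + by rewrite !comp_assoc tR !cofree_R_nat -comp_assoc tR.
- move=> f; have := vs_sq_comm (ts f).
  by rewrite vi_map !cofree_map comp_idr.
- move=> f x e1 e2.
  apply: (@cofree_uniq _ _ _ _ _ p' (mkArrow (ffL F' f)) _ _ (C f) (idm _ ∘ idm _)).
  + exact: vs_sq_hcomp (cofree_d p' f) (ts f).
  + apply: vs_sq_eq (vs_sq_hcomp (cofree_nat p' x) (vs_sq_hcomp
      (ts (mkArrow (ffL F f))) (isq _ _ _ _ _ _ _ _ (cofree_d p f)))) _ _ => //.
    by rewrite e1 /= !comp_idl.
  + rewrite !comp_assoc (cofree_dR p') cofree_R_nat e2 -!comp_assoc.
    by rewrite (comp_assoc (ffR F' _)) tR (cofree_dR p) comp_idl comp_idr.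
- move=> f x e1 e2.
  apply: (@cofree_uniq _ _ _ _ _ p' f _ _
    (i _ _ (vs_comp (cofree p (mkArrow (ffR F f))) (cofree p f))) (idm _ ∘ idm _)).
  + exact: vs_sq_hcomp (ts f) (isq _ _ _ _ _ _ _ _ (cofree_m p f)).
  + rewrite vi_comp; apply: vs_sq_hcomp (cofree_m p' f) _.
    apply: vs_sq_vcomp (ts f).
    apply: vs_sq_eq (vs_sq_hcomp (cofree_nat p' x) (ts (mkArrow (ffR F f)))) _ _ => //.
    by rewrite e1 comp_idr.
  + rewrite !comp_assoc tR (cofree_mR p) (cofree_mR p') cofree_R_nat e2 -comp_assoc tR.
    by rewrite comp_idl.
Qed.

End Map.

(** Cofree arrows are unique up to a unique isomorphism.  It respects the
    comultiplications because they are induced by universal properties, and the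
    multiplications because [i] preserves vertical composition. *)
Theorem compare_presented (V V' : VerticalStructure M) (i : vs_iso V V')
  (F F' : FunctorialFactorization M) d m d' m'
  (p : presented V (F := F) d m) (p' : presented V' (F := F') d' m') :
  exists t, awfs_map d m d' m' t /\ forall f, invertible (t f).
Proof.
have [t ht] := compare_cofree i p p'.
have [t' ht'] := compare_cofree (vs_iso_sym i) p' p.
exists t; split.
  by apply: (compare_map (i := i) (p := p) (p' := p')) => f; case: (ht f).
move=> f; exists (t' f); split.
- apply: (@cofree_uniq _ _ _ _ _ p f _ _ (cofree p f) (idm _)).
  + rewrite -{1}(vi_funK i (cofree p f)).
    apply: vs_sq_eq (vs_sq_hcomp (proj1 (ht' f)) _) (comp_idl _) eq_refl.
    by apply/(vi_sq i); rewrite !vi_invK; apply: (proj1 (ht f)).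
  + exact: vs_sq_hid.
  + by rewrite comp_assoc (proj2 (ht' f)) (proj2 (ht f)) comp_idr.
- apply: (@cofree_uniq _ _ _ _ _ p' f _ _ (cofree p' f) (idm _)).
  + rewrite -{1}(vi_invK i (cofree p' f)).
    apply: vs_sq_eq (vs_sq_hcomp (proj1 (ht f)) _) (comp_idl _) eq_refl.
    exact: (proj1 (vi_sq i _ _ _ _) (proj1 (ht' f))).
  + exact: vs_sq_hid.
  + by rewrite comp_assoc (proj2 (ht f)) (proj2 (ht' f)) comp_idr.
Qed.

End Comparison.

(** ** Isomorphisms of double categories over commutative squares *)

Section DoubleIso.

Variable M : Category.

Lemma vs_double_functor_ext (V V' : VerticalStructure M) (o : M -> M)
  (fm : forall A B, hom A B -> hom (o A) (o B)) p p' q q'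
  (v v' : forall A B, vs_ver V A B -> vs_ver V' (o A) (o B)) s s'
  a1 a2 a3 a4 a5 a6 a7 a8 b1 b2 b3 b4 b5 b6 b7 b8 : v = v' ->
  @Build_DoubleFunctor (vs_double V) (vs_double V') (@Build_Functor M M o fm p q)
    v s a1 a2 a3 a4 a5 a6 a7 a8
  = @Build_DoubleFunctor (vs_double V) (vs_double V') (@Build_Functor M M o fm p' q')
      v' s' b1 b2 b3 b4 b5 b6 b7 b8.
Proof.
move=> e; subst v'.
move: a1 a2 a3 a4 a5 a6 a7 a8; rewrite (proof_irrelevance _ p p') (proof_irrelevance _ q q').
move=> a1 a2 a3 a4 a5 a6 a7 a8.
have e : s = s'.
  do 6 (apply: functional_extensionality_dep => ?); apply: functional_extensionality => x.
  by apply: vs_cell_ext; [rewrite [LHS]a1 [RHS]b1|rewrite [LHS]a2 [RHS]b2].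
subst s'; f_equal; exact: proof_irrelevance.
Qed.

Definition double_functor_of_iso (V V' : VerticalStructure M) (i : vs_iso V V') :
  DoubleFunctor (vs_double V) (vs_double V').
Proof.
refine (@Build_DoubleFunctor (vs_double V) (vs_double V') (id_functor M)
  (fun A B u => i A B u)
  (fun A B A' B' u v x =>
     @Build_vs_cell M V' A B A' B' (i _ _ u) (i _ _ v) (cell_top x) (cell_bot x)
       (proj1 (vi_sq i u v _ _) (cell_sq x)))
  _ _ _ _ _ _ _ _) => //=.
- by move=> *; apply: vs_cell_ext.
- by move=> *; apply: vs_cell_ext.
- by move=> *; apply: vi_id.
- by move=> *; apply: vi_comp.
- by move=> *; apply: vs_cell_eq_over => //; apply: vi_id.
- by move=> *; apply: vs_cell_eq_over => //; apply: vi_comp.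
Defined.

Lemma double_iso_of_vs_iso (V V' : VerticalStructure M) :
  vs_iso V V' -> double_iso_over (vs_over V) (vs_over V').
Proof.
move=> i; exists (double_functor_of_iso i), (double_functor_of_iso (vs_iso_sym i)).
split; [|split]; apply: vs_double_functor_ext;
  do 2 (apply: functional_extensionality_dep => ?); apply: functional_extensionality => u.
- exact: (vi_funK i).
- exact: (vi_invK i).
- exact: (vi_map i).
Qed.

(** Over the double category of squares, an isomorphism is the identity on
    objects and horizontal arrows, and squares are determined by these; only
    the action on vertical arrows remains.  The proof first turns the equality
    of functors into one of components, so that the object map can be replaced
    by the identity in all types. *)
Lemma vs_iso_of_double_iso (V V' : VerticalStructure M) :
  double_iso_over (vs_over V) (vs_over V') -> inhabited (vs_iso V V').
Proof.
move=> [[[o fm p q] v s a1 a2 a3 a4 a5 a6 a7 a8]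
        [[[o' fm' p' q'] v' s' b1 b2 b3 b4 b5 b6 b7 b8] [GF [FG PF]]]].
have eo := f_equal (fun K : DoubleFunctor (vs_double V) (Sq M) => fob (dfun K)) PF.
change (o = fun A => A) in eo; subst o.
have eo' := f_equal (fun K : DoubleFunctor (vs_double V) (vs_double V) => fob (dfun K)) GF.
change (o' = fun A => A) in eo'; subst o'.
have efm := inj_pair2 _ _ _ _ _ (f_equal (fun K : DoubleFunctor (vs_double V) (Sq M) =>
  existT (fun o : M -> M => forall A B, hom A B -> hom (o A) (o B))
    (fob (dfun K)) (fun A B => @fmap _ _ (dfun K) A B)) PF).
change (fm = fun A B f => f) in efm; subst fm.
have efm' := inj_pair2 _ _ _ _ _ (f_equal
  (fun K : DoubleFunctor (vs_double V) (vs_double V) =>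
  existT (fun o : M -> M => forall A B, hom A B -> hom (o A) (o B))
    (fob (dfun K)) (fun A B => @fmap _ _ (dfun K) A B)) GF).
change (fm' = fun A B f => f) in efm'; subst fm'.
have vmap := inj_pair2 _ _ _ _ _ (f_equal (fun K : DoubleFunctor (vs_double V) (Sq M) =>
  existT (fun o : M -> M => forall A B, vs_ver V A B -> hom (o A) (o B))
    (fob (dfun K)) (fun A B u => dver K u)) PF).
have v'v := inj_pair2 _ _ _ _ _ (f_equal
  (fun K : DoubleFunctor (vs_double V) (vs_double V) =>
  existT (fun o : M -> M => forall A B, vs_ver V A B -> vs_ver V (o A) (o B))
    (fob (dfun K)) (fun A B u => dver K u)) GF).
have vv' := inj_pair2 _ _ _ _ _ (f_equal
  (fun K : DoubleFunctor (vs_double V') (vs_double V') =>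
  existT (fun o : M -> M => forall A B, vs_ver V' A B -> vs_ver V' (o A) (o B))
    (fob (dfun K)) (fun A B u => dver K u)) FG).
have {}vmap A B u : vs_map (v A B u) = vs_map u.
  exact: (f_equal (fun w : forall A B, vs_ver V A B -> hom A B => w A B u) vmap).
have {}v'v A B u : v' A B (v A B u) = u.
  exact: (f_equal (fun w : forall A B, vs_ver V A B -> vs_ver V A B => w A B u) v'v).
have {}vv' A B u : v A B (v' A B u) = u.
  exact: (f_equal (fun w : forall A B, vs_ver V' A B -> vs_ver V' A B => w A B u) vv').
have vsq A B A' B' (x : vs_ver V A B) (y : vs_ver V A' B') h k :
    vs_sq x y h k -> vs_sq (v _ _ x) (v _ _ y) h k.
  move=> sq; have := cell_sq (s _ _ _ _ _ _ (Build_vs_cell sq)).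
  have e1 := a1 _ _ _ _ _ _ (Build_vs_cell sq).
  have e2 := a2 _ _ _ _ _ _ (Build_vs_cell sq).
  by rewrite /= in e1 e2; rewrite e1 e2.
have vsq' A B A' B' (x : vs_ver V' A B) (y : vs_ver V' A' B') h k :
    vs_sq x y h k -> vs_sq (v' _ _ x) (v' _ _ y) h k.
  move=> sq; have := cell_sq (s' _ _ _ _ _ _ (Build_vs_cell sq)).
  have e1 := b1 _ _ _ _ _ _ (Build_vs_cell sq).
  have e2 := b2 _ _ _ _ _ _ (Build_vs_cell sq).
  by rewrite /= in e1 e2; rewrite e1 e2.
constructor; refine (@Build_vs_iso M V V' v v' v'v vv' vmap _ a5 a6).
move=> A B A' B' x y h k; split; first exact: vsq.
by move=> /vsq'; rewrite !v'v.
Qed.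

End DoubleIso.

(** ** An algebraic weak factorization system presents its coalgebras *)

Section Coalgebras.

Variables (M : Category) (W : AWFS M).

Notation Larr f := (mkArrow (ffL W f) : ob (Arrow M)).
Notation Rarr f := (mkArrow (ffR W f) : ob (Arrow M)).

(** A map into the cofree coalgebra is recovered from its composite with the
    right part, by the second counit law. *)
Lemma cofreeL_uniq (f : arrow M) A B (u : ClovenL W A B) (h : hom A (adom f))
  (k : hom B (W f)) :
  clL_square u (cofreeL W f) h k ->
  forall x : @hom (Arrow M) (mkArrow (clL_map u)) f, sdom x = h ->
    scod x = ffR W f ∘ k -> k = fmap W x ∘ clL_str u.
Proof.
move=> [c e] x e1 e2.
have cR : ffR W f ∘ ffL W f = amap f ∘ idm (adom f) by rewrite ff_fact comp_idr.
rewrite -[LHS]comp_idl -(delta_E cR) -comp_assoc -[delta W f]/(clL_str (cofreeL W f)).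
rewrite -e comp_assoc Emap_comp; congr (_ ∘ _); rewrite /Emap; congr fmap.
by apply: square_ext; rewrite /= ?comp_idl.
Qed.

(** Both sides of the equation fill the square from the composite of the two
    cofree coalgebras to the free algebra on [ffL W f], and the filler is
    computed by the distributive law. *)
Lemma mu_square (f : arrow M) :
  clL_square (compL (cofreeL W (Rarr f)) (cofreeL W f)) (cofreeL W f)
    (idm (adom f)) (mu W f).
Proof.
have c : mu W f ∘ (ffL W (Rarr f) ∘ ffL W f) = ffL W f ∘ idm (adom f).
  by rewrite comp_assoc mu_L comp_idl comp_idr.
exists c => /=.
set g := mkArrow (ffL W (Rarr f) ∘ ffL W f).
have sq := @freeR_square M W g (Larr f) (idm (adom f)) (mu W f) c.
set P := Emap _ _ _ _ in sq *.
have eaux : P ∘ compL_aux (cofreeL W (Rarr f)) (cofreeL W f) = delta W f.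
  have c1 : mu W f ∘ cofreeL W (Rarr f) ∘ cofreeL W f
            = freeR W (Larr f) ∘ (P ∘ ffL W g).
    rewrite /P Emap_L comp_assoc /= (ff_fact W (Larr f)) comp_idr.
    by rewrite mu_L comp_idl.
  rewrite /compL_aux (filler_post _ c1 sq).
  have c2 : idm (W f) ∘ cofreeL W f = freeR W (Larr f) ∘ ffL W (Larr f).
    by rewrite /= (ff_fact W (Larr f)) comp_idl.
  have e1 : P ∘ ffL W g = ffL W (Larr f).
    have e := @Emap_L M W _ _ _ _ (amap g) (ffL W f) (idm (adom f)) (mu W f) c.
    by rewrite comp_idr in e.
  have e2 : mu W f ∘ cofreeL W (Rarr f) = idm (W f) by exact: mu_L.
  rewrite (filler_eq c1 c2 e1 e2).
  exact: eq_trans (f_equal (fun z => z ∘ delta W f) (@mu_E M W (Larr f) c2)) (comp_idl _).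
have c3 : mu W f ∘ idm (W (Rarr f)) ∘ cofreeL W (Rarr f)
          = freeR W (Larr f) ∘ (P ∘ compL_aux (cofreeL W (Rarr f)) (cofreeL W f)).
  by rewrite eaux /= comp_idr mu_L delta_R.
rewrite (filler_post _ c3 sq).
have c4 : mu W f ∘ ffL W (Rarr f) = ffR W (Larr f) ∘ delta W f by rewrite mu_L delta_R.
rewrite (delta_mu c4) /filler /=; congr (_ ∘ _ ∘ _).
by apply: Emap_eq; rewrite ?eaux ?comp_idr.
Qed.

Definition coalgebras_presented : presented (Coalg_structure W) (delta W) (mu W).
Proof.
refine (@Build_presented M (Coalg_structure W) W (delta W) (mu W)
  (fun f => Build_Coalgebra (@cofreeL_coalgebra M W f)) _ _ _ _ _ _ _ _).
- by [].
- move=> f A B u h k c.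
  exists (Emap W (f := mkArrow (clL_map u)) h k c ∘ clL_str u); split.
    exact: coalgebra_extension (coalg_law u).
  by rewrite comp_assoc Emap_R -comp_assoc clL_cod comp_idr.
- move=> f A B u h k1 k2 s1 s2 e; case: (s1) => c _.
  have c1 : (ffR W f ∘ k1) ∘ clL_map u = amap f ∘ h.
    by rewrite -comp_assoc c comp_assoc /= ff_fact.
  pose x : @hom (Arrow M) (mkArrow (clL_map u)) f := @mkSquare M (mkArrow (clL_map u)) f _ _ c1.
  by rewrite (cofreeL_uniq s1 (x := x)) // (cofreeL_uniq s2 (x := x)).
- by move=> f g x; apply: (@cofreeL_square M W f g (sdom x) (scod x) (scomm x)).
- move=> f; exists (coalg_comm (cofreeL W f)).
  by rewrite -[RHS]/(delta W (Larr f) ∘ delta W f) cofreeL_coalgebra.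
- exact: delta_R.
- exact: mu_square.
- exact: mu_R.
Defined.

End Coalgebras.

Section MorphismOfMap.

Variables (M : Category) (W W' : AWFS M) (t : forall f : arrow M, hom (W f) (W' f)).
Hypothesis a : awfs_map (delta W) (mu W) (delta W') (mu W') t.

Let t_nat : NatTrans (ffE W) (ffE W') := @Build_NatTrans _ _ (ffE W) (ffE W') t (am_nat a).

Lemma map_L (f : arrow M) : t_nat f ∘ ffL W f = ffL W' f ∘ idm (adom f).
Proof. by rewrite comp_idr; apply: (am_L a). Qed.

Lemma map_R (f : arrow M) : idm (acod f) ∘ ffR W f = ffR W' f ∘ t_nat f.
Proof. by rewrite comp_idl; symmetry; apply: (am_R a). Qed.

Definition awfs_morphism_of_map : AWFSMorphism W W'.
Proof.
refine (@Build_AWFSMorphism M W W' t_nat map_L map_R _ _).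
- by move=> f; apply: (am_d a).
- by move=> f; apply: (am_m a).
Defined.

End MorphismOfMap.

(** ** Cloven left maps *)

(** The double category is kept apart from the factorization so that, in the
    opposite category, the same argument applies to cloven right maps. *)
Record cloven_left (M : Category) (V : VerticalStructure M)
  (F : FunctorialFactorization M) := {
  cl_fun :> forall A B, vs_ver V A B -> ClovenL F A B;
  cl_inv : forall A B, ClovenL F A B -> vs_ver V A B;
  cl_funK : forall A B (u : vs_ver V A B), cl_inv (cl_fun u) = u;
  cl_invK : forall A B (u : ClovenL F A B), cl_fun (cl_inv u) = u;
  cl_map : forall A B (u : vs_ver V A B), clL_map (cl_fun u) = vs_map u;
  cl_sq : forall A B A' B' (u : vs_ver V A B) (v : vs_ver V A' B') h k,
    vs_sq u v h k <-> clL_square (cl_fun u) (cl_fun v) h k;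
  cl_id : forall A, cl_fun (vs_id V A) = idL F A }.

Arguments cl_inv {M V F} c [A B] u : rename.
Arguments cl_fun {M V F} c [A B] u : rename.

Definition clovenL_left (M : Category) (W : AWFS M) : cloven_left (ClovL_structure W) W.
Proof. by refine (@Build_cloven_left M (ClovL_structure W) W _ (fun A B u => u) _ _ _ _ _). Defined.

Section Left.

Variables (M : Category) (W : FunctorialFactorization M) (V : VerticalStructure M)
  (cl : cloven_left V W).

Lemma cl_inv_map (A B : M) (u : ClovenL W A B) : vs_map (cl_inv cl u) = clL_map u.
Proof. by rewrite -(cl_map cl) cl_invK. Qed.

Lemma cloven_connected : connected V.
Proof.
move=> A B u; apply/(cl_sq cl); rewrite cl_id -(cl_map cl).
have c : clL_map (cl A B u) ∘ idm A = clL_map (cl A B u) ∘ idm A by [].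
by exists c; rewrite /= Emap_L comp_idr clL_dom.
Qed.

Variables (F : FunctorialFactorization M)
  (d : forall f : arrow M, hom (F f) (F (mkArrow (ffL F f))))
  (m : forall f : arrow M, hom (F (mkArrow (ffR F f))) (F f)).
Variable p : presented V (F := F) d m.

Notation Larr f := (mkArrow (ffL F f) : ob (Arrow M)).
Notation C f := (cl _ _ (cofree p f)).

Lemma cofree_cl_map f : clL_map (C f) = ffL F f.
Proof. by rewrite cl_map cofree_map. Qed.

(** The structure of the cofree arrow on [f], followed by its counit, compares
    the two factorizations; by the last clause, this comparison recovers the
    structure of a cloven left map from the map that it induces into the cofree
    arrow. *)
Lemma cofree_to_copointed : exists t : forall f : arrow M, hom (F f) (W f),
  (forall f, t f ∘ ffL F f = ffL W f) /\ (forall f, ffR W f ∘ t f = ffR F f) /\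
  (forall f g (x : @hom (Arrow M) f g), t g ∘ fmap F x = fmap W x ∘ t f) /\
  (forall (f : arrow M) A B (u : ClovenL W A B) (h : hom A (adom f)) k
    (x : @hom (Arrow M) (mkArrow (clL_map u)) f),
    clL_square u (C f) h k -> sdom x = h -> scod x = ffR F f ∘ k ->
    t f ∘ k = fmap W x ∘ clL_str u).
Proof.
have c (f : arrow M) : ffR F f ∘ clL_map (C f) = amap f ∘ idm (adom f).
  by rewrite (cofree_cl_map f) ff_fact comp_idr.
pose z (f : arrow M) : @hom (Arrow M) (mkArrow (clL_map (C f))) f :=
  @mkSquare M (mkArrow (clL_map (C f))) f (idm (adom f)) (ffR F f) (c f).
pose t (f : arrow M) : hom (F f) (W f) := fmap W (z f) ∘ clL_str (C f).
have tu : forall (f : arrow M) A B (u : ClovenL W A B) (h : hom A (adom f)) k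
    (x : @hom (Arrow M) (mkArrow (clL_map u)) f),
    clL_square u (C f) h k -> sdom x = h -> scod x = ffR F f ∘ k ->
    t f ∘ k = fmap W x ∘ clL_str u.
  move=> f A B u h k x [c' e] e1 e2.
  rewrite /t -comp_assoc -e comp_assoc /Emap -fmap_comp; congr (_ ∘ _).
  by congr fmap; apply: square_ext; rewrite /= ?comp_idl.
exists t; split; [|split; [|split]] => //.
- move=> f; rewrite /t -(cofree_cl_map f) -comp_assoc clL_dom.
  by rewrite (ffL_nat W (z f)) comp_idr.
- by move=> f; rewrite /t comp_assoc -(ffR_nat W (z f)) -comp_assoc clL_cod comp_idr.
- move=> f g x.
  have cx : (scod x ∘ ffR F f) ∘ clL_map (C f) = amap g ∘ (sdom x ∘ idm _).
    by rewrite -comp_assoc c comp_assoc scomm -comp_assoc.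
  pose y : @hom (Arrow M) (mkArrow (clL_map (C f))) g :=
    @mkSquare M (mkArrow (clL_map (C f))) g _ _ cx.
  have ey : scod y = ffR F g ∘ fmap F x by rewrite /= cofree_R_nat.
  rewrite (tu g _ _ _ _ _ y (proj1 (cl_sq cl _ _ _ _) (cofree_nat p x)) (comp_idr _) ey) /t comp_assoc -fmap_comp.
  congr (fmap _ _ ∘ _); exact: square_ext.
Qed.

(** A square with identity components need not be an identity definitionally,
    since the two arrows that it joins are only propositionally equal. *)
Lemma fmap_id_mono (X Y : M) (f g : hom X Y) (x : @hom (Arrow M) (mkArrow f) (mkArrow g))
  Z (a b : hom Z (W (mkArrow f))) :
  sdom x = idm X -> scod x = idm Y -> fmap W x ∘ a = fmap W x ∘ b -> a = b.
Proof.
move=> e0 e1; have e : f = g.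
  by have := scomm x; rewrite e0 e1 /= comp_idl comp_idr.
subst g; have -> : x = idm (mkArrow f : Arrow M) by apply: square_ext.
by rewrite fmap_id !comp_idl.
Qed.

(** A coalgebra structure [s] for the comonad of cofree arrows gives the cloven
    left map with structure [t ∘ s], and coassociativity says that [s] is the
    map that this cloven left map induces. *)
Lemma cloven_comonadic : comonadic p.
Proof.
have [t [tL [tR [tn tu]]]] := cofree_to_copointed.
constructor.
- move=> A B f s sL sR sd.
  have uL : (t (mkArrow f) ∘ s) ∘ f = ffL W (mkArrow f).
    by rewrite -comp_assoc sL; exact: (tL (mkArrow f)).
  have uR : ffR W (mkArrow f) ∘ (t (mkArrow f) ∘ s) = idm B.
    by rewrite comp_assoc (tR (mkArrow f)).
  pose u := @Build_ClovenL M W A B f (t (mkArrow f) ∘ s) uL uR.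
  exists (cl_inv cl u); split; first exact: cl_inv_map.
  apply/(cl_sq cl); rewrite cl_invK.
  pose g : ob (Arrow M) := mkArrow f; pose Cg := C g.
  have mC : clL_map Cg = ffL F g := cofree_cl_map g.
  pose Cm : ob (Arrow M) := mkArrow (clL_map Cg).
  have cx : idm (F g) ∘ clL_map Cg = ffL F g ∘ idm A by rewrite mC comp_idl comp_idr.
  pose x : hom Cm (Larr g) := @mkSquare M Cm (Larr g) (idm A) (idm (F g)) cx.
  have ex : t (Larr g) ∘ d g = fmap W x ∘ clL_str Cg.
    apply: (tu _ _ _ _ _ _ x (proj1 (cl_sq cl _ _ _ _) (cofree_d p g))) => //=.
    by rewrite (cofree_dR p).
  have cz : s ∘ f = ffL F g ∘ idm A by rewrite sL comp_idr.
  pose z : hom g (Larr g) := @mkSquare M g (Larr g) (idm A) s cz.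
  have cC : s ∘ f = clL_map Cg ∘ idm A by rewrite mC sL comp_idr.
  exists cC; apply: (fmap_id_mono (x := x)) => //=.
  have xz : fmap W x ∘ Emap W (f := g) (g := Cm) (idm A) s cC = fmap W z.
    by rewrite /Emap -fmap_comp; congr fmap; apply: square_ext; exact: comp_idl.
  rewrite (comp_assoc (fmap W x) (Emap _ _ _ _)) xz.
  rewrite (comp_assoc (fmap W x) _ s) -ex -[RHS]comp_assoc (sd z) //.
  by rewrite !comp_assoc tn.
- move=> A B u v e sq; rewrite -(cl_funK cl u) -(cl_funK cl v); congr (cl_inv _ _).
  by apply: clL_eq; [rewrite !cl_map|apply/(cl_sq cl)].
- move=> A B A' B' u v s s' x su Ru sv Rv e; apply/(cl_sq cl).
  have cmp X Y (w : vs_ver V X Y) : idm Y ∘ clL_map (cl X Y w) = vs_map w ∘ idm X.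
    by rewrite cl_map comp_idl comp_idr.
  pose y X Y (w : vs_ver V X Y) : @hom (Arrow M) (mkArrow (clL_map (cl X Y w)))
      (mkArrow (vs_map w)) :=
    @mkSquare M (mkArrow (clL_map (cl X Y w))) (mkArrow (vs_map w)) _ _ (cmp X Y w).
  have self X Y (w : vs_ver V X Y) r :
      vs_sq w (cofree p (mkArrow (vs_map w))) (idm X) r ->
      ffR F (mkArrow (vs_map w)) ∘ r = idm Y ->
      t (mkArrow (vs_map w)) ∘ r = fmap W (y _ _ w) ∘ clL_str (cl X Y w).
    by move=> /(cl_sq cl) sq er; apply: (tu _ _ _ _ _ _ (y _ _ w) sq).
  have c : scod x ∘ clL_map (cl _ _ u) = clL_map (cl _ _ v) ∘ sdom x.
    by rewrite !cl_map; exact: (scomm x).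
  exists c; apply: (fmap_id_mono (x := y _ _ v)) => //=.
  have yx : fmap W (y _ _ v) ∘ Emap W (f := mkArrow (clL_map (cl _ _ u)))
      (g := mkArrow (clL_map (cl _ _ v))) (sdom x) (scod x) c
      = fmap W x ∘ fmap W (y _ _ u).
    rewrite /Emap -!fmap_comp; congr fmap; apply: square_ext => /=;
      by rewrite comp_idl comp_idr.
  rewrite (comp_assoc (fmap W (y _ _ v)) (Emap _ _ _ _)) yx -comp_assoc.
  rewrite (comp_assoc (fmap W (y _ _ v))) -(self _ _ _ _ su Ru) -(self _ _ _ _ sv Rv).
  by rewrite -comp_assoc -e !comp_assoc tn.
Qed.

End Left.

(** * The size bound *)

(** [B] bounds the ranks of presentability of [M] and of accessibility of [F],
    and [K] is a regular cardinal above [B]. *)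
Record size_bound (M : Category) (F : FunctorialFactorization M) (B : Set) : Prop := {
  sb_roomy : roomy B;
  sb_regular : exists K : Set, regular_cardinal K /\
    forall X : Type, card_le X B -> card_lt X K;
  sb_continuous : bcontinuous B (ffE F);
  sb_generating : exists (I : Set) (Q : I -> Arrow M), generating_family B Q }.

(** The bound absorbs the two cardinals provided by the hypotheses; a generator
    of [M] gives one of the arrow category, which is then closed under colimits
    of that size. *)
Lemma size_bound_exists (M : Category) (F : FunctorialFactorization M) :
  locally_presentable M -> accessible_functor (ffE F) -> exists B, size_bound F B.
Proof.
move=> [coc [K0 [_ [I [G [pres gen]]]]]] [K1 [_ cont]].
pose X : Set := (nat + K0 + K1)%type.
have inX : card_le nat X by exists (fun n => inl (inl n)) => x y [].
have hB := pairing_closure_roomy inX.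
have K0B : card_le K0 (pairing_closure X).
  apply: card_le_trans (card_le_pairing_closure X).
  by exists (fun n => inl (inr n)) => x y [].
have K1B : card_le K1 (pairing_closure X).
  apply: card_le_trans (card_le_pairing_closure X).
  by exists (fun n => inr n) => x y [].
exists (pairing_closure X); constructor=> //.
- exact: regular_above.
- by move=> J D c sJ fJ; apply: cont => //; apply: gfiltered_filtered fJ.
- have det : detects_isos G.
    apply: presentable_generator => Y.
    by have [J [D [c [_ [_ [iso [uc e]]]]]]] := gen Y; exists J, D, c.
  have [|I' [G' [det' pres']]] := arrow_generator coc (B := pairing_closure X) det.
    by move=> i; apply: presentable_bpresentable (pres i).
  exists (closure_index (pairing_closure X) (arrow_cocomplete coc) G').
  by exists (closure_object (coc := arrow_cocomplete coc) (G := G')); apply: closure_generating.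
Qed.

Lemma bcontinuous_accessible (C C' : Category) (F : Functor C C') (B K : Set) :
  roomy B -> regular_cardinal K -> (forall X : Type, card_le X B -> card_lt X K) ->
  bcontinuous B F -> accessible_functor F.
Proof.
move=> hB rK lt cF; exists K; split=> // J D c sJ fJ.
by apply: cF => //; apply: filtered_gfiltered fJ.
Qed.

Lemma bcontinuous_comp (B : Set) (C C' C'' : Category) (F : Functor C C')
  (G : Functor C' C'') : bcontinuous B F ->
  (forall (J : Category) (D : Functor J C') (c : Cocone D),
    small J -> is_colimit c -> is_colimit (map_cocone G c)) ->
  bcontinuous B (comp_functor G F).
Proof.
move=> cF cG J D c sJ fJ uc; have u := cG _ _ _ sJ (cF _ _ _ sJ fJ uc).
apply: colim_intro => [X k nat|X h h' e].
  exact: (@colim_desc _ _ _ (map_cocone G (map_cocone F c)) X k u nat).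
exact: (@colim_epi _ _ _ (map_cocone G (map_cocone F c)) X h h' u e).
Qed.

Lemma functor_ext (C C' : Category) (o : C -> C')
  (fm fm' : forall A B, hom A B -> hom (o A) (o B)) p p' q q' :
  (forall A B (f : hom A B), fm A B f = fm' A B f) ->
  @Build_Functor C C' o fm p q = @Build_Functor C C' o fm' p' q'.
Proof.
move=> e; have {}e : fm = fm'.
  by do 2 (apply: functional_extensionality_dep => ?); apply: functional_extensionality.
by subst fm'; rewrite (proof_irrelevance _ p p') (proof_irrelevance _ q q').
Qed.

(** * Underlying weak factorization systems *)

Section Classes.

Variables (M : Category).

Lemma left_class_transfer (W W' : AWFS M) (t : forall f : arrow M, hom (W f) (W' f)) :
  (forall f, t f ∘ ffL W f = ffL W' f) -> (forall f, ffR W' f ∘ t f = ffR W f) ->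
  forall f, left_class W f -> left_class W' f.
Proof.
move=> tL tR [A B f] [[g s s1 s2] /= e]; subst g.
have h1 : (t (mkArrow f) ∘ s) ∘ f = ffL W' (mkArrow f) by rewrite -comp_assoc s1; exact: (tL (mkArrow f)).
have h2 : ffR W' (mkArrow f) ∘ (t (mkArrow f) ∘ s) = idm B.
  by rewrite comp_assoc (tR (mkArrow f)).
by exists (Build_ClovenL h1 h2).
Qed.

Lemma right_class_transfer (W W' : AWFS M) (t : forall f : arrow M, hom (W' f) (W f)) :
  (forall f, t f ∘ ffL W' f = ffL W f) -> (forall f, ffR W f ∘ t f = ffR W' f) ->
  forall f, right_class W f -> right_class W' f.
Proof.
move=> tL tR [A B f] [[g s s1 s2] /= e]; subst g.
have h1 : (s ∘ t (mkArrow f)) ∘ ffL W' (mkArrow f) = idm A.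
  by rewrite -comp_assoc (tL (mkArrow f)); exact: s1.
have h2 : f ∘ (s ∘ t (mkArrow f)) = ffR W' (mkArrow f).
  by rewrite comp_assoc s2 (tR (mkArrow f)).
by exists (Build_ClovenR h1 h2).
Qed.

Lemma same_underlying (W W' : AWFS M) (t : forall f : arrow M, hom (W f) (W' f))
  (t' : forall f : arrow M, hom (W' f) (W f)) :
  (forall f, t f ∘ ffL W f = ffL W' f) -> (forall f, ffR W' f ∘ t f = ffR W f) ->
  (forall f, t' f ∘ ffL W' f = ffL W f) -> (forall f, ffR W f ∘ t' f = ffR W' f) ->
  same_underlying_wfs W W'.
Proof.
move=> tL tR tL' tR'; split=> f; split.
- exact: left_class_transfer tL tR f.
- exact: left_class_transfer tL' tR' f.
- exact: right_class_transfer tL' tR' f.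
- exact: right_class_transfer tL tR f.
Qed.

Lemma left_class_retract (W : AWFS M) (f g : Arrow M) :
  is_retract f g -> left_class W g -> left_class W f.
Proof.
case: f g => [A B f] [A' B' g] [i [r ri]] [[g' s s1 s2] /= e]; subst g'.
have ri0 : sdom r ∘ sdom i = idm A by exact: (f_equal (@sdom _ _ _) ri).
have ri1 : scod r ∘ scod i = idm B by exact: (f_equal (@scod _ _ _) ri).
have h1 : (fmap W r ∘ s ∘ scod i) ∘ f = ffL W (mkArrow f).
  rewrite -(comp_assoc _ (scod i)) (scomm i) /= comp_assoc -(comp_assoc _ s) s1.
  by rewrite (ffL_nat W r) -comp_assoc ri0 comp_idr.
have h2 : ffR W (mkArrow f) ∘ (fmap W r ∘ s ∘ scod i) = idm B.
  rewrite !comp_assoc -(ffR_nat W r) -(comp_assoc (scod r)) s2.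
  by rewrite comp_idr.
by exists (Build_ClovenL h1 h2).
Qed.

Lemma right_class_retract (W : AWFS M) (f g : Arrow M) :
  is_retract f g -> right_class W g -> right_class W f.
Proof.
case: f g => [A B f] [A' B' g] [i [r ri]] [[g' s s1 s2] /= e]; subst g'.
have ri0 : sdom r ∘ sdom i = idm A by exact: (f_equal (@sdom _ _ _) ri).
have ri1 : scod r ∘ scod i = idm B by exact: (f_equal (@scod _ _ _) ri).
have h1 : (sdom r ∘ (s ∘ fmap W i)) ∘ ffL W (mkArrow f) = idm A.
  rewrite -!comp_assoc (ffL_nat W i) (comp_assoc s) s1.
  by rewrite comp_idl.
have h2 : f ∘ (sdom r ∘ (s ∘ fmap W i)) = ffR W (mkArrow f).
  have hr : f ∘ sdom r = scod r ∘ g := eq_sym (scomm r).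
  rewrite (comp_assoc f) hr -comp_assoc (comp_assoc g) s2.
  by rewrite -(ffR_nat W i) comp_assoc ri1 comp_idl.
by exists (Build_ClovenR h1 h2).
Qed.

End Classes.

(** * Cofree cloven left maps *)

Section CofreeLeft.

Variables (M : Category) (W : FunctorialFactorization M) (V : VerticalStructure M)
  (cl : cloven_left V W).

Notation CL := (Copt (Lcopoint W)).

Lemma copt_sdom (A : CL) : sdom (cp_str A) = idm _.
Proof. by have := f_equal (@sdom _ _ _) (cp_law A); rewrite /= comp_idl. Qed.

Lemma copt_scod (A : CL) : ffR W (cp_ob A) ∘ scod (cp_str A) = idm _.
Proof. exact: (f_equal (@scod _ _ _) (cp_law A)). Qed.

Lemma copt_comm (A : CL) : scod (cp_str A) ∘ amap (cp_ob A) = ffL W (cp_ob A).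
Proof. by rewrite (scomm (cp_str A)) copt_sdom comp_idr. Qed.

Section OfCloven.

Variables (X Y : M) (u : ClovenL W X Y).

Notation g := (mkArrow (clL_map u) : ob (Arrow M)).

Lemma copt_comm_of_cloven : clL_str u ∘ clL_map u = ffL W g ∘ idm X.
Proof. by rewrite clL_dom comp_idr. Qed.

Definition copt_str_of_cloven : hom g (mkArrow (ffL W g) : ob (Arrow M)) :=
  @mkSquare M g (mkArrow (ffL W g)) (idm X) (clL_str u) copt_comm_of_cloven.

Lemma copt_law_of_cloven : Lcopoint W g ∘ copt_str_of_cloven = idm g.
Proof. by apply: square_ext; [exact: comp_idl|exact: clL_cod]. Qed.

Definition copt_of_cloven : CL := Build_copt_coalgebra copt_law_of_cloven.

End OfCloven.

Lemma copt_hom_law (X Y : CL) (x : hom (cp_ob X) (cp_ob Y)) :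
  fmap W x ∘ scod (cp_str X) = scod (cp_str Y) ∘ scod x ->
  fmap (Lfunctor W) x ∘ cp_str X = cp_str Y ∘ x.
Proof.
move=> e; apply: square_ext => //=.
by rewrite !copt_sdom comp_idl comp_idr.
Qed.

Lemma copt_hom_scod (X Y : CL) (x : hom X Y) :
  fmap W (proj1_sig x) ∘ scod (cp_str X) = scod (cp_str Y) ∘ scod (proj1_sig x).
Proof. exact: (f_equal (@scod _ _ _) (proj2_sig x)). Qed.

(** Maps from identities to an arrow are maps into its domain, and every such
    map is a map of coalgebras; so a cofree coalgebra has the right domain. *)
Lemma cofree_sdom (f : Arrow M) (A : CL) (e : hom (cp_ob A) f) :
  is_cofree e -> invertible (sdom e).
Proof.
move=> cofree.
have into (X : M) (Y : CL) (x : hom X (adom (cp_ob Y))) :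
    exists h : hom (copt_of_cloven (idL W X)) Y, sdom (proj1_sig h) = x /\
      scod (proj1_sig h) = amap (cp_ob Y) ∘ x.
  have c : (amap (cp_ob Y) ∘ x) ∘ idm X = amap (cp_ob Y) ∘ x by rewrite comp_idr.
  pose z : @hom (Arrow M) (mkArrow (idm X)) (cp_ob Y) :=
    @mkSquare M (mkArrow (idm X)) (cp_ob Y) _ _ c.
  have ez : fmap (Lfunctor W) z ∘ cp_str (copt_of_cloven (idL W X)) = cp_str Y ∘ z.
    apply: (@copt_hom_law (copt_of_cloven (idL W X)) Y z).
    by rewrite /= (ffL_nat W z) comp_assoc copt_comm.
  by exists (exist _ z ez).
have c : amap f ∘ idm (adom f) = amap f ∘ idm (adom f) by [].
pose y : @hom (Arrow M) (mkArrow (idm (adom f))) f :=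
  @mkSquare M (mkArrow (idm (adom f))) f (idm _) (amap f) c.
have [n [en _]] := cofree (copt_of_cloven (idL W (adom f))) y.
have e1 : sdom e ∘ sdom (proj1_sig n) = idm _ by exact: (f_equal (@sdom _ _ _) en).
exists (sdom (proj1_sig n)); split=> //.
set X := adom (cp_ob A).
have [h1 [h10 h11]] := into X A (sdom (proj1_sig n) ∘ sdom e).
have [h2 [h20 h21]] := into X A (idm X).
suff -> : sdom (proj1_sig n) ∘ sdom e = sdom (proj1_sig h2) by [].
rewrite -h10; suff -> : h1 = h2 by [].
have [k [_ uk]] := cofree (copt_of_cloven (idL W X)) (e ∘ proj1_sig h1).
rewrite -(uk h1) // -(uk h2) //.
have q : sdom e ∘ (sdom (proj1_sig n) ∘ sdom e) = sdom e.
  by rewrite comp_assoc e1 comp_idl.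
apply: square_ext => /=; first by rewrite h10 h20 q comp_idr.
by rewrite h11 h21 comp_idr (comp_assoc (scod e)) (scomm e) -comp_assoc q.
Qed.

(** The cofree coalgebras, transported so that their domains are those of the
    given arrows, are cofree vertical arrows. *)
Theorem presented_of_cofree (G : Functor (Arrow M) CL)
  (e : forall f : Arrow M, hom (cp_ob (G f)) f) :
  (forall f, is_cofree (e f)) ->
  (forall f g (x : @hom (Arrow M) f g), x ∘ e f = e g ∘ proj1_sig (fmap G x)) ->
  exists (F : FunctorialFactorization M)
    (d : forall f : arrow M, hom (F f) (F (mkArrow (ffL F f))))
    (m : forall f : arrow M, hom (F (mkArrow (ffR F f))) (F f)),
    inhabited (presented V d m) /\
    ffE F = comp_functor (cod_functor M) (comp_functor (copt_forget (Lcopoint W)) G).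
Proof.
move=> cofree nat; pose Gmap f g (x : @hom (Arrow M) f g) := fmap G x.
have eG f g (x : @hom (Arrow M) f g) : e g ∘ proj1_sig (Gmap f g x) = x ∘ e f.
  by rewrite nat.
have [inv hinv] : exists inv : forall f : Arrow M, hom (adom f) (adom (cp_ob (G f))),
    forall f, inv f ∘ sdom (e f) = idm _ /\ sdom (e f) ∘ inv f = idm _.
  apply: (@dchoice (Arrow M) (fun f => hom (adom f) (adom (cp_ob (G f))))
    (fun f i => i ∘ sdom (e f) = idm _ /\ sdom (e f) ∘ i = idm _)) => f.
  by have [i hi] := cofree_sdom (cofree f); exists i.
have invl f : inv f ∘ sdom (e f) = idm _ := proj1 (hinv f).
have invr f : sdom (e f) ∘ inv f = idm _ := proj2 (hinv f).
pose a f := amap (cp_ob (G f)) ∘ inv f.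
have ca f : idm _ ∘ amap (cp_ob (G f)) = a f ∘ sdom (e f).
  by rewrite /a -comp_assoc invl comp_idl comp_idr.
pose y f : @hom (Arrow M) (cp_ob (G f)) (mkArrow (a f)) :=
  @mkSquare M (cp_ob (G f)) (mkArrow (a f)) _ _ (ca f).
have ca' f : idm _ ∘ a f = amap (cp_ob (G f)) ∘ inv f by rewrite comp_idl.
pose y' f : @hom (Arrow M) (mkArrow (a f)) (cp_ob (G f)) :=
  @mkSquare M (mkArrow (a f)) (cp_ob (G f)) _ _ (ca' f).
have y'y f : y' f ∘ y f = idm _.
  by apply: square_ext; [exact: invl|exact: comp_idl].
pose s f := fmap W (y f) ∘ scod (cp_str (G f)).
have sL f : s f ∘ a f = ffL W (mkArrow (a f)).
  rewrite /s /a -!comp_assoc (comp_assoc _ (amap _)) copt_comm comp_assoc.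
  by rewrite (ffL_nat W (y f)) -comp_assoc invr comp_idr.
have sR f : ffR W (mkArrow (a f)) ∘ s f = idm _.
  by rewrite /s comp_assoc -(ffR_nat W (y f)) -comp_assoc copt_scod comp_idl.
pose C0 f : ClovenL W (adom f) (acod (cp_ob (G f))) := Build_ClovenL (sL f) (sR f).
pose C f : vs_ver V (adom f) (acod (cp_ob (G f))) := cl_inv cl (C0 f).
have RC f : scod (e f) ∘ vs_map (C f) = amap f.
  by rewrite cl_inv_map /= /a comp_assoc scomm -comp_assoc invr comp_idr.
have squareP f X Y (u : ClovenL W X Y) h k
    (x : @hom (Arrow M) (mkArrow (clL_map u)) (cp_ob (G f))) :
    sdom x = inv f ∘ h -> scod x = k ->
    clL_square u (C0 f) h k <-> fmap W x ∘ clL_str u = scod (cp_str (G f)) ∘ k.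
  move=> x0 x1.
  have c : k ∘ clL_map u = a f ∘ h.
    by have := scomm x; rewrite x0 x1 /= /a comp_assoc.
  have yx : Emap W (f := mkArrow (clL_map u)) (g := mkArrow (a f)) h k c
            = fmap W (y f) ∘ fmap W x.
    rewrite -fmap_comp /Emap; congr fmap; apply: square_ext => /=.
      by rewrite x0 comp_assoc invr comp_idl.
    by rewrite x1 comp_idl.
  split=> [[c' q]|q].
    rewrite (proof_irrelevance _ c' c) yx in q.
    rewrite -[LHS]comp_idl -[RHS]comp_idl -fmap_id -y'y fmap_comp -!comp_assoc.
    by congr (_ ∘ _); rewrite comp_assoc q /= /s comp_assoc.
  by exists c; rewrite yx -comp_assoc q /= /s comp_assoc.
have sqC f X Y (u : vs_ver V X Y) h k :
    vs_sq u (C f) h k <-> clL_square (cl X Y u) (C0 f) h k.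
  by rewrite (cl_sq cl) cl_invK.
have univ f X Y (u : vs_ver V X Y) (h : hom X (adom f)) (k : hom Y (acod f)) :
    k ∘ vs_map u = amap f ∘ h ->
    exists! k', vs_sq u (C f) h k' /\ scod (e f) ∘ k' = k.
  rewrite -(cl_map cl) => c.
  pose u0 := cl X Y u.
  pose x : @hom (Arrow M) (mkArrow (clL_map u0)) f := @mkSquare M (mkArrow (clL_map u0)) f _ _ c.
  have [n [en un]] := cofree f (copt_of_cloven u0) x.
  have n0 : sdom (proj1_sig n) = inv f ∘ h.
    have := f_equal (@sdom _ _ _) en => /= <-.
    by rewrite comp_assoc invl comp_idl.
  exists (scod (proj1_sig n)); split.
    split; last exact: (f_equal (@scod _ _ _) en).
    apply/sqC/(squareP f X Y u0 h _ (proj1_sig n) n0 eq_refl).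
    exact: (@copt_hom_scod (copt_of_cloven u0) (G f) n).
  move=> k' [/sqC sq ek].
  have c' : k' ∘ clL_map u0 = amap (cp_ob (G f)) ∘ (inv f ∘ h).
    by case: (sq) => c' _; rewrite c' /= /a comp_assoc.
  pose x' : @hom (Arrow M) (mkArrow (clL_map u0)) (cp_ob (G f)) :=
    @mkSquare M (mkArrow (clL_map u0)) (cp_ob (G f)) _ _ c'.
  have ex' := copt_hom_law (X := copt_of_cloven u0) (Y := G f) (x := x')
    (proj1 (squareP f X Y u0 h k' x' eq_refl eq_refl) sq).
  have -> : n = exist _ x' ex'; last by [].
  apply: un; apply: square_ext => /=; last exact: ek.
  by rewrite comp_assoc invr comp_idl.
pose p := @cofree_presented M V _ C (fun f => scod (e f)) RC univ.
pose F := @cofree_ff M V _ C (fun f => scod (e f)) RC univ.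
exists F; do 2 eexists; split; first by constructor; exact: p.
apply: functor_ext => f g x.
apply: (@univ_uniq M V _ C (fun f => scod (e f)) RC univ g _ _
          (C f) (sdom x) _ _ (univ_lift_sq _ _)); last first.
  transitivity (scod x ∘ scod (e f)); last first.
    exact: eq_sym (f_equal (@scod _ _ _) (eG f g x)).
  exact: (@univ_lift_R M V _ C (fun f => scod (e f)) univ).
have h0 : inv g ∘ (sdom x ∘ sdom (e f)) = sdom (proj1_sig (Gmap f g x)).
  have := f_equal (@sdom _ _ _) (eG f g x) => /= <-.
  by rewrite comp_assoc invl comp_idl.
have c : scod (proj1_sig (Gmap f g x)) ∘ a f = amap (cp_ob (G g)) ∘ (inv g ∘ sdom x).
  have hs : scod (proj1_sig (Gmap f g x)) ∘ amap (cp_ob (G f))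
            = amap (cp_ob (G g)) ∘ sdom (proj1_sig (Gmap f g x)) by exact: scomm.
  by rewrite /a comp_assoc hs -h0 -!comp_assoc invr comp_idr.
pose x' : @hom (Arrow M) (mkArrow (a f)) (cp_ob (G g)) :=
  @mkSquare M (mkArrow (a f)) (cp_ob (G g)) _ _ c.
apply/sqC; rewrite /C cl_invK.
apply/(squareP g _ _ (C0 f) (sdom x) _ x' eq_refl eq_refl).
rewrite /= /s comp_assoc -fmap_comp -copt_hom_scod; congr (fmap _ _ ∘ _).
apply: square_ext; last exact: comp_idr.
by rewrite -h0 comp_assoc.
Qed.

End CofreeLeft.

(** The universal property forces the action on maps, which makes the counits
    natural. *)
Lemma cofree_functor_exists (C : Category) (T : Functor C C)
  (eps : NatTrans T (id_functor C)) :
  (forall X, exists (A : Copt eps) (e : hom (cp_ob A) X), is_cofree e) ->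
  exists (G : Functor C (Copt eps)) (e : forall X, hom (cp_ob (G X)) X),
    (forall X, is_cofree (e X)) /\
    (forall X Y (f : hom X Y), f ∘ e X = e Y ∘ proj1_sig (fmap G f)).
Proof.
move=> ex.
have [z cofree] : exists z : forall X : C, {A : Copt eps & hom (cp_ob A) X},
    forall X, is_cofree (projT2 (z X)).
  apply: (@dchoice C (fun X => {A : Copt eps & hom (cp_ob A) X})
            (fun X z => is_cofree (projT2 z))) => X.
  by have [A [e ce]] := ex X; exists (existT _ A e).
pose A X := projT1 (z X); pose e X : hom (cp_ob (A X)) X := projT2 (z X).
have inj X (Y : Copt eps) (h h' : hom Y (A X)) :
    e X ∘ proj1_sig h = e X ∘ proj1_sig h' -> h = h'.
  move=> q; have [k [_ uk]] := cofree X Y (e X ∘ proj1_sig h).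
  by rewrite -(uk h) // -(uk h').
have [Gm hGm] : exists Gm : forall x : {X : C & {Y : C & hom X Y}},
    hom (A (projT1 x)) (A (projT1 (projT2 x))),
    forall x, e _ ∘ proj1_sig (Gm x) = projT2 (projT2 x) ∘ e _.
  apply: (@dchoice {X : C & {Y : C & hom X Y}}
    (fun x => hom (A (projT1 x)) (A (projT1 (projT2 x))))
    (fun x h => e _ ∘ proj1_sig h = projT2 (projT2 x) ∘ e _)) => -[X [Y f]].
  by have [h [eh _]] := cofree Y (A X) (f ∘ e X); exists h.
pose Gmap X Y (f : hom X Y) : hom (A X) (A Y) := Gm (existT _ X (existT _ Y f)).
have eG X Y (f : hom X Y) : e Y ∘ proj1_sig (Gmap X Y f) = f ∘ e X.
  exact: (hGm (existT _ X (existT _ Y f))).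
have Gid X : Gmap X X (idm X) = idm (A X).
  by apply: inj; rewrite eG; exact: eq_trans (comp_idl _) (eq_sym (comp_idr _)).
have Gcomp X Y Z (g : hom Y Z) (f : hom X Y) :
    Gmap X Z (g ∘ f) = Gmap Y Z g ∘ Gmap X Y f.
  have q : e Z ∘ proj1_sig (Gmap Y Z g ∘ Gmap X Y f)
           = e Z ∘ (proj1_sig (Gmap Y Z g) ∘ proj1_sig (Gmap X Y f)) by [].
  apply: inj; rewrite q eG (comp_assoc (e Z)) eG -[RHS]comp_assoc eG.
  exact: eq_sym (comp_assoc _ _ _).
by exists (@Build_Functor C (Copt eps) A Gmap Gid Gcomp), e; split.
Qed.

Lemma free_functor_exists (C : Category) (T : Functor C C)
  (eta : NatTrans (id_functor C) T) :
  (forall X, exists (A : Ptd eta) (e : hom X (al_ob A)), is_free e) ->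
  exists (G : Functor C (Ptd eta)) (e : forall X, hom X (al_ob (G X))),
    (forall X, is_free (e X)) /\
    (forall X Y (f : hom X Y), e Y ∘ f = proj1_sig (fmap G f) ∘ e X).
Proof.
move=> ex.
have [z free] : exists z : forall X : C, {A : Ptd eta & hom X (al_ob A)},
    forall X, is_free (projT2 (z X)).
  apply: (@dchoice C (fun X => {A : Ptd eta & hom X (al_ob A)})
            (fun X z => is_free (projT2 z))) => X.
  by have [A [e fe]] := ex X; exists (existT _ A e).
pose A X := projT1 (z X); pose e X : hom X (al_ob (A X)) := projT2 (z X).
have inj X (Y : Ptd eta) (h h' : hom (A X) Y) :
    proj1_sig h ∘ e X = proj1_sig h' ∘ e X -> h = h'.
  move=> q; have [k [_ uk]] := free X Y (proj1_sig h ∘ e X).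
  by rewrite -(uk h) // -(uk h').
have [Gm hGm] : exists Gm : forall x : {X : C & {Y : C & hom X Y}},
    hom (A (projT1 x)) (A (projT1 (projT2 x))),
    forall x, proj1_sig (Gm x) ∘ e _ = e _ ∘ projT2 (projT2 x).
  apply: (@dchoice {X : C & {Y : C & hom X Y}}
    (fun x => hom (A (projT1 x)) (A (projT1 (projT2 x))))
    (fun x h => proj1_sig h ∘ e _ = e _ ∘ projT2 (projT2 x))) => -[X [Y f]].
  by have [h [eh _]] := free X (A Y) (e Y ∘ f); exists h.
pose Gmap X Y (f : hom X Y) : hom (A X) (A Y) := Gm (existT _ X (existT _ Y f)).
have eG X Y (f : hom X Y) : proj1_sig (Gmap X Y f) ∘ e X = e Y ∘ f.
  exact: (hGm (existT _ X (existT _ Y f))).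
have Gid X : Gmap X X (idm X) = idm (A X).
  by apply: inj; rewrite eG; exact: eq_trans (comp_idr _) (eq_sym (comp_idl _)).
have Gcomp X Y Z (g : hom Y Z) (f : hom X Y) :
    Gmap X Z (g ∘ f) = Gmap Y Z g ∘ Gmap X Y f.
  have q : proj1_sig (Gmap Y Z g ∘ Gmap X Y f) ∘ e X
           = (proj1_sig (Gmap Y Z g) ∘ proj1_sig (Gmap X Y f)) ∘ e X by [].
  apply: inj; rewrite q eG -[RHS]comp_assoc eG (comp_assoc _ (e Y)) eG.
  exact: comp_assoc.
by exists (@Build_Functor C (Ptd eta) A Gmap Gid Gcomp), e; split.
Qed.

(** * Duality *)

Section Duality.

Variable M : Category.

(** The opposite of a locally presentable category is rarely locally
    presentable.  Hence only the passage from cofree objects to factorization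
    systems is dualized, and the accessibility statements stay on the side of
    [M]. *)
Definition op : Category.
Proof.
refine (@Build_Category M (fun A B => hom B A) (fun A => idm A)
          (fun A B C g f => f ∘ g) _ _ _).
- by move=> *; rewrite comp_assoc.
- by move=> *; apply: comp_idr.
- by move=> *; apply: comp_idl.
Defined.

Definition op_arrow (f : arrow M) : arrow op := @mkArrow op (acod f) (adom f) (amap f).

Definition unop_arrow (f : arrow op) : arrow M := @mkArrow M (acod f) (adom f) (amap f).

Definition op_square (f g : arrow M) (x : square f g) : square (op_arrow g) (op_arrow f) :=
  @mkSquare op (op_arrow g) (op_arrow f) (scod x) (sdom x) (eq_sym (scomm x)).

Definition unop_square (f g : arrow op) (x : square f g) :
    square (unop_arrow g) (unop_arrow f) :=
  @mkSquare M (unop_arrow g) (unop_arrow f) (scod x) (sdom x) (eq_sym (scomm x)).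

Lemma unop_square_surj (f g : arrow M) (x : square f g) :
  exists y : square (op_arrow g) (op_arrow f), x = unop_square y.
Proof. by exists (op_square x); apply: square_ext. Qed.

Lemma fmap_square (N C : Category) (F : Functor (Arrow N) C) (f g : Arrow N) (x y : hom f g) :
  sdom x = sdom y -> scod x = scod y -> fmap F x = fmap F y.
Proof. by move=> e0 e1; rewrite (square_ext e0 e1). Qed.

Definition op_functor (F : Functor (Arrow M) M) : Functor (Arrow op) op.
Proof.
refine (@Build_Functor (Arrow op) op (fun f => F (unop_arrow f))
          (fun f g x => fmap F (unop_square x : @hom (Arrow M) _ _)) _ _).
- by move=> f; apply: eq_trans (fmap_id F (unop_arrow f)); apply: fmap_square.
- by move=> f g h y x; apply: eq_trans (fmap_comp F _ _); apply: fmap_square.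
Defined.

Definition unop_functor (F : Functor (Arrow op) op) : Functor (Arrow M) M.
Proof.
refine (@Build_Functor (Arrow M) M (fun f => F (op_arrow f))
          (fun f g x => fmap F (op_square x : @hom (Arrow op) _ _)) _ _).
- by move=> f; apply: eq_trans (fmap_id F (op_arrow f)); apply: fmap_square.
- by move=> f g h y x; apply: eq_trans (fmap_comp F _ _); apply: fmap_square.
Defined.

Definition op_ff (F : FunctorialFactorization M) : FunctorialFactorization op.
Proof.
refine (@Build_FunctorialFactorization op (op_functor F)
  (fun f => ffR F (unop_arrow f)) (fun f => ffL F (unop_arrow f)) _ _ _).
- by move=> f; apply: (ff_fact F (unop_arrow f)).
- by move=> f g x; apply: eq_sym (ffR_nat F (unop_square x)).
- by move=> f g x; apply: eq_sym (ffL_nat F (unop_square x)).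
Defined.

Definition unop_ff (F : FunctorialFactorization op) : FunctorialFactorization M.
Proof.
refine (@Build_FunctorialFactorization M (unop_functor F)
  (fun f => ffR F (op_arrow f)) (fun f => ffL F (op_arrow f)) _ _ _).
- by move=> f; apply: (ff_fact F (op_arrow f)).
- by move=> f g x; apply: eq_sym (ffR_nat F (op_square x)).
- by move=> f g x; apply: eq_sym (ffL_nat F (op_square x)).
Defined.

Lemma ff_ext (N : Category) (E : arrow N -> N)
  (fm fm' : forall f g : arrow N, square f g -> hom (E f) (E g)) p p' q q' L R c c' l l' r r' :
  (forall f g x, fm f g x = fm' f g x) ->
  @Build_FunctorialFactorization N (@Build_Functor (Arrow N) N E fm p q) L R c l r
  = @Build_FunctorialFactorization N (@Build_Functor (Arrow N) N E fm' p' q') L R c' l' r'.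
Proof.
move=> e; have {}e : fm = fm'.
  by do 2 (apply: functional_extensionality_dep => ?); apply: functional_extensionality.
subst fm'; move: l r l' r'.
rewrite (proof_irrelevance _ p p') (proof_irrelevance _ q q') (proof_irrelevance _ c c').
by move=> l r l' r'; rewrite (proof_irrelevance _ l l') (proof_irrelevance _ r r').
Qed.

(** The two sides agree up to proofs of commutativity of squares. *)
Lemma op_unop_ff (F : FunctorialFactorization op) : op_ff (unop_ff F) = F.
Proof.
case: F => [[E fm p q] L R c l r]; apply: ff_ext => f g x /=.
by congr fm; apply: square_ext.
Qed.

Section Laws.

Variables (F : FunctorialFactorization M)
  (d : forall f : arrow M, hom (F f) (F (mkArrow (ffL F f))))
  (m : forall f : arrow M, hom (F (mkArrow (ffR F f))) (F f)).

(** Duality exchanges comultiplications and multiplications. *)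
Definition op_d (f : arrow op) :
    hom (op_ff F f) (op_ff F (mkArrow (ffL (op_ff F) f))) := m (unop_arrow f).

Definition op_m (f : arrow op) :
    hom (op_ff F (mkArrow (ffR (op_ff F) f))) (op_ff F f) := d (unop_arrow f).

Lemma op_laws : awfs_laws d m -> awfs_laws op_d op_m.
Proof.
move=> l; constructor=> /=.
- by move=> f; apply: (law_mR l).
- by move=> f; apply: (law_mL l).
- by move=> f x e0 e1; apply: (law_mE l).
- move=> f x e0 e1; exact: (law_mm l (x := unop_square x)).
- by move=> f g x y e0 e1; apply: (law_mnat l (x := unop_square x) (y := unop_square y)).
- by move=> f; apply: (law_dL l (unop_arrow f)).
- by move=> f; apply: (law_dR l (unop_arrow f)).
- by move=> f x e0 e1; apply: (law_dE l).
- move=> f x e0 e1; exact: (law_dd l (f := unop_arrow f) (x := unop_square x) e1 e0).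
- by move=> f g x y e0 e1; apply: (law_dnat l (f := unop_arrow g) (g := unop_arrow f) (x := unop_square x) (y := unop_square y)).
- move=> f x e0 e1; apply: eq_trans (eq_sym (comp_assoc _ _ _)).
  exact: (law_dm l (f := unop_arrow f) (x := unop_square x) e1 e0).
Qed.

Lemma unop_laws : awfs_laws op_d op_m -> awfs_laws d m.
Proof.
move=> l; constructor=> /=.
- by move=> f; apply: (law_mR l (op_arrow f)).
- by move=> f; apply: (law_mL l (op_arrow f)).
- move=> f x; have [y ->] := unop_square_surj x => e0 e1.
  exact: (law_mE l (f := op_arrow f) (x := y) e1 e0).
- move=> f x; have [y ->] := unop_square_surj x => e0 e1.
  exact: (law_mm l (f := op_arrow f) (x := y) e1 e0).
- move=> f g x y; have [x' ->] := unop_square_surj x; have [y' ->] := unop_square_surj y.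
  move=> e0 e1; exact: (law_mnat l (f := op_arrow g) (g := op_arrow f) (x := x') (y := y') e1 e0).
- by move=> f; apply: (law_dL l (op_arrow f)).
- by move=> f; apply: (law_dR l (op_arrow f)).
- move=> f x; have [y ->] := unop_square_surj x => e0 e1.
  exact: (law_dE l (f := op_arrow f) (x := y) e1 e0).
- move=> f x; have [y ->] := unop_square_surj x => e0 e1.
  exact: (law_dd l (f := op_arrow f) (x := y) e1 e0).
- move=> f g x y; have [x' ->] := unop_square_surj x; have [y' ->] := unop_square_surj y.
  move=> e0 e1; exact: (law_dnat l (f := op_arrow g) (g := op_arrow f) (x := x') (y := y') e1 e0).
- move=> f x; have [y ->] := unop_square_surj x => e0 e1; apply: eq_trans (comp_assoc _ _ _).
  exact: (law_dm l (f := op_arrow f) (x := y) e1 e0).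
Qed.

End Laws.

Lemma laws_of_awfs (N : Category) (W : AWFS N) : awfs_laws (delta W) (mu W).
Proof.
have mk (f g : arrow N) (x : @hom (Arrow N) f g) h k c : sdom x = h -> scod x = k ->
    Emap W h k c = fmap W x by move=> e0 e1; apply: fmap_square.
constructor.
- exact: delta_L.
- exact: delta_R.
- move=> f x e0 e1; have c : ffR W f ∘ ffL W f = amap f ∘ idm (adom f).
    by rewrite ff_fact comp_idr.
  by rewrite -(delta_E c) (mk _ _ x).
- move=> f x e0 e1; have c : delta W f ∘ ffL W f = ffL W (mkArrow (ffL W f)) ∘ idm (adom f).
    by rewrite delta_L comp_idr.
  by rewrite (delta_coassoc c) (mk _ _ x).
- move=> f g x y e0 e1.
  have c : Emap W _ _ (scomm x) ∘ ffL W f = ffL W g ∘ sdom x by apply: ffL_nat.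
  by rewrite -[fmap W x]/(Emap W _ _ (scomm x)) (delta_nat c) (mk _ _ y).
- exact: mu_R.
- exact: mu_L.
- move=> f x e0 e1; have c : idm (acod f) ∘ amap f = ffR W f ∘ ffL W f.
    by rewrite ff_fact comp_idl.
  by rewrite -(mu_E c) (mk _ _ x).
- move=> f x e0 e1; have c : idm (acod f) ∘ ffR W (mkArrow (ffR W f)) = ffR W f ∘ mu W f.
    by rewrite mu_R comp_idl.
  by rewrite (mu_assoc c) (mk _ _ x).
- move=> f g x y e0 e1.
  have c : scod x ∘ ffR W f = ffR W g ∘ Emap W _ _ (scomm x) by apply: ffR_nat.
  by rewrite -[fmap W x]/(Emap W _ _ (scomm x)) (mu_nat c) (mk _ _ y).
- move=> f x e0 e1.
  have c : mu W f ∘ ffL W (mkArrow (ffR W f)) = ffR W (mkArrow (ffL W f)) ∘ delta W f.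
    by rewrite mu_L delta_R.
  by rewrite (delta_mu c) (mk _ _ x).
Qed.

Definition op_awfs (W : AWFS M) : AWFS op := make_awfs (op_laws (laws_of_awfs W)).

Definition vs_op (V : VerticalStructure M) : VerticalStructure op.
Proof.
refine (@Build_VerticalStructure op (fun A B => vs_ver V B A) (fun A B u => vs_map u)
  (fun A B A' B' u v h k => vs_sq v u k h) (vs_id V)
  (fun A B C v u => vs_comp u v) _ _ _ _ _ _ _ _ _ _).
- by move=> A; apply: (vs_map_id V A).
- by move=> A B C v u; apply: (@vs_map_comp M V C B A u v).
- by move=> A B A' B' u v h k s; apply: eq_sym (vs_sq_comm s).
- by move=> A B u; apply: (vs_sq_hid u).
- by move=> A B A' B' A'' B'' u v w h k h' k' s s'; apply: vs_sq_hcomp s' s.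
- by move=> A B h; apply: (vs_sq_vid V h).
- by move=> A B C A' B' C' u v u' v' h k l s s'; apply: vs_sq_vcomp s' s.
- by move=> *; apply: eq_sym (vs_assoc _ _ _).
- by move=> A B u; apply: (vs_idr u).
- by move=> A B u; apply: (vs_idl u).
Defined.

Lemma vs_iso_unop (V V' : VerticalStructure M) : vs_iso (vs_op V) (vs_op V') -> vs_iso V V'.
Proof.
move=> i.
refine (@Build_vs_iso M V V' (fun A B u => i B A u) (fun A B u => vi_inv i (A := B) (B := A) u)
          _ _ _ _ _ _).
- by move=> A B u; apply: (vi_funK i).
- by move=> A B u; apply: (vi_invK i).
- by move=> A B u; apply: (vi_map i).
- by move=> A B A' B' u v h k; apply: (vi_sq i).
- by move=> A; apply: (vi_id i).
- by move=> A B C v u; apply: (vi_comp i).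
Defined.

Lemma vs_iso_op (V V' : VerticalStructure M) : vs_iso V V' -> vs_iso (vs_op V) (vs_op V').
Proof.
move=> i.
refine (@Build_vs_iso op (vs_op V) (vs_op V') (fun A B u => i B A u)
  (fun A B u => vi_inv i (A := B) (B := A) u) _ _ _ _ _ _).
- by move=> A B u; apply: (vi_funK i).
- by move=> A B u; apply: (vi_invK i).
- by move=> A B u; apply: (vi_map i).
- by move=> A B A' B' u v h k; apply: (vi_sq i).
- by move=> A; apply: (vi_id i).
- by move=> A B C v u; apply: (vi_comp i).
Defined.

Section Cloven.

Variable F : FunctorialFactorization M.

Definition op_clR (A B : M) (a : ClovenR F B A) : ClovenL (op_ff F) A B :=
  @Build_ClovenL op (op_ff F) A B (clR_map a) (clR_str a) (clR_cod a) (clR_dom a).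

Definition unop_clL (A B : op) (u : ClovenL (op_ff F) A B) : ClovenR F B A :=
  @Build_ClovenR M F B A (clL_map u) (clL_str u) (clL_cod u) (clL_dom u).

Lemma op_clR_square (A B A' B' : M) (a : ClovenR F B A) (b : ClovenR F B' A') h k :
  clR_square b a k h <-> clL_square (op_clR a) (op_clR b) h k.
Proof.
split=> -[c e].
  exists (eq_sym c); rewrite [RHS]e /=.
  congr (_ ∘ _); exact: fmap_square.
exists (eq_sym c); rewrite -[LHS]e /=.
congr (_ ∘ _); exact: fmap_square.
Qed.

Lemma op_clRK (A B : M) (a : ClovenR F B A) : unop_clL (op_clR a) = a.
Proof. by case: a. Qed.

Lemma unop_clLK (A B : op) (u : ClovenL (op_ff F) A B) : op_clR (unop_clL u) = u.
Proof. by case: u. Qed.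

End Cloven.

Definition clovenR_left (W : AWFS M) : cloven_left (vs_op (ClovR_structure W)) (op_ff W).
Proof.
refine (@Build_cloven_left op (vs_op (ClovR_structure W)) (op_ff W)
  (fun A B a => op_clR a) (fun A B u => unop_clL u) _ _ _ _ _).
- by move=> A B u; apply: op_clRK.
- by move=> A B u; apply: unop_clLK.
- by [].
- by move=> A B A' B' a b h k; apply: op_clR_square.
- by move=> A; rewrite /idL /op_clR /=; f_equal; apply: proof_irrelevance.
Defined.

Lemma clL_build_eq (N : Category) (F : FunctorialFactorization N) (A B : N) (f : hom A B)
  s s' p p' q q' : s = s' ->
  @Build_ClovenL N F A B f s p q = @Build_ClovenL N F A B f s' p' q'.
Proof.
by move=> e; subst s'; rewrite (proof_irrelevance _ p p') (proof_irrelevance _ q q').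
Qed.

Lemma op_compR (W : AWFS M) (A B C : M) (b : ClovenR W B C) (a : ClovenR W A B) :
  op_clR (compR b a) = compL (W := op_awfs W) (op_clR a) (op_clR b).
Proof.
have aux : compR_aux b a = compL_aux (W := op_awfs W) (op_clR a) (op_clR b).
  rewrite /compR_aux /filler -comp_assoc.
  apply: (f_equal (fun z => clR_str b ∘ (z ∘ delta W (mkArrow (b ∘ a))))).
  exact: fmap_square.
apply: clL_build_eq.
apply: (eq_trans (eq_sym (@comp_assoc M _ _ _ _ (clR_str a) _ (delta W (mkArrow (b ∘ a)))))).
apply: (f_equal (fun z => clR_str a ∘ (z ∘ delta W (mkArrow (b ∘ a))))).
exact: fmap_square.
Qed.

Lemma op_algebra (W : AWFS M) (A B : M) (a : ClovenR W A B) :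
  is_algebra a <-> is_coalgebra (W := op_awfs W) (op_clR a).
Proof.
have e : Emap W (f := mkArrow (ffR W (mkArrow a))) (g := mkArrow a)
           (clR_str a) (idm B) (alg_comm a)
         = Emap (op_awfs W) (f := mkArrow (op_clR a))
             (g := mkArrow (ffL (op_awfs W) (mkArrow (op_clR a))))
             (idm B) (clL_str (op_clR a)) (coalg_comm (W := op_awfs W) (op_clR a)).
  exact: fmap_square.
by rewrite /is_algebra e.
Qed.

Lemma unop_coalgebra (W : AWFS M) (A B : op) (u : Coalgebra (op_awfs W) A B) :
  is_algebra (unop_clL (coalg_cloven u)).
Proof. by apply/op_algebra; case: u => -[]. Qed.

Definition coalgebras_op (W : AWFS M) :
  vs_iso (vs_op (Alg_structure W)) (Coalg_structure (op_awfs W)).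
Proof.
refine (@Build_vs_iso op (vs_op (Alg_structure W)) (Coalg_structure (op_awfs W))
  (fun A B a => @Build_Coalgebra op (op_awfs W) A B (op_clR (alg_cloven a))
     (proj1 (op_algebra _) (alg_law a)))
  (fun A B u => Build_Algebra (unop_coalgebra u)) _ _ _ _ _ _).
- by move=> A B u; apply: algebra_ext; apply: op_clRK.
- by move=> A B u; apply: coalgebra_ext; apply: unop_clLK.
- by [].
- by move=> A B A' B' a b h k; apply: op_clR_square.
- by move=> A; apply: coalgebra_ext; apply: clL_build_eq.
- by move=> A B C v u; apply: coalgebra_ext; apply: op_compR.
Defined.

(** ** Cofree objects from free ones *)

Section Copointed.

Variables (F : FunctorialFactorization M) (G : Functor (Arrow M) (Ptd (Rpoint F)))
  (e : forall f : Arrow M, hom f (al_ob (G f))).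
Hypotheses (free : forall f, is_free (e f))
  (nat : forall f g (x : @hom (Arrow M) f g), e g ∘ x = proj1_sig (fmap G x) ∘ e f).

Notation CL := (Copt (Lcopoint (op_ff F))).

Lemma op_ptd_law (A : Ptd (Rpoint F)) :
  Lcopoint (op_ff F) (op_arrow (al_ob A))
  ∘ (op_square (al_str A) : @hom (Arrow op) _ (mkArrow (ffL (op_ff F) (op_arrow (al_ob A)))))
  = idm (op_arrow (al_ob A) : Arrow op).
Proof.
apply: square_ext.
- exact: (f_equal (@scod _ _ _) (al_law A)).
- exact: (f_equal (@sdom _ _ _) (al_law A)).
Qed.

Definition op_ptd (A : Ptd (Rpoint F)) : CL := Build_copt_coalgebra (op_ptd_law A).

Lemma op_ptd_hom_law (X Y : Ptd (Rpoint F)) (x : hom (al_ob X) (al_ob Y)) :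
  al_str Y ∘ fmap (Rfunctor F) x = x ∘ al_str X ->
  fmap (Lfunctor (op_ff F)) (op_square x : @hom (Arrow op) _ _) ∘ cp_str (op_ptd Y)
  = cp_str (op_ptd X) ∘ (op_square x : @hom (Arrow op) _ _).
Proof.
move=> q; apply: square_ext.
- exact: (f_equal (@scod _ _ _) q).
- apply: eq_trans (f_equal (@sdom _ _ _) q).
  apply: (f_equal (fun z => sdom (al_str Y) ∘ z)); exact: fmap_square.
Qed.

Definition op_ptd_hom (X Y : Ptd (Rpoint F)) (h : hom X Y) : hom (op_ptd Y) (op_ptd X) :=
  exist _ (op_square (proj1_sig h) : @hom (Arrow op) _ _) (op_ptd_hom_law (proj2_sig h)).

Definition op_ptd_functor : Functor (Arrow op) CL.
Proof.
refine (@Build_Functor (Arrow op) CL (fun f => op_ptd (G (unop_arrow f)))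
  (fun f g x => op_ptd_hom (fmap G (unop_square x : @hom (Arrow M) _ _))) _ _).
- move=> f; apply: sig_ext.
  have -> : fmap G (unop_square (idm f) : @hom (Arrow M) _ _) = idm (G (unop_arrow f)).
    by rewrite -fmap_id; apply: fmap_square.
  exact: square_ext.
- move=> f g h y x; apply: sig_ext.
  have -> : fmap G (unop_square (y ∘ x) : @hom (Arrow M) _ _)
      = fmap G (unop_square x : @hom (Arrow M) _ _) ∘ fmap G (unop_square y : @hom (Arrow M) _ _).
    by rewrite -fmap_comp; apply: fmap_square.
  exact: square_ext.
Defined.

Lemma unop_copt_law (Y : CL) :
  (unop_square (cp_str Y) : @hom (Arrow M) (mkArrow (ffR F (unop_arrow (cp_ob Y)))) _)
  ∘ Rpoint F (unop_arrow (cp_ob Y)) = idm (unop_arrow (cp_ob Y) : Arrow M).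
Proof.
apply: square_ext.
- exact: (f_equal (@scod _ _ _) (cp_law Y)).
- exact: (f_equal (@sdom _ _ _) (cp_law Y)).
Qed.

Definition unop_copt (Y : CL) : Ptd (Rpoint F) :=
  @Build_ptd_algebra _ _ (Rpoint F) (unop_arrow (cp_ob Y)) (unop_square (cp_str Y)) (unop_copt_law Y).

Lemma unop_hom_law (A : Ptd (Rpoint F)) (Y : CL) (y : hom (cp_ob Y) (cp_ob (op_ptd A))) :
  al_str (unop_copt Y) ∘ fmap (Rfunctor F) (unop_square y : @hom (Arrow M) (al_ob A) (unop_arrow (cp_ob Y)))
  = (unop_square y : @hom (Arrow M) (al_ob A) (unop_arrow (cp_ob Y))) ∘ al_str A <->
  fmap (Lfunctor (op_ff F)) y ∘ cp_str Y = cp_str (op_ptd A) ∘ y.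
Proof.
split=> q; apply: square_ext.
- exact: (f_equal (@scod _ _ _) q).
- exact: (f_equal (@sdom _ _ _) q).
- exact: (f_equal (@scod _ _ _) q).
- exact: (f_equal (@sdom _ _ _) q).
Qed.

Definition op_unit (f : Arrow op) : hom (cp_ob (op_ptd_functor f)) f :=
  op_square (e (unop_arrow f)).

Lemma op_ptd_cofree (f : Arrow op) : is_cofree (op_unit f).
Proof.
move=> Y k.
have [h [eh uh]] := @free (unop_arrow f) (unop_copt Y) (unop_square k).
pose y : hom (cp_ob Y) (cp_ob (op_ptd_functor f)) := op_square (proj1_sig h).
have ey : proj1_sig h = unop_square y by apply: square_ext.
have ly := proj2_sig h; rewrite ey in ly.
exists (exist _ y (proj1 (unop_hom_law y) ly)); split.
  by apply: square_ext; [exact: (f_equal (@scod _ _ _) eh)|exact: (f_equal (@sdom _ _ _) eh)].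
move=> h' eh'; apply: sig_ext => /=.
have lh' := proj2 (unop_hom_law (A := G (unop_arrow f)) (proj1_sig h')) (proj2_sig h').
have eq : h = exist _ _ lh'.
  apply: uh.
  by apply: square_ext; [exact: (f_equal (@scod _ _ _) eh')|exact: (f_equal (@sdom _ _ _) eh')].
by rewrite /y eq; apply: square_ext.
Qed.

Lemma op_unit_nat (f g : Arrow op) (x : hom f g) :
  x ∘ op_unit f = op_unit g ∘ proj1_sig (fmap op_ptd_functor x).
Proof.
have q := nat (unop_square x : @hom (Arrow M) (unop_arrow g) (unop_arrow f)).
apply: square_ext.
- exact: (f_equal (@scod _ _ _) q).
- exact: (f_equal (@sdom _ _ _) q).
Qed.

Lemma unop_functor_cofree :
  unop_functor (comp_functor (cod_functor op)
    (comp_functor (copt_forget (Lcopoint (op_ff F))) op_ptd_functor))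
  = comp_functor (dom_functor M) (comp_functor (ptd_forget (Rpoint F)) G).
Proof.
apply: functor_ext => f g x /=.
have -> : (unop_square (op_square x) : @hom (Arrow M) _ _) = x by apply: square_ext.
by [].
Qed.

End Copointed.

(** ** Transport along the duality *)

Lemma presented_unop (V : VerticalStructure op) (F : FunctorialFactorization op) d0 m0 :
  presented V (F := F) d0 m0 ->
  exists (d : forall f : arrow M, hom (unop_ff F f) (unop_ff F (mkArrow (ffL (unop_ff F) f))))
    (m : forall f : arrow M, hom (unop_ff F (mkArrow (ffR (unop_ff F) f))) (unop_ff F f)),
    inhabited (presented V (F := op_ff (unop_ff F)) (op_d m) (op_m d)).
Proof.
move=> p.
have [d1 [m1 p1]] : exists d1 m1, inhabited (presented V (F := op_ff (unop_ff F)) d1 m1).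
  have := op_unop_ff F; move: (op_ff (unop_ff F)) => F' e; subst F'.
  by exists d0, m0.
by exists (fun f => m1 (op_arrow f)), (fun f => d1 (op_arrow f)).
Qed.

Lemma unop_awfs_map (F F' : FunctorialFactorization M)
  (d : forall f : arrow M, hom (F f) (F (mkArrow (ffL F f))))
  (m : forall f : arrow M, hom (F (mkArrow (ffR F f))) (F f))
  (d' : forall f : arrow M, hom (F' f) (F' (mkArrow (ffL F' f))))
  (m' : forall f : arrow M, hom (F' (mkArrow (ffR F' f))) (F' f))
  (t : forall f : arrow op, hom (op_ff F f) (op_ff F' f)) :
  awfs_map (op_d m) (op_m d) (op_d m') (op_m d') t ->
  awfs_map d' m' d m (fun f => t (op_arrow f) : hom (F' f) (F f)).
Proof.
move=> a.
have nat (f g : arrow M) (x : @hom (Arrow M) f g) :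
    (t (op_arrow g) : hom (F' g) (F g)) ∘ fmap F' x = fmap F x ∘ (t (op_arrow f) : hom (F' f) (F f)).
  have [y ->] := unop_square_surj x.
  exact: eq_sym (am_nat a (y : @hom (Arrow op) (op_arrow g) (op_arrow f))).
constructor=> //.
- by move=> f; apply: (am_R a (op_arrow f)).
- by move=> f; apply: (am_L a (op_arrow f)).
- move=> f x; have [y ->] := unop_square_surj x => e0 e1.
  have q := am_m a (f := op_arrow f) (x := y) e1 e0.
  apply: (eq_trans q); rewrite (comp_assoc (fmap F _)) -nat; exact: eq_refl.
- move=> f x; have [y ->] := unop_square_surj x => e0 e1.
  have q := am_d a (f := op_arrow f) (x := y) e1 e0.
  apply: (eq_trans q); rewrite -nat comp_assoc; exact: eq_refl.
Qed.

End Duality.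

(** * The two factorization systems *)

Section Determined.

Variable M : Category.

Lemma cofree_from_copointed (W : AWFS M) (V : VerticalStructure M) (cl : cloven_left V W)
  (F : FunctorialFactorization M) d m (p : presented V (F := F) d m) :
  exists t : forall f : arrow M, hom (W f) (F f),
    (forall f, t f ∘ ffL W f = ffL F f) /\ (forall f, ffR F f ∘ t f = ffR W f).
Proof.
pose C f := cl_inv cl (cofreeL W f).
have mC f : vs_map (C f) = ffL W f by apply: cl_inv_map.
have [t ht] : exists t : forall f : arrow M, hom (W f) (F f),
    forall f, vs_sq (C f) (cofree p f) (idm (adom f)) (t f) /\ ffR F f ∘ t f = ffR W f.
  apply: (@dchoice (arrow M) (fun f => hom (W f) (F f))
    (fun f t => vs_sq (C f) (cofree p f) (idm (adom f)) t /\ ffR F f ∘ t = ffR W f)) => f.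
  by apply: (cofree_ext p (f := f)); rewrite mC ff_fact comp_idr.
exists t; split=> f; last exact: (proj2 (ht f)).
by rewrite -(mC f) (vs_sq_comm (proj1 (ht f))) cofree_map comp_idr.
Qed.

Lemma coalgebras_determine (W W' : AWFS M) :
  vs_iso (Coalg_structure W) (Coalg_structure W') -> awfs_isomorphic W W'.
Proof.
move=> i.
have [t [a inv]] := compare_presented i (coalgebras_presented W) (coalgebras_presented W').
by exists (awfs_morphism_of_map a).
Qed.

Lemma algebras_determine (W W' : AWFS M) :
  vs_iso (Alg_structure W) (Alg_structure W') -> awfs_isomorphic W W'.
Proof.
move=> i.
have j : vs_iso (Coalg_structure (op_awfs W')) (Coalg_structure (op_awfs W)).
  apply: vs_iso_trans (vs_iso_sym (coalgebras_op W')) _.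
  apply: vs_iso_trans (coalgebras_op W).
  exact: vs_iso_op (vs_iso_sym i).
have [t [a inv]] := compare_presented j (coalgebras_presented _) (coalgebras_presented _).
exists (awfs_morphism_of_map (unop_awfs_map a)) => f.
by have [s [s1 s2]] := inv (op_arrow f); exists s; split.
Qed.

Lemma left_closed_of_cloven (W W' : AWFS M) :
  vs_iso (Coalg_structure W') (ClovL_structure W) -> left_retract_closed W'.
Proof.
move=> i f g r [u eu].
have [v ev] : left_class W f.
  apply: left_class_retract r _; exists (i _ _ u).
  exact: eq_trans (vi_map i u) eu.
exists (vi_inv i (v : vs_ver (ClovL_structure W) _ _)).
exact: eq_trans (vi_map (vs_iso_sym i) _) ev.
Qed.

Lemma right_closed_of_cloven (W W' : AWFS M) :
  vs_iso (Alg_structure W') (ClovR_structure W) -> right_retract_closed W'.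
Proof.
move=> i f g r [u eu].
have [v ev] : right_class W f.
  apply: right_class_retract r _; exists (i _ _ u).
  exact: eq_trans (vi_map i u) eu.
exists (vi_inv i (v : vs_ver (ClovR_structure W) _ _)).
exact: eq_trans (vi_map (vs_iso_sym i) _) ev.
Qed.

End Determined.

Theorem sharp_exists (M : Category) (W : AWFS M) : locally_presentable M -> accessible_functor (ffE W) ->
  exists Ws : AWFS M, accessible_functor (ffE Ws) /\
    inhabited (vs_iso (Coalg_structure Ws) (ClovL_structure W)) /\ same_underlying_wfs Ws W.
Proof.
move=> hM hW; have coc := proj1 hM.
have [B [hB [K [rK ltK]] cE [I [Q gQ]]]] := size_bound_exists hM hW.
have cL := Lfunctor_bcontinuous coc cE.
have [G [e [cofree nat]]] := cofree_functor_exists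
  (cofree_exists (Lcopoint W) (arrow_cocomplete coc) hB gQ cL).
have cl := clovenL_left W.
have [F [d [m [[p] eE]]]] := presented_of_cofree cl cofree nat.
have conn := cloven_connected cl.
exists (make_awfs (presented_laws p conn)); split; [|split].
- rewrite /= eE; apply: (bcontinuous_accessible hB rK ltK).
  apply: bcontinuous_comp; first exact: (cofree_bcontinuous (arrow_cocomplete coc) hB gQ cL cofree nat).
  by move=> J D c sJ uc; apply: cod_cocontinuous.
- exact: coalgebras_of_presented (cloven_comonadic cl p).
- have [t [tL [tR _]]] := cofree_to_copointed cl p.
  have [t' [tL' tR']] := cofree_from_copointed cl p.
  exact: (@same_underlying _ (make_awfs (presented_laws p conn)) W t t').
Qed.

Theorem flat_exists (M : Category) (W : AWFS M) : locally_presentable M -> accessible_functor (ffE W) ->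
  exists Wf : AWFS M, accessible_functor (ffE Wf) /\
    inhabited (vs_iso (Alg_structure Wf) (ClovR_structure W)) /\ same_underlying_wfs Wf W.
Proof.
move=> hM hW; have coc := proj1 hM.
have [B [hB [K [rK ltK]] cE [I [Q gQ]]]] := size_bound_exists hM hW.
have cR := Rfunctor_bcontinuous coc cE.
have [G [e [free nat]]] := free_functor_exists (free_exists (Rpoint W) hB gQ cR).
have cl := clovenR_left W.
have [F0 [d0 [m0 [[p0] eE]]]] := presented_of_cofree cl (op_ptd_cofree free) (op_unit_nat nat).
have [d [m [p]]] := presented_unop p0.
have conn := cloven_connected cl.
have laws := presented_laws p conn.
exists (make_awfs (unop_laws laws)); split; [|split].
- rewrite /= eE unop_functor_cofree; apply: (bcontinuous_accessible hB rK ltK).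
  apply: bcontinuous_comp; first exact: (free_bcontinuous gQ cR free nat).
  by move=> J D c sJ uc; apply: dom_cocontinuous.
- have [i] := coalgebras_of_presented conn (cloven_comonadic cl p).
  constructor; apply: vs_iso_unop; apply: vs_iso_trans (coalgebras_op _) _.
  have e1 : op_awfs (make_awfs (unop_laws laws)) = make_awfs (presented_laws p conn).
    exact: (f_equal (fun l => make_awfs l) (proof_irrelevance _ _ _)).
  by rewrite e1.
- have [t [tL [tR _]]] := cofree_to_copointed cl p.
  have [t' [tL' tR']] := cofree_from_copointed (W := op_awfs W) cl p.
  apply: (@same_underlying _ (make_awfs (unop_laws laws)) W
    (fun f => t' (op_arrow f)) (fun f => t (op_arrow f))) => f.
  + exact: (tR' (op_arrow f)).
  + exact: (tL' (op_arrow f)).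
  + exact: (tR (op_arrow f)).
  + exact: (tL (op_arrow f)).
Qed.

Theorem proposition4p5 (M : Category) (hM : locally_presentable M)
  (W : AWFS M) (hW : accessible_awfs W) :
  (exists Wsharp : AWFS M,
     accessible_awfs Wsharp /\
     double_iso_over (Coalg Wsharp) (ClovL W) /\
     (forall W' : AWFS M,
        double_iso_over (Coalg W') (ClovL W) -> awfs_isomorphic W' Wsharp) /\
     left_retract_closed Wsharp /\
     same_underlying_wfs Wsharp W) /\
  (exists Wflat : AWFS M,
     accessible_awfs Wflat /\
     double_iso_over (Alg Wflat) (ClovR W) /\
     (forall W' : AWFS M,
        double_iso_over (Alg W') (ClovR W) -> awfs_isomorphic W' Wflat) /\
     right_retract_closed Wflat /\
     same_underlying_wfs Wflat W).
Proof.
split.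
- have [Ws [acc [[i] same]]] := sharp_exists hM (proj2 hW).
  exists Ws; split; first by split.
  split; first exact: double_iso_of_vs_iso i.
  split; last by split=> //; apply: left_closed_of_cloven i.
  move=> W' /vs_iso_of_double_iso [j]; apply: coalgebras_determine.
  exact: vs_iso_trans j (vs_iso_sym i).
- have [Wf [acc [[i] same]]] := flat_exists hM (proj2 hW).
  exists Wf; split; first by split.
  split; first exact: double_iso_of_vs_iso i.
  split; last by split=> //; apply: right_closed_of_cloven i.
  move=> W' /vs_iso_of_double_iso [j]; apply: algebras_determine.
  exact: vs_iso_trans j (vs_iso_sym i).
Qed.
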